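(* Let $m$ be a positive integer and $0<x<\pi$. Then $$\sum_{n=1}^\infty\frac{(-1)^{n-1}\sin nx}{n^{2m}}=\frac{(-1)^{m}\pi^{2m-1}}{(2m-1)!}\bigg(2^{2m-1}\zeta'\Big(1-2m,1-\frac x{2\pi}\Big)-2^{2m-1}\zeta'\Big(1-2m,\frac x{2\pi}\Big)-\zeta'\Big(1-2m,1-\frac x\pi\Big)+\zeta'\Big(1-2m,\frac x\pi\Big)\bigg).$$
   Context: For $0<a\le 1$, $\zeta(s,a)$ denotes the Hurwitz zeta function, defined for $\Re s>1$ by $\zeta(s,a)=\sum_{k=0}^\infty (k+a)^{-s}$ and extended by analytic continuation to all complex $s\neq 1$. Throughout, $\zeta'(s,a)$ denotes the partial derivative $\frac{\partial}{\partial s}\zeta(s,a)$ with respect to the first variable $s$. *)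

(* Defs.v *)
From Stdlib Require Import Reals Factorial.
From Coquelicot Require Import Coquelicot.
Open Scope R_scope.

(* b^(-s) for a real base b > 0 and complex s, i.e. exp(-s * ln b). *)
Definition cpow_neg (b : R) (s : C) : C :=
  let t := ln b in
  (exp (- Re s * t) * cos (- Im s * t), exp (- Re s * t) * sin (- Im s * t)).

(* Z is (the) Hurwitz zeta function: for each 0 < a <= 1, s |-> Z a s is
   holomorphic on C \ {1} and equals sum_{k>=0} (k+a)^(-s) for Re s > 1.
   By the identity theorem such Z a is unique (the analytic continuation). *)
Definition is_hurwitz_zeta (Z : R -> C -> C) : Prop :=
  forall a : R, 0 < a <= 1 ->
    (forall s : C, s <> RtoC 1 -> ex_derive (Z a) s) /\
    (forall s : C, 1 < Re s ->
        is_series (fun k : nat => cpow_neg (INR k + a) s) (Z a s)).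

Definition hurwitz_zeta' (Z : R -> C -> C) (s : C) (a : R) : C :=
  C_derive (Z a) s.

(* Main.v *)
(* Only the difference D(s) = zeta(s, a) - zeta(s, 1 - a) matters. With
   q(t) = Re cot (PI (a + i t)), its continuation is
     D(s) = 2 cos (PI s / 2) * int_0^infinity t^(-s) q(t) dt      (Re s < 1).
   Since the cosine vanishes at s = 1 - 2m, D'(1 - 2m) is the derivative of the cosine there times
   the integral of t^(2m-1) q(t), and q(t) = 2 sum_n exp(-2 PI n t) sin(2 PI n a) turns this
   integral into the series sum_n sin(2 PI n a) / n^(2m) up to a factor. Taking a = x / (2 PI) and
   a = x / PI and combining the two series gives the alternating one.

   For 2 < Re s < 3 the formula follows from the partial fractions of the cotangent and from
   int_0^infinity t^(-s) / (1 + t^2) dt = PI / (2 cos (PI s / 2)), |Re s| < 1, after subtracting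
   from q multiples of 1 and of 1 / (1 + t^2), which carries it across Re s = 1. It extends to
   Re s < 0 by unique continuation, which only needs Goursat's theorem: Goursat in logarithmic
   coordinates gives the bound of |f| at the center of a disc by its values on the circle, and this
   bound applied to f / (z - p)^n spreads the zeros of f.

   All integrals are written in the variable u = ln t, so they run over the whole line. *)

Require Import Defs.
From Stdlib Require Import Reals Factorial Lra Lia Psatz Classical ClassicalEpsilon.
From Coquelicot Require Import Coquelicot.
Open Scope R_scope.

(** * Complex derivatives and continuity *)

(** The difference is accessible because the sums over k + a and k + 1 - a join into the two-sided
    expansion of the cotangent. The obstacle is convergence: the Mellin integrals of q and of cot
    (PI a) - q live on the adjacent half-plane Re s < 1 and strip 1 < Re s < 3, which share no
    point. The function q - cot (PI a) / (1 + t^2) is small at both ends, and its strip -1 < Re s <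
    3 overlaps both regions. The comparison with the series starts at Re s = 2 because the tails of
    the partial fractions are bounded by t^2 / (1 + t), which is of order t at infinity. The partial
    fractions come from Herglotz's trick: the defect obeys the duplication formula of the cotangent
    and is O(t) uniformly in a. In the secant integral a constant subtracted from the numerator
    removes the pole at i PI / 2, so a rectangle integral that vanishes takes the place of a
    residue. Sums and integrals are exchanged by hand: a finite sum is integrated exactly, and the
    remainder is dominated by exp (- d |u|) with a coefficient of order 1 / N. *)

Notation Cder f z l := (@is_derive C_AbsRing C_NormedModule f (z : C) (l : C)).
Notation RCder f t l := (@is_derive R_AbsRing C_R_NormedModule f t (l : C)).
Notation RCcont f t := (@continuous R_UniformSpace (NormedModule.UniformSpace R_AbsRing C_R_NormedModule) f t).

(* Kept opaque: otherwise conversion unfolds the integral when comparing different integrals. *)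
Definition RCInt (f : R -> C) (a b : R) : C := @RInt C_R_CompleteNormedModule f a b.
Global Opaque RCInt.
Notation is_RCInt f a b l := (@is_RInt C_R_NormedModule f a b (l : C)).

Lemma Cmod_sym (x y : C) : Cmod (x - y) = Cmod (y - x).
Proof. rewrite <- Cmod_opp; f_equal; ring. Qed.

Lemma Cmod_minus_triangle (x y : C) : Cmod (x - y) <= Cmod x + Cmod y.
Proof.
  unfold Cminus; eapply Rle_trans; [apply Cmod_triangle|]; rewrite Cmod_opp; lra.
Qed.

Lemma Cmod_le_add (x y : C) : Cmod x <= Cmod y + Cmod (x - y).
Proof.
  replace x with (y + (x - y))%C at 1 by ring; apply Cmod_triangle.
Qed.

Lemma Cmod_le_Rabs (x y : R) : Cmod (x, y) <= Rabs x + Rabs y.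
Proof.
  replace (x, y) with (RtoC x + Ci * RtoC y)%C
    by (unfold RtoC, Ci, Cplus, Cmult; simpl; f_equal; ring).
  eapply Rle_trans; [apply Cmod_triangle|].
  rewrite Cmod_mult, !Cmod_R, Cmod_Ci; lra.
Qed.

Lemma im_le_Cmod (z : C) : Rabs (Im z) <= Cmod z.
Proof.
  eapply Rle_trans; [|apply Rmax_Cmod]; apply Rmax_r.
Qed.

Lemma Cder_eps (f : C -> C) (z l : C) :
  Cder f z l <->
  forall eps, 0 < eps -> exists d, 0 < d /\ forall y : C, Cmod (y - z) < d ->
    Cmod (f y - f z - (y - z) * l) <= eps * Cmod (y - z).
Proof.
  split.
  - intros [_ H] eps He.
    destruct (H z (fun P HP => HP) (mkposreal eps He)) as [d Hd].
    exists d; split; [apply cond_pos|]. intros y Hy; apply (Hd y Hy).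
  - intros H; split; [apply is_linear_scal_l|].
    intros x Hx eps.
    assert (x = z) as ->.
    { apply (is_filter_lim_locally_unique (V := AbsRing_NormedModule C_AbsRing)) in Hx; easy. }
    destruct (H eps (cond_pos eps)) as [d [Hd H']].
    exists (mkposreal d Hd); intros y Hy; apply (H' y Hy).
Qed.

(** A second order remainder suffices; the inverse, the exponential, [Cexp1] at 0 and the Mellin
    transforms are all differentiated through this criterion. *)
Lemma Cder_quadratic (f : C -> C) (z l : C) (d K : R) : 0 < d ->
  (forall h : C, Cmod h < d -> Cmod (f (z + h)%C - f z - h * l) <= K * Cmod h ^ 2) ->
  Cder f z l.
Proof.
  intros Hd H; apply Cder_eps; intros eps He.
  assert (HK := Rabs_pos K).
  exists (Rmin d (eps / (Rabs K + 1))); split.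
  - apply Rmin_pos; auto; apply Rdiv_lt_0_compat; lra.
  - intros y Hy.
    replace y with (z + (y - z))%C at 1 by ring.
    eapply Rle_trans; [apply H; eapply Rlt_le_trans; [apply Hy|apply Rmin_l]|].
    assert (H1 := Rlt_le_trans _ _ _ Hy (Rmin_r _ _)).
    assert (H0 := Cmod_ge_0 (y - z)).
    set (m := Cmod (y - z)) in *.
    assert (m * (Rabs K + 1) <= eps).
    { apply Rmult_lt_compat_r with (r := Rabs K + 1) in H1; [|lra].
      unfold Rdiv in H1; rewrite Rmult_assoc, Rinv_l in H1; lra. }
    assert (K <= Rabs K) by apply Rle_abs.
    nra.
Qed.

Lemma Cder_continuous (f : C -> C) (z l : C) : Cder f z l ->
  forall eps, 0 < eps -> exists d, 0 < d /\ forall y : C, Cmod (y - z) < d ->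
    Cmod (f y - f z) < eps.
Proof.
  intros H eps He; destruct (proj1 (Cder_eps f z l) H 1 Rlt_0_1) as [d [Hd Hf]].
  assert (Hl := Cmod_ge_0 l).
  exists (Rmin d (eps / (Cmod l + 2))); split.
  - apply Rmin_pos; auto; apply Rdiv_lt_0_compat; lra.
  - intros y Hy.
    assert (H1 := Rlt_le_trans _ _ _ Hy (Rmin_l _ _)).
    assert (H2 := Rlt_le_trans _ _ _ Hy (Rmin_r _ _)).
    specialize (Hf y H1).
    assert (H0 := Cmod_ge_0 (y - z)).
    apply Rmult_lt_compat_r with (r := Cmod l + 2) in H2; [|lra].
    unfold Rdiv in H2; rewrite Rmult_assoc, Rinv_l, Rmult_1_r in H2 by lra.
    replace (f y - f z)%C with ((f y - f z - (y - z) * l) + (y - z) * l)%C by ring.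
    eapply Rle_lt_trans; [apply Cmod_triangle|].
    rewrite Cmod_mult; nra.
Qed.

Lemma Cder_const (c z : C) : Cder (fun _ => c) z 0%C.
Proof.
  apply Cder_quadratic with 1 0; [lra|]; intros h _.
  replace (c - c - h * 0)%C with (RtoC 0) by ring; rewrite Cmod_0; lra.
Qed.

Lemma Cder_id (z : C) : Cder (fun w => w) z 1%C.
Proof.
  apply Cder_quadratic with 1 0; [lra|]; intros h _.
  replace (z + h - z - h * 1)%C with (RtoC 0) by ring; rewrite Cmod_0; lra.
Qed.

Lemma Cder_plus (f g : C -> C) (z df dg : C) :
  Cder f z df -> Cder g z dg -> Cder (fun w => f w + g w)%C z (df + dg)%C.
Proof. exact (is_derive_plus f g z df dg). Qed.

Lemma Cder_ext (f g : C -> C) (z l l' : C) :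
  (forall w, f w = g w) -> l = l' -> Cder f z l -> Cder g z l'.
Proof. intros H -> ; apply is_derive_ext; exact H. Qed.

Lemma Cder_ext_near (f g : C -> C) (z l : C) (d : R) : 0 < d ->
  (forall w, Cmod (w - z) < d -> f w = g w) -> Cder f z l -> Cder g z l.
Proof.
  intros Hd H; apply is_derive_ext_loc; exists (mkposreal d Hd); intros y Hy; apply H, Hy.
Qed.

Lemma Cder_mult (f g : C -> C) (z df dg : C) :
  Cder f z df -> Cder g z dg -> Cder (fun w => f w * g w)%C z (df * g z + f z * dg)%C.
Proof.
  intros Hf Hg; apply Cder_eps; intros eps He.
  assert (HA := Cmod_ge_0 (g z)); assert (HB := Cmod_ge_0 (f z)); assert (HC := Cmod_ge_0 df).
  set (K := Cmod (f z) + Cmod (g z) + Cmod df + 2).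
  assert (HK : 0 < K) by (unfold K; lra).
  assert (He' : 0 < eps / K) by (apply Rdiv_lt_0_compat; lra).
  destruct (proj1 (Cder_eps f z df) Hf _ He') as [d1 [Hd1 H1]].
  destruct (proj1 (Cder_eps g z dg) Hg _ He') as [d2 [Hd2 H2]].
  assert (Hm : 0 < Rmin 1 (eps / K)) by (apply Rmin_pos; lra).
  destruct (Cder_continuous g z dg Hg _ Hm) as [d3 [Hd3 H3]].
  exists (Rmin d1 (Rmin d2 d3)); split; [repeat apply Rmin_pos; auto|].
  intros y Hy.
  assert (Hy1 := Rlt_le_trans _ _ _ Hy (Rmin_l _ _)).
  assert (Hy' := Rlt_le_trans _ _ _ Hy (Rmin_r _ _)).
  assert (Hy2 := Rlt_le_trans _ _ _ Hy' (Rmin_l _ _)).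
  assert (Hy3 := Rlt_le_trans _ _ _ Hy' (Rmin_r _ _)).
  specialize (H1 y Hy1); specialize (H2 y Hy2); specialize (H3 y Hy3).
  assert (H4 := Rlt_le_trans _ _ _ H3 (Rmin_l _ _)).
  assert (H5 := Rlt_le_trans _ _ _ H3 (Rmin_r _ _)).
  replace (f y * g y - f z * g z - (y - z) * (df * g z + f z * dg))%C
    with ((f y - f z - (y - z) * df) * g y + f z * (g y - g z - (y - z) * dg)
          + (y - z) * df * (g y - g z))%C by ring.
  assert (Hgy := Cmod_le_add (g y) (g z)).
  assert (H0 := Cmod_ge_0 (y - z)).
  assert (HK' : eps = eps / K * K) by (field; lra).
  eapply Rle_trans; [apply Cmod_triangle|].
  eapply Rle_trans; [apply Rplus_le_compat_r, Cmod_triangle|].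
  rewrite !Cmod_mult.
  assert (Cmod (f y - f z - (y - z) * df) * Cmod (g y) <= (eps / K * Cmod (y - z)) * (Cmod (g z) + 1)).
  { apply Rmult_le_compat; auto using Cmod_ge_0; lra. }
  assert (Cmod (f z) * Cmod (g y - g z - (y - z) * dg) <= Cmod (f z) * (eps / K * Cmod (y - z))).
  { apply Rmult_le_compat_l; auto. }
  assert (Cmod (y - z) * Cmod df * Cmod (g y - g z) <= Cmod (y - z) * Cmod df * (eps / K)).
  { apply Rmult_le_compat_l; [apply Rmult_le_pos; auto|lra]. }
  rewrite HK' at 1. unfold K at 2. 
  assert (0 <= eps / K * Cmod (y - z)) by (apply Rmult_le_pos; lra).
  nra.
Qed.

Lemma Cder_scal (c : C) (f : C -> C) (z l : C) :
  Cder f z l -> Cder (fun w => c * f w)%C z (c * l)%C.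
Proof.
  intros H; eapply Cder_ext; [| |apply (Cder_mult (fun _ => c) f _ _ _ (Cder_const c z) H)].
  - reflexivity.
  - ring.
Qed.

Lemma Cder_opp (f : C -> C) (z l : C) :
  Cder f z l -> Cder (fun w => - f w)%C z (- l)%C.
Proof.
  intros H; eapply Cder_ext; [| |apply (Cder_scal (-(1))%C f z l H)].
  - intros; simpl; ring.
  - ring.
Qed.

Lemma Cder_minus (f g : C -> C) (z df dg : C) :
  Cder f z df -> Cder g z dg -> Cder (fun w => f w - g w)%C z (df - dg)%C.
Proof.
  intros Hf Hg; exact (Cder_plus f (fun w => - g w)%C z df (- dg)%C Hf (Cder_opp g z dg Hg)).
Qed.

Lemma Cder_comp (f g : C -> C) (z df dg : C) :
  Cder f (g z) df -> Cder g z dg -> Cder (fun w => f (g w)) z (dg * df)%C.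
Proof.
  intros Hf Hg; apply Cder_eps; intros eps He.
  assert (HA := Cmod_ge_0 dg); assert (HB := Cmod_ge_0 df).
  set (K := Cmod dg + Cmod df + 2).
  assert (HK : 0 < K) by (unfold K; lra).
  assert (He' : 0 < eps / K) by (apply Rdiv_lt_0_compat; lra).
  destruct (proj1 (Cder_eps f (g z) df) Hf _ He') as [d1 [Hd1 H1]].
  assert (Hm : 0 < Rmin 1 (eps / K)) by (apply Rmin_pos; lra).
  destruct (proj1 (Cder_eps g z dg) Hg _ Hm) as [d2 [Hd2 H2]].
  destruct (Cder_continuous g z dg Hg _ Hd1) as [d3 [Hd3 H3]].
  exists (Rmin d2 d3); split; [apply Rmin_pos; auto|].
  intros y Hy.
  assert (Hy2 := Rlt_le_trans _ _ _ Hy (Rmin_l _ _)).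
  assert (Hy3 := Rlt_le_trans _ _ _ Hy (Rmin_r _ _)).
  specialize (H2 y Hy2); specialize (H1 (g y) (H3 y Hy3)).
  assert (H0 := Cmod_ge_0 (y - z)).
  assert (H4 : Cmod (g y - g z - (y - z) * dg) <= 1 * Cmod (y - z)).
  { eapply Rle_trans; [apply H2|]; apply Rmult_le_compat_r; auto; apply Rmin_l. }
  assert (H5 : Cmod (g y - g z - (y - z) * dg) <= eps / K * Cmod (y - z)).
  { eapply Rle_trans; [apply H2|]; apply Rmult_le_compat_r; auto; apply Rmin_r. }
  replace (f (g y) - f (g z) - (y - z) * (dg * df))%C
    with ((f (g y) - f (g z) - (g y - g z) * df) + (g y - g z - (y - z) * dg) * df)%C by ring.
  assert (H6 : Cmod (g y - g z) <= (1 + Cmod dg) * Cmod (y - z)).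
  { replace (g y - g z)%C with ((g y - g z - (y - z) * dg) + (y - z) * dg)%C by ring.
    eapply Rle_trans; [apply Cmod_triangle|]; rewrite Cmod_mult; lra. }
  assert (HK' : eps = eps / K * K) by (field; lra).
  eapply Rle_trans; [apply Cmod_triangle|].
  rewrite Cmod_mult.
  assert (Cmod (f (g y) - f (g z) - (g y - g z) * df) <= eps / K * ((1 + Cmod dg) * Cmod (y - z))).
  { eapply Rle_trans; [apply H1|]; apply Rmult_le_compat_l; lra. }
  assert (Cmod (g y - g z - (y - z) * dg) * Cmod df <= (eps / K * Cmod (y - z)) * Cmod df).
  { apply Rmult_le_compat_r; auto. }
  rewrite HK' at 1; unfold K at 2.
  assert (0 <= eps / K * Cmod (y - z)) by (apply Rmult_le_pos; lra).
  nra.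
Qed.

Lemma Cder_inv (z : C) : z <> 0%C -> Cder (fun w => / w)%C z (- / (z * z))%C.
Proof.
  intros Hz; assert (Hm := proj1 (Cmod_gt_0 z) Hz).
  apply Cder_quadratic with (Cmod z / 2) (2 / Cmod z ^ 3); [lra|].
  intros h Hh.
  assert (H1 : Cmod z / 2 <= Cmod (z + h)).
  { assert (H := Cmod_minus_triangle (z + h) h).
    replace (z + h - h)%C with z in H by ring; lra. }
  assert (Hzh : (z + h)%C <> 0%C) by (apply Cmod_gt_0; lra).
  replace (/ (z + h) - / z - h * - / (z * z))%C with (h * h * / (z * z) * / (z + h))%C
    by (field; auto).
  rewrite !Cmod_mult, !Cmod_inv, Cmod_mult by (auto; apply Cmult_neq_0; auto).
  assert (H2 : / Cmod (z + h) <= / (Cmod z / 2)) by (apply Rinv_le_contravar; lra).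
  replace (2 / Cmod z ^ 3 * Cmod h ^ 2) with
     (Cmod h * Cmod h * / (Cmod z * Cmod z) * / (Cmod z / 2)) by (field; lra).
  apply Rmult_le_compat_l; auto.
  apply Rmult_le_pos; [apply Rmult_le_pos; apply Cmod_ge_0|].
  left; apply Rinv_0_lt_compat; nra.
Qed.

Lemma Cder_unique (f : C -> C) (z l1 l2 : C) : Cder f z l1 -> Cder f z l2 -> l1 = l2.
Proof.
  intros H1 H2; rewrite <- (is_C_derive_unique f z l1), <- (is_C_derive_unique f z l2); auto.
Qed.

(** As a real normed module C carries the norm of a product; this bridge lets the general integral
    estimates be used with [Cmod]. *)
Lemma RC_norm (z : C) : @norm R_AbsRing C_R_NormedModule z = Cmod z.
Proof. symmetry; apply Cmod_norm. Qed.

Lemma RCcont_eps (f : R -> C) (t : R) :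
  RCcont f t <->
  forall eps, 0 < eps -> exists d, 0 < d /\ forall y, Rabs (y - t) < d -> Cmod (f y - f t) < eps.
Proof.
  unfold continuous; rewrite (filterlim_locally_ball_norm (K := R_AbsRing) (U := C_R_NormedModule)); split.
  - intros H eps He; destruct (H (mkposreal eps He)) as [d Hd].
    exists d; split; [apply cond_pos|]; intros y Hy; specialize (Hd y Hy).
    unfold ball_norm in Hd; rewrite RC_norm in Hd; exact Hd.
  - intros H eps; destruct (H eps (cond_pos eps)) as [d [Hd H']].
    exists (mkposreal d Hd); intros y Hy; unfold ball_norm; rewrite RC_norm; apply (H' y Hy).
Qed.

Lemma RCcont_ext (f g : R -> C) (t : R) : (forall u, f u = g u) -> RCcont f t -> RCcont g t.
Proof. intros H; apply (continuous_ext f g); exact H. Qed.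

Lemma RCder_ext (f g : R -> C) (t : R) (l : C) :
  (forall u, f u = g u) -> RCder f t l -> RCder g t l.
Proof. intros H; apply (is_derive_ext f g); exact H. Qed.

Lemma RCcont_pair (a b : R -> R) (t : R) :
  continuous a t -> continuous b t -> RCcont (fun u => (a u, b u) : C) t.
Proof.
  intros Ha Hb.
  apply RCcont_eps; intros eps He.
  assert (He2 : 0 < eps / 2) by lra.
  destruct (proj1 (filterlim_locally _ _) Ha (mkposreal _ He2)) as [d1 H1].
  destruct (proj1 (filterlim_locally _ _) Hb (mkposreal _ He2)) as [d2 H2].
  exists (Rmin d1 d2); split; [apply Rmin_pos; apply cond_pos|].
  intros y Hy.
  specialize (H1 y (Rlt_le_trans _ _ _ Hy (Rmin_l _ _))).
  specialize (H2 y (Rlt_le_trans _ _ _ Hy (Rmin_r _ _))).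
  change (Rabs (a y - a t) < eps / 2) in H1; change (Rabs (b y - b t) < eps / 2) in H2.
  unfold Cminus, Cplus, Copp; simpl.
  eapply Rle_lt_trans; [apply Cmod_le_Rabs|]; unfold Rminus in *; lra.
Qed.

Lemma RCcont_RtoC (a : R -> R) (t : R) : continuous a t -> RCcont (fun u => RtoC (a u)) t.
Proof. intros H; apply RCcont_pair; auto; apply continuous_const. Qed.

Lemma RCcont_comp (f : C -> C) (g : R -> C) (t : R) (l : C) :
  Cder f (g t) l -> RCcont g t -> RCcont (fun u => f (g u)) t.
Proof.
  intros Hf Hg; apply RCcont_eps; intros eps He.
  destruct (Cder_continuous f _ l Hf eps He) as [d [Hd H]].
  destruct (proj1 (RCcont_eps g t) Hg d Hd) as [d' [Hd' H']].
  exists d'; split; auto.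
Qed.

Lemma RCcont_plus (f g : R -> C) (t : R) :
  RCcont f t -> RCcont g t -> RCcont (fun u => f u + g u)%C t.
Proof. exact (continuous_plus f g t). Qed.

Lemma RCcont_mult (f g : R -> C) (t : R) :
  RCcont f t -> RCcont g t -> RCcont (fun u => f u * g u)%C t.
Proof.
  intros Hf Hg; apply RCcont_eps; intros eps He.
  assert (HA := Cmod_ge_0 (g t)); assert (HB := Cmod_ge_0 (f t)).
  set (K := Cmod (f t) + Cmod (g t) + 2).
  assert (HK : 0 < K) by (unfold K; lra).
  assert (He' : 0 < Rmin 1 (eps / K)).
  { apply Rmin_pos; [lra|]; apply Rdiv_lt_0_compat; lra. }
  destruct (proj1 (RCcont_eps f t) Hf _ He') as [d1 [Hd1 H1]].
  destruct (proj1 (RCcont_eps g t) Hg _ He') as [d2 [Hd2 H2]].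
  exists (Rmin d1 d2); split; [apply Rmin_pos; auto|].
  intros y Hy.
  specialize (H1 y (Rlt_le_trans _ _ _ Hy (Rmin_l _ _))).
  specialize (H2 y (Rlt_le_trans _ _ _ Hy (Rmin_r _ _))).
  assert (H3 := Rlt_le_trans _ _ _ H1 (Rmin_r _ _)).
  assert (H4 := Rlt_le_trans _ _ _ H2 (Rmin_r _ _)).
  assert (H5 := Rlt_le_trans _ _ _ H2 (Rmin_l _ _)).
  replace (f y * g y - f t * g t)%C with ((f y - f t) * g y + f t * (g y - g t))%C by ring.
  eapply Rle_lt_trans; [apply Cmod_triangle|]; rewrite !Cmod_mult.
  assert (H6 := Cmod_le_add (g y) (g t)).
  assert (HK' : eps = eps / K * K) by (field; lra).
  assert (0 < eps / K) by (apply Rdiv_lt_0_compat; lra).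
  assert (H7 := Cmod_ge_0 (f y - f t)); assert (H8 := Cmod_ge_0 (g y - g t)).
  assert (Cmod (f y - f t) * Cmod (g y) <= eps / K * (Cmod (g t) + 1))
    by (apply Rmult_le_compat; auto using Cmod_ge_0; lra).
  assert (Cmod (f t) * Cmod (g y - g t) <= Cmod (f t) * (eps / K))
    by (apply Rmult_le_compat_l; lra).
  rewrite HK'; unfold K at 2; nra.
Qed.

Lemma RCcont_const (c : C) (t : R) : RCcont (fun _ => c) t.
Proof. exact (continuous_const c t). Qed.

Lemma RCder_pair (a b : R -> R) (t da db : R) :
  is_derive a t da -> is_derive b t db -> RCder (fun u => (a u, b u) : C) t (da, db).
Proof.
  intros [_ Ha] [_ Hb]; split; [apply is_linear_scal_l|].
  intros x Hx eps.
  assert (He2 : 0 < eps / 2) by (generalize (cond_pos eps); lra).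
  specialize (Ha x Hx (mkposreal _ He2)); specialize (Hb x Hx (mkposreal _ He2)).
  generalize (filter_and _ _ Ha Hb); apply filter_imp; intros y [H1 H2].
  rewrite RC_norm; eapply Rle_trans; [apply (Cmod_le_Rabs (a y - a x - (y - x) * da) (b y - b x - (y - x) * db))|].
  change (Rabs (a y - a x - (y - x) * da) <= eps / 2 * Rabs (y - x)) in H1.
  change (Rabs (b y - b x - (y - x) * db) <= eps / 2 * Rabs (y - x)) in H2.
  change (Rabs (a y - a x - (y - x) * da) + Rabs (b y - b x - (y - x) * db) <= eps * Rabs (y - x)).
  lra.
Qed.

Lemma norm_RCInt_le_const (f : R -> C) (a b : R) (l : C) (M : R) : a <= b ->
  (forall x, a <= x <= b -> Cmod (f x) <= M) -> is_RCInt f a b l -> Cmod l <= (b - a) * M.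
Proof.
  intros Hab Hf Hl; rewrite <- RC_norm; refine (norm_RInt_le_const (V := C_R_NormedModule) f a b l M Hab _ Hl).
  intros x Hx; rewrite RC_norm; auto.
Qed.

(** * The complex exponential *)

Lemma exp_le (x y : R) : x <= y -> exp x <= exp y.
Proof. intros [H| ->]; [left; apply exp_increasing; auto|lra]. Qed.

Lemma RtoC_nz (x : R) : x <> 0 -> RtoC x <> 0%C.
Proof. intros H E; apply H; injection E; auto. Qed.

Definition Cexp (z : C) : C := (exp (Re z) * cos (Im z), exp (Re z) * sin (Im z)).

Lemma Cexp_plus (z w : C) : Cexp (z + w) = (Cexp z * Cexp w)%C.
Proof.
  unfold Cexp; rewrite re_plus, im_plus, exp_plus, cos_plus, sin_plus.
  unfold Cmult; simpl; f_equal; ring.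
Qed.

Lemma Cexp_RtoC (x : R) : Cexp (RtoC x) = RtoC (exp x).
Proof. unfold Cexp, RtoC; simpl; rewrite cos_0, sin_0; f_equal; ring. Qed.

Lemma Cexp_0 : Cexp 0 = 1%C.
Proof. rewrite Cexp_RtoC, exp_0; reflexivity. Qed.

Lemma Cmod_Cexp (z : C) : Cmod (Cexp z) = exp (Re z).
Proof.
  unfold Cmod, Cexp; simpl.
  replace (_ + _) with (Rsqr (exp (Re z)) * (Rsqr (sin (Im z)) + Rsqr (cos (Im z))))
    by (unfold Rsqr; ring).
  rewrite sin2_cos2, Rmult_1_r; apply sqrt_Rsqr; left; apply exp_pos.
Qed.

Lemma Cexp_nz (z : C) : Cexp z <> 0%C.
Proof. apply Cmod_gt_0; rewrite Cmod_Cexp; apply exp_pos. Qed.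

Lemma Cexp_opp (z : C) : (Cexp z * Cexp (- z))%C = 1%C.
Proof. rewrite <- Cexp_plus; replace (z + - z)%C with (RtoC 0) by ring; apply Cexp_0. Qed.

Lemma Cexp_inv (z : C) : Cexp (- z) = (/ Cexp z)%C.
Proof.
  rewrite <- (Cmult_1_l (/ Cexp z)), <- (Cexp_opp z); field; apply Cexp_nz.
Qed.

Lemma Re_le_abs_Cmod (z : C) : Re z <= Cmod z.
Proof. eapply Rle_trans; [apply Rle_abs|apply re_le_Cmod]. Qed.

Lemma RCder_Cexp_line (z : C) (t : R) :
  RCder (fun t : R => Cexp (t * z)) t (z * Cexp (t * z))%C.
Proof.
  destruct z as [a b].
  assert (E : forall u : R, ((u * (a, b))%C : C) = (u * a, u * b))
    by (intros u; unfold Cmult, RtoC; simpl; f_equal; ring).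
  rewrite E; unfold Cexp at 2; simpl; unfold Cmult at 2; simpl.
  apply (RCder_ext (fun u : R => (exp (u * a) * cos (u * b), exp (u * a) * sin (u * b)) : C)).
  { intros u; rewrite E; reflexivity. }
  apply RCder_pair; auto_derive; auto; ring.
Qed.

Lemma RCcont_Cexp_line (z : C) (t : R) : RCcont (fun t : R => Cexp (t * z)) t.
Proof.
  apply (ex_derive_continuous (K := R_AbsRing) (V := C_R_NormedModule)).
  eexists; apply RCder_Cexp_line.
Qed.

(** Complex values admit no intermediate point, so the mean value inequality comes from integrating
    the derivative. *)
Lemma RC_mean_value (f df : R -> C) (M : R) :
  (forall t, RCder f t (df t)) -> (forall t, RCcont df t) ->
  (forall t, 0 <= t <= 1 -> Cmod (df t) <= M) -> Cmod (f 1 - f 0) <= M.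
Proof.
  intros Hd Hc HM.
  replace M with ((1 - 0) * M) by ring.
  apply (norm_RCInt_le_const df 0 1); [lra|apply HM|].
  apply (is_RInt_derive (V := C_R_CompleteNormedModule) f df); auto.
Qed.

Lemma RCder_minus (f g : R -> C) (t : R) (df dg : C) :
  RCder f t df -> RCder g t dg -> RCder (fun u => f u - g u)%C t (df - dg)%C.
Proof. exact (is_derive_minus (K := R_AbsRing) (V := C_R_NormedModule) f g t df dg). Qed.

(** The three exponential bounds use the mean value inequality along t z, 0 <= t <= 1: the
    derivative in t of a Taylor remainder is z times the preceding remainder. *)
Lemma Cexp_bound1 (z : C) : Cmod (Cexp z - 1) <= Cmod z * exp (Cmod z).
Proof.
  replace (Cexp z - 1)%C with (Cexp (RtoC 1 * z) - Cexp (RtoC 0 * z))%C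
    by (rewrite Cmult_0_l, Cmult_1_l, Cexp_0; reflexivity).
  apply (RC_mean_value (fun t => Cexp (RtoC t * z)) (fun t => z * Cexp (RtoC t * z))%C).
  - intros t; apply RCder_Cexp_line.
  - intros t; apply RCcont_mult; [apply RCcont_const|apply RCcont_Cexp_line].
  - intros t Ht; rewrite Cmod_mult, Cmod_Cexp; apply Rmult_le_compat_l; [apply Cmod_ge_0|].
    apply exp_le; eapply Rle_trans; [apply Re_le_abs_Cmod|].
    rewrite Cmod_mult, Cmod_R, Rabs_right by lra.
    generalize (Cmod_ge_0 z); nra.
Qed.

Lemma RCder_line (z : C) (t : R) : RCder (fun t : R => (t * z)%C) t z.
Proof.
  destruct z as [a b].
  apply (RCder_ext (fun u : R => (u * a, u * b) : C)).
  { intros u; unfold Cmult, RtoC; simpl; f_equal; ring. }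
  apply RCder_pair; auto_derive; auto; ring.
Qed.

Lemma RCcont_line (z : C) (t : R) : RCcont (fun t : R => (t * z)%C) t.
Proof. apply RCcont_mult; [apply RCcont_RtoC, continuous_id|apply RCcont_const]. Qed.

Lemma Cmod_exp_scal (t : R) (z : C) : 0 <= t <= 1 ->
  Cmod (t * z) <= Cmod z /\ exp (Cmod (t * z)) <= exp (Cmod z).
Proof.
  intros Ht; assert (Cmod (t * z) <= Cmod z).
  { rewrite Cmod_mult, Cmod_R, Rabs_right by lra; generalize (Cmod_ge_0 z); nra. }
  split; auto; apply exp_le; auto.
Qed.

Lemma Cexp_bound2 (z : C) : Cmod (Cexp z - 1 - z) <= Cmod z ^ 2 * exp (Cmod z).
Proof.
  replace (Cexp z - 1 - z)%C with ((Cexp (RtoC 1 * z) - RtoC 1 * z) - (Cexp (RtoC 0 * z) - RtoC 0 * z))%C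
    by (rewrite Cmult_0_l, Cmult_1_l, Cexp_0; ring).
  apply (RC_mean_value (fun t => Cexp (RtoC t * z) - RtoC t * z)%C (fun t => z * Cexp (RtoC t * z) - z)%C).
  - intros t; apply RCder_minus; [apply RCder_Cexp_line|apply RCder_line].
  - intros t; apply RCcont_plus; [apply RCcont_mult; [apply RCcont_const|apply RCcont_Cexp_line]|apply RCcont_const].
  - intros t Ht.
    replace (z * Cexp (t * z) - z)%C with (z * (Cexp (t * z) - 1))%C by ring.
    rewrite Cmod_mult; simpl pow; rewrite Rmult_1_r, Rmult_assoc; apply Rmult_le_compat_l; [apply Cmod_ge_0|].
    eapply Rle_trans; [apply Cexp_bound1|].
    destruct (Cmod_exp_scal t z Ht).
    apply Rmult_le_compat; auto using Cmod_ge_0; left; apply exp_pos.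
Qed.

Lemma RCder_sqr_line (z : C) (t : R) : RCder (fun t : R => (t * z * (t * z))%C) t (2 * (t * z * z))%C.
Proof.
  set (w := (z * z)%C).
  replace (2 * (t * z * z))%C with (RtoC (2 * t) * w)%C by (unfold w; rewrite RtoC_mult; ring).
  apply (RCder_ext (fun u : R => RtoC (u ^ 2) * w)%C).
  { intros u; unfold w; rewrite RtoC_pow; simpl; ring. }
  destruct w as [a b].
  apply (RCder_ext (fun u : R => (u ^ 2 * a, u ^ 2 * b) : C)).
  { intros u; unfold Cmult, RtoC; simpl; f_equal; ring. }
  replace (2 * t * (a, b))%C with ((2 * t * a, 2 * t * b) : C)
    by (unfold Cmult, RtoC; simpl; f_equal; ring).
  apply RCder_pair; auto_derive; auto; simpl; ring.
Qed.

(** The remainder is doubled so that its derivative in t is 2 z (exp (t z) - 1 - t z), without any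
    division. *)
Lemma Cexp_bound3 (z : C) : Cmod (Cexp z - 1 - z - z * z / 2) <= Cmod z ^ 3 * exp (Cmod z).
Proof.
  assert (H2 : Cmod (2 * (Cexp z - 1 - z) - z * z) <= 2 * (Cmod z ^ 3 * exp (Cmod z))).
  { replace (2 * (Cexp z - 1 - z) - z * z)%C
      with (((Cexp (RtoC 1 * z) - RtoC 1 * z) + (Cexp (RtoC 1 * z) - RtoC 1 * z) - RtoC 1 * z * (RtoC 1 * z))
          - ((Cexp (RtoC 0 * z) - RtoC 0 * z) + (Cexp (RtoC 0 * z) - RtoC 0 * z) - RtoC 0 * z * (RtoC 0 * z)))%C
      by (rewrite Cmult_0_l, Cmult_1_l, Cexp_0; ring).
    assert (D : forall t, RCder (fun t : R => Cexp (t * z) - t * z)%C t (z * Cexp (t * z) - z)%C).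
    { intros t; apply RCder_minus; [apply RCder_Cexp_line|apply RCder_line]. }
    apply (RC_mean_value
      (fun t : R => (Cexp (t * z) - t * z) + (Cexp (t * z) - t * z) - t * z * (t * z))%C
      (fun t : R => (z * Cexp (t * z) - z) + (z * Cexp (t * z) - z) - 2 * (t * z * z))%C).
    - intros t; apply RCder_minus; [|apply RCder_sqr_line].
      exact (is_derive_plus (K := R_AbsRing) (V := C_R_NormedModule) _ _ t _ _ (D t) (D t)).
    - assert (K : forall t, RCcont (fun t : R => z * Cexp (t * z) - z)%C t).
      { intros t; apply RCcont_plus; [apply RCcont_mult; [apply RCcont_const|apply RCcont_Cexp_line]|apply RCcont_const]. }
      intros t; apply RCcont_plus; [apply RCcont_plus; apply K|].
      apply (RCcont_ext (fun t : R => (- (2)) * (t * z * z))%C); [intros u; ring|].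
      apply RCcont_mult; [apply RCcont_const|].
      apply RCcont_mult; [apply RCcont_line|apply RCcont_const].
    - intros t Ht.
      replace (z * Cexp (t * z) - z + (z * Cexp (t * z) - z) - 2 * (t * z * z))%C
        with (RtoC 2 * z * (Cexp (t * z) - 1 - t * z))%C by ring.
      rewrite !Cmod_mult, Cmod_R, Rabs_right by lra.
      replace (2 * (Cmod z ^ 3 * exp (Cmod z))) with (2 * Cmod z * (Cmod z ^ 2 * exp (Cmod z))) by ring.
      apply Rmult_le_compat_l; [generalize (Cmod_ge_0 z); lra|].
      eapply Rle_trans; [apply Cexp_bound2|].
      destruct (Cmod_exp_scal t z Ht).
      apply Rmult_le_compat; auto; [apply pow_le, Cmod_ge_0|left; apply exp_pos|].
      apply pow_incr; split; auto using Cmod_ge_0. }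
  replace (Cexp z - 1 - z - z * z / 2)%C with (/ 2 * (2 * (Cexp z - 1 - z) - z * z))%C
    by (field; apply RtoC_nz; lra).
  rewrite Cmod_mult, Cmod_inv, Cmod_R, Rabs_right by (lra || (apply RtoC_nz; lra)).
  lra.
Qed.

Lemma Cder_Cexp (z : C) : Cder Cexp z (Cexp z).
Proof.
  apply Cder_quadratic with 1 (exp (Re z) * exp 1); [lra|].
  intros h Hh; rewrite Cexp_plus.
  replace (Cexp z * Cexp h - Cexp z - h * Cexp z)%C with (Cexp z * (Cexp h - 1 - h))%C by ring.
  rewrite Cmod_mult, Cmod_Cexp, Rmult_assoc; apply Rmult_le_compat_l; [left; apply exp_pos|].
  eapply Rle_trans; [apply Cexp_bound2|]; rewrite Rmult_comm.
  apply Rmult_le_compat_r; [apply pow_le, Cmod_ge_0|].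
  apply exp_le; lra.
Qed.

Lemma Cder_Cexp_scal (c z : C) : Cder (fun w => Cexp (c * w)%C) z (c * Cexp (c * z))%C.
Proof.
  apply (Cder_comp Cexp (fun w => c * w)%C); [apply Cder_Cexp|].
  apply (Cder_ext (fun w => c * w)%C _ _ (c * 1)%C); [reflexivity|ring|apply Cder_scal, Cder_id].
Qed.

(* Stands for the entire function (exp z - 1) / z: Rocq gives 0 / 0 = 0, hence the case at 0. *)
Definition Cexp1 (z : C) : C := if Ceq_dec z 0 then 1%C else ((Cexp z - 1) / z)%C.

Lemma Cexp1_spec (z : C) : (z * Cexp1 z)%C = (Cexp z - 1)%C.
Proof.
  unfold Cexp1; destruct (Ceq_dec z 0) as [->|H]; [rewrite Cexp_0; ring|field; auto].
Qed.

(** At 0 the third order bound on the exponential gives the derivative 1 / 2; elsewhere the quotient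
    rule applies on a disc that avoids 0. *)
Lemma Cder_Cexp1 (z : C) : exists l, Cder Cexp1 z l.
Proof.
  destruct (Ceq_dec z 0) as [->|H].
  - exists (/ 2)%C; apply Cder_quadratic with 1 (exp 1); [lra|].
    intros h Hh; rewrite Cplus_0_l; unfold Cexp1.
    destruct (Ceq_dec 0 0) as [_|N]; [|easy].
    destruct (Ceq_dec h 0) as [->|Hh0].
    + replace (1 - 1 - 0 * / 2)%C with (RtoC 0) by ring; rewrite Cmod_0; simpl; lra.
    + assert (Hm := proj1 (Cmod_gt_0 h) Hh0).
      replace ((Cexp h - 1) / h - 1 - h * / 2)%C with (/ h * (Cexp h - 1 - h - h * h / 2))%C
        by (field; auto).
      rewrite Cmod_mult, Cmod_inv by auto.
      apply Rle_trans with (/ Cmod h * (Cmod h ^ 3 * exp 1)).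
      * apply Rmult_le_compat_l; [left; apply Rinv_0_lt_compat; auto|].
        eapply Rle_trans; [apply Cexp_bound3|].
        apply Rmult_le_compat_l; [apply pow_le; lra|apply exp_le; lra].
      * right; field; lra.
  - eexists.
    apply (Cder_ext_near (fun w => (Cexp w - 1) * / w)%C _ z _ (Cmod z)).
    + apply Cmod_gt_0; auto.
    + intros w Hw; unfold Cexp1; destruct (Ceq_dec w 0) as [->|_]; [|reflexivity].
      exfalso; replace (0 - z)%C with (- z)%C in Hw by ring; rewrite Cmod_opp in Hw; lra.
    + apply Cder_mult; [apply Cder_minus; [apply Cder_Cexp|apply Cder_const]|apply Cder_inv; auto].
Qed.

Lemma Cexp_eq_1 (z : C) : Cexp z = 1%C -> Re z = 0 /\ cos (Im z) = 1.
Proof.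
  intros H.
  assert (Hr : Re z = 0).
  { apply (f_equal Cmod) in H; rewrite Cmod_Cexp, Cmod_1, <- exp_0 in H; apply exp_inv; auto. }
  split; auto.
  unfold Cexp in H; rewrite Hr, exp_0 in H; injection H; lra.
Qed.

(** * Goursat's theorem on rectangles *)

Lemma pow_half_small (w d : R) : 0 < d -> exists n, w * (/ 2) ^ n < d.
Proof.
  intros Hd.
  destruct (Rle_lt_dec w 0) as [Hw|Hw].
  - exists 0%nat; simpl; lra.
  - assert (H : Rabs (/ 2) < 1) by (rewrite Rabs_right; lra).
    assert (Hdw : 0 < d / w) by (apply Rdiv_lt_0_compat; auto).
    destruct (pow_lt_1_zero (/ 2) H (d / w) Hdw) as [N HN].
    exists N; specialize (HN N (Nat.le_refl N)).
    rewrite Rabs_right in HN by (apply Rle_ge, pow_le; lra).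
    apply Rmult_lt_compat_l with (r := w) in HN; auto.
    replace (w * (d / w)) with d in HN by (field; lra); exact HN.
Qed.

(** Compactness by bisection, in the form of Cousin's lemma: if P failed, some quarter would fail,
    and so on; the nested bad rectangles shrink to a point, where the local hypothesis is
    contradicted. *)
Lemma cousin_rectangle (P : R -> R -> R -> R -> Prop) :
  (forall a b c d, a <= b -> c <= d ->
    P a ((a + b) / 2) c ((c + d) / 2) -> P ((a + b) / 2) b c ((c + d) / 2) ->
    P a ((a + b) / 2) ((c + d) / 2) d -> P ((a + b) / 2) b ((c + d) / 2) d ->
    P a b c d) ->
  forall a0 b0 c0 d0, a0 <= b0 -> c0 <= d0 ->
  (forall x y, a0 <= x <= b0 -> c0 <= y <= d0 -> exists del, 0 < del /\
    forall a b c d, a0 <= a <= x -> x <= b <= b0 -> c0 <= c <= y -> y <= d <= d0 ->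
      b - a < del -> d - c < del -> P a b c d) ->
  P a0 b0 c0 d0.
Proof.
  intros Hsplit a0 b0 c0 d0 Hab Hcd Hloc.
  apply NNPP; intros Hbad.
  set (bad := fun r : (R * R) * (R * R) =>
    let '((a, b), (c, d)) := r in a <= b /\ c <= d /\ ~ P a b c d).
  set (sub := fun r r' : (R * R) * (R * R) =>
    let '((a, b), (c, d)) := r in let '((a', b'), (c', d')) := r' in
    (a <= a' /\ b' <= b /\ b' - a' = (b - a) / 2) /\
    (c <= c' /\ d' <= d /\ d' - c' = (d - c) / 2)).
  (* The proof of badness travels with the rectangle, so that choosing a bad quarter is a function
     and can be iterated. *)
  assert (Hstep : forall s : {r | bad r}, {s' : {r | bad r} | sub (proj1_sig s) (proj1_sig s')}).
  { intros [[[a b] [c d]] [H1 [H2 H3]]].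
    apply constructive_indefinite_description.
    assert (HN : exists r', bad r' /\ sub ((a, b), (c, d)) r').
    { apply NNPP; intros HN; apply H3; apply Hsplit; auto; apply NNPP; intros HP; apply HN.
      - exists ((a, (a + b) / 2), (c, (c + d) / 2)); simpl; repeat split; auto; lra.
      - exists (((a + b) / 2, b), (c, (c + d) / 2)); simpl; repeat split; auto; lra.
      - exists ((a, (a + b) / 2), ((c + d) / 2, d)); simpl; repeat split; auto; lra.
      - exists (((a + b) / 2, b), ((c + d) / 2, d)); simpl; repeat split; auto; lra. }
    destruct HN as [r' [Hb Hs]]; exists (exist _ r' Hb); exact Hs. }
  assert (Hb0 : bad ((a0, b0), (c0, d0))) by (simpl; auto).
  set (s := fix s n := match n with O => exist bad _ Hb0 | S k => proj1_sig (Hstep (s k)) end).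
  set (A := fun n => fst (fst (proj1_sig (s n)))).
  set (B := fun n => snd (fst (proj1_sig (s n)))).
  set (C' := fun n => fst (snd (proj1_sig (s n)))).
  set (D := fun n => snd (snd (proj1_sig (s n)))).
  assert (Hbadn : forall n, A n <= B n /\ C' n <= D n /\ ~ P (A n) (B n) (C' n) (D n)).
  { intros n; unfold A, B, C', D; destruct (s n) as [[[a b] [c d]] H]; exact H. }
  assert (Hsub : forall n, (A n <= A (S n) /\ B (S n) <= B n /\ B (S n) - A (S n) = (B n - A n) / 2)
     /\ (C' n <= C' (S n) /\ D (S n) <= D n /\ D (S n) - C' (S n) = (D n - C' n) / 2)).
  { intros n; assert (H := proj2_sig (Hstep (s n))).
    change (proj1_sig (Hstep (s n))) with (s (S n)) in H.
    unfold A, B, C', D; destruct (proj1_sig (s n)) as [[a b] [c d]];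
    destruct (proj1_sig (s (S n))) as [[a' b'] [c' d']]; exact H. }
  assert (Hw : forall n, B n - A n = (b0 - a0) * (/ 2) ^ n /\ D n - C' n = (d0 - c0) * (/ 2) ^ n).
  { induction n as [|n [IH1 IH2]]; [unfold A, B, C', D; simpl; lra|].
    destruct (Hsub n) as [[_ [_ H1]] [_ [_ H2]]]; simpl; lra. }
  assert (Hmono : forall n k, A n <= A (n + k)%nat /\ B (n + k)%nat <= B n /\
                              C' n <= C' (n + k)%nat /\ D (n + k)%nat <= D n).
  { intros n; induction k as [|k IH]; [rewrite Nat.add_0_r; repeat split; lra|].
    rewrite Nat.add_succ_r; destruct (Hsub (n + k)%nat); lra. }
  assert (Hcross : forall n k, A n <= B k /\ C' n <= D k).
  { intros n k; destruct (Hmono n k) as [H1 [_ [H2 _]]]; destruct (Hmono k n) as [_ [H3 [_ H4]]].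
    rewrite (Nat.add_comm k n) in H3, H4.
    destruct (Hbadn (n + k)%nat) as [H5 [H6 _]]; lra. }
  (* The suprema of the left ends and of the lower ends are the coordinates of a point common to all
     the nested rectangles. *)
  destruct (completeness (fun u => exists n, u = A n)) as [x [Hx1 Hx2]].
  { exists (B 0%nat); intros u [n ->]; apply Hcross. }
  { exists (A 0%nat), 0%nat; reflexivity. }
  destruct (completeness (fun u => exists n, u = C' n)) as [y [Hy1 Hy2]].
  { exists (D 0%nat); intros u [n ->]; apply Hcross. }
  { exists (C' 0%nat), 0%nat; reflexivity. }
  assert (Hx : forall n, A n <= x <= B n).
  { intros n; split; [apply Hx1; exists n; auto|apply Hx2; intros u [k ->]; apply Hcross]. }
  assert (Hy : forall n, C' n <= y <= D n).
  { intros n; split; [apply Hy1; exists n; auto|apply Hy2; intros u [k ->]; apply Hcross]. }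
  destruct (Hloc x y (Hx 0%nat) (Hy 0%nat)) as [del [Hdel HP]].
  destruct (pow_half_small (Rmax (b0 - a0) (d0 - c0)) del Hdel) as [n Hn].
  assert (Hp : 0 < (/ 2) ^ n) by (apply pow_lt; lra).
  apply (proj2 (proj2 (Hbadn n))).
  destruct (Hmono 0%nat n) as [M1 [M2 [M3 M4]]]; simpl in M1, M2, M3, M4.
  assert (E1 := Rmax_l (b0 - a0) (d0 - c0)); assert (E2 := Rmax_r (b0 - a0) (d0 - c0)).
  destruct (Hw n) as [W1 W2].
  apply HP.
  - split; [exact M1|apply Hx].
  - split; [apply Hx|exact M2].
  - split; [exact M3|apply Hy].
  - split; [apply Hy|exact M4].
  - rewrite W1; eapply Rle_lt_trans; [apply Rmult_le_compat_r|apply Hn]; lra.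
  - rewrite W2; eapply Rle_lt_trans; [apply Rmult_le_compat_r|apply Hn]; lra.
Qed.

Lemma RCcont_horizontal (f : C -> C) (x y : R) (l : C) :
  Cder f (x, y) l -> RCcont (fun u => f (u, y)) x.
Proof.
  intros H; apply (RCcont_comp f (fun u => (u, y)) x l H), RCcont_pair;
    [apply continuous_id|apply continuous_const].
Qed.

Lemma RCcont_vertical (f : C -> C) (x y : R) (l : C) :
  Cder f (x, y) l -> RCcont (fun u => f (x, u)) y.
Proof.
  intros H; apply (RCcont_comp f (fun u => (x, u)) y l H), RCcont_pair;
    [apply continuous_const|apply continuous_id].
Qed.

Notation ex_RCInt f a b := (@ex_RInt C_R_NormedModule f a b).

Lemma RCInt_correct (f : R -> C) (a b : R) : ex_RCInt f a b -> is_RCInt f a b (RCInt f a b).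
Proof. exact (RInt_correct (V := C_R_CompleteNormedModule) f a b). Qed.

Lemma RCInt_unique (f : R -> C) (a b : R) (l : C) : is_RCInt f a b l -> RCInt f a b = l.
Proof. exact (is_RInt_unique (V := C_R_CompleteNormedModule) f a b l). Qed.

Lemma RCInt_Chasles (f : R -> C) (a b c : R) : ex_RCInt f a b -> ex_RCInt f b c ->
  RCInt f a c = (RCInt f a b + RCInt f b c)%C.
Proof. intros H1 H2; symmetry; exact (RInt_Chasles (V := C_R_CompleteNormedModule) f a b c H1 H2). Qed.

Lemma is_RCInt_minus (f g : R -> C) (a b : R) (lf lg : C) :
  is_RCInt f a b lf -> is_RCInt g a b lg -> is_RCInt (fun t => f t - g t)%C a b (lf - lg)%C.
Proof. exact (is_RInt_minus (V := C_R_NormedModule) f g a b lf lg). Qed.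

Lemma is_RCInt_derive (F f : R -> C) (a b : R) :
  (forall t, RCder F t (f t)) -> (forall t, RCcont f t) -> is_RCInt f a b (F b - F a)%C.
Proof.
  intros H1 H2; exact (is_RInt_derive (V := C_R_CompleteNormedModule) F f a b (fun t _ => H1 t) (fun t _ => H2 t)).
Qed.

Lemma ex_RCInt_continuous (f : R -> C) (a b : R) : a <= b ->
  (forall t, a <= t <= b -> RCcont f t) -> ex_RCInt f a b.
Proof.
  intros Hab H; apply (ex_RInt_continuous (V := C_R_CompleteNormedModule)).
  rewrite Rmin_left, Rmax_right by auto; exact H.
Qed.

Definition holomorphic_on (f : C -> C) (a b c d : R) : Prop :=
  forall x y, a <= x <= b -> c <= y <= d -> exists l, Cder f (x, y) l.

Definition rectangle_integral (f : C -> C) (a b c d : R) : C :=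
  (RCInt (fun x => f (x, c)) a b + Ci * RCInt (fun y => f (b, y)) c d
   - RCInt (fun x => f (x, d)) a b - Ci * RCInt (fun y => f (a, y)) c d)%C.

Lemma ex_RCInt_horizontal (f : C -> C) (a b c d x1 x2 y : R) : holomorphic_on f a b c d ->
  a <= x1 -> x1 <= x2 -> x2 <= b -> c <= y <= d -> ex_RCInt (fun x => f (x, y)) x1 x2.
Proof.
  intros H H1 H2 H3 Hy; apply ex_RCInt_continuous; auto; intros t Ht.
  destruct (H t y) as [l Hl]; [lra|auto|]; apply (RCcont_horizontal f t y l Hl).
Qed.

Lemma ex_RCInt_vertical (f : C -> C) (a b c d y1 y2 x : R) : holomorphic_on f a b c d ->
  c <= y1 -> y1 <= y2 -> y2 <= d -> a <= x <= b -> ex_RCInt (fun y => f (x, y)) y1 y2.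
Proof.
  intros H H1 H2 H3 Hx; apply ex_RCInt_continuous; auto; intros t Ht.
  destruct (H x t) as [l Hl]; [auto|lra|]; apply (RCcont_vertical f x t l Hl).
Qed.

Lemma rectangle_integral_split (f : C -> C) (a b c d m n : R) : holomorphic_on f a b c d ->
  a <= m <= b -> c <= n <= d ->
  rectangle_integral f a b c d =
  (rectangle_integral f a m c n + rectangle_integral f m b c n +
   (rectangle_integral f a m n d + rectangle_integral f m b n d))%C.
Proof.
  intros H Hm Hn; unfold rectangle_integral.
  assert (Hh : forall y, c <= y <= d ->
    RCInt (fun x => f (x, y)) a b = (RCInt (fun x => f (x, y)) a m + RCInt (fun x => f (x, y)) m b)%C).
  { intros y Hy; apply RCInt_Chasles; apply (ex_RCInt_horizontal f a b c d); auto; lra. }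
  assert (Hv : forall x, a <= x <= b ->
    RCInt (fun y => f (x, y)) c d = (RCInt (fun y => f (x, y)) c n + RCInt (fun y => f (x, y)) n d)%C).
  { intros x Hx; apply RCInt_Chasles; apply (ex_RCInt_vertical f a b c d); auto; lra. }
  rewrite (Hh c ltac:(lra)), (Hh d ltac:(lra)), (Hv a ltac:(lra)), (Hv b ltac:(lra)); ring.
Qed.

(** The bridge from complex to real derivatives; the edges of a rectangle are lines with v = 1 or v
    = i. *)
Lemma RCder_comp_line (F : C -> C) (p v l : C) (t : R) :
  Cder F (p + t * v)%C l -> RCder (fun u : R => F (p + u * v)%C) t (v * l)%C.
Proof.
  intros H; split; [apply is_linear_scal_l|].
  intros x Hx eps.
  assert (x = t) as ->.
  { apply (is_filter_lim_locally_unique (V := R_NormedModule)) in Hx; easy. }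
  assert (Hv := Cmod_ge_0 v).
  assert (He : 0 < eps / (Cmod v + 1)) by (apply Rdiv_lt_0_compat; [apply cond_pos|lra]).
  destruct (proj1 (Cder_eps _ _ _) H _ He) as [d [Hd Hf]].
  assert (Hd' : 0 < d / (Cmod v + 1)) by (apply Rdiv_lt_0_compat; lra).
  exists (mkposreal _ Hd'); intros y Hy.
  change (Rabs (y - t) < d / (Cmod v + 1)) in Hy.
  rewrite RC_norm; change (norm (minus y t)) with (Rabs (y - t)).
  change (Cmod (F (p + y * v)%C - F (p + t * v)%C - scal (V := C_R_ModuleSpace) (y - t) (v * l)%C) <= eps * Rabs (y - t)).
  rewrite scal_R_Cmult.
  assert (E : ((p + y * v) - (p + t * v))%C = ((y - t)%R * v)%C) by (rewrite RtoC_minus; ring).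
  assert (Hm : Cmod ((p + y * v) - (p + t * v)) = Rabs (y - t) * Cmod v)
    by (rewrite E, Cmod_mult, Cmod_R; auto).
  apply Rmult_lt_compat_r with (r := Cmod v + 1) in Hy; [|lra].
  unfold Rdiv in Hy; rewrite Rmult_assoc, Rinv_l, Rmult_1_r in Hy by lra.
  assert (H0 := Rabs_pos (y - t)).
  specialize (Hf (p + y * v)%C); rewrite Hm, E in Hf.
  replace ((y - t)%R * (v * l))%C with ((y - t)%R * v * l)%C by ring.
  eapply Rle_trans; [apply Hf; nra|].
  replace (eps * Rabs (y - t)) with (eps / (Cmod v + 1) * (Rabs (y - t) * (Cmod v + 1)))
    by (field; lra).
  apply Rmult_le_compat_l; [lra|]; nra.
Qed.

Lemma RCder_eq (f : R -> C) (t : R) (l l' : C) : RCder f t l -> l = l' -> RCder f t l'.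
Proof. intros H <-; exact H. Qed.

(** A primitive makes the edge integrals telescope around the rectangle. The division by [Ci]
    appears because y |-> F (a, y) has derivative [Ci] times g. *)
Lemma is_RCInt_edges_primitive (F g : C -> C) (a b c d : R) :
  (forall z, Cder F z (g z)) -> (forall z, exists l, Cder g z l) ->
  is_RCInt (fun x => g (x, c)) a b (F (b, c) - F (a, c))%C /\
  is_RCInt (fun y => g (a, y)) c d ((F (a, d) - F (a, c)) / Ci)%C.
Proof.
  intros HF Hg; split.
  - apply (is_RCInt_derive (fun x => F (x, c))).
    + intros t; apply (RCder_ext (fun u : R => F ((0, c) + u * 1)%C)).
      { intros u; f_equal; unfold Cplus, Cmult, RtoC; simpl; f_equal; ring. }
      apply (RCder_eq _ _ (1 * g ((0, c) + t * 1))%C).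
      * apply RCder_comp_line, HF.
      * rewrite Cmult_1_l; f_equal; unfold Cplus, Cmult, RtoC; simpl; f_equal; ring.
    + intros t; destruct (Hg (t, c)) as [l Hl]; apply (RCcont_horizontal g t c l Hl).
  - replace ((F (a, d) - F (a, c)) / Ci)%C with (/ Ci * F (a, d) - / Ci * F (a, c))%C
      by (field; apply Ci_nz).
    apply (is_RCInt_derive (fun y => / Ci * F (a, y))%C).
    + intros t; apply (RCder_ext (fun u : R => / Ci * F ((a, 0) + u * Ci))%C).
      { intros u; f_equal; f_equal; unfold Cplus, Cmult, RtoC, Ci; simpl; f_equal; ring. }
      apply (RCder_eq _ _ (Ci * (/ Ci * g ((a, 0) + t * Ci)))%C).
      * apply (RCder_comp_line (fun z => / Ci * F z)%C), Cder_scal, HF.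
      * rewrite Cmult_assoc, Cinv_r, Cmult_1_l by apply Ci_nz.
        f_equal; unfold Cplus, Cmult, RtoC, Ci; simpl; f_equal; ring.
    + intros t; destruct (Hg (a, t)) as [l Hl]; apply (RCcont_vertical g a t l Hl).
Qed.

Lemma RCInt_minus (f g : R -> C) (a b : R) : ex_RCInt f a b -> ex_RCInt g a b ->
  RCInt (fun t => f t - g t)%C a b = (RCInt f a b - RCInt g a b)%C.
Proof.
  intros H1 H2; apply RCInt_unique, is_RCInt_minus; apply RCInt_correct; auto.
Qed.

Lemma RCInt_bound (f : R -> C) (a b M : R) : a <= b -> ex_RCInt f a b ->
  (forall t, a <= t <= b -> Cmod (f t) <= M) -> Cmod (RCInt f a b) <= (b - a) * M.
Proof. intros H1 H2 H3; apply (norm_RCInt_le_const f a b _ M); auto; apply RCInt_correct; auto. Qed.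

Lemma ex_RCInt_minus (f g : R -> C) (a b : R) : ex_RCInt f a b -> ex_RCInt g a b ->
  ex_RCInt (fun t => f t - g t)%C a b.
Proof. exact (ex_RInt_minus (V := C_R_NormedModule) f g a b). Qed.

(* Subtracting the affine approximation at p, whose boundary integral vanishes, leaves an
   integrand of size eps * (diameter). *)
Lemma rectangle_integral_local (f : C -> C) (p l : C) (eps a b c d : R) :
  holomorphic_on f a b c d -> a <= Re p <= b -> c <= Im p <= d -> 0 <= eps ->
  (forall x y, a <= x <= b -> c <= y <= d ->
    Cmod (f (x, y) - f p - ((x, y) - p) * l) <= eps * Cmod ((x, y) - p)) ->
  Cmod (rectangle_integral f a b c d) <= 2 * eps * (b - a + (d - c)) ^ 2.
Proof.
  intros Hf Hx Hy He H.
  set (g := fun z => (f p + (z - p) * l)%C).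
  set (F := fun z => (f p * z + (z - p) * (z - p) * l * / 2)%C).
  assert (HF : forall z, Cder F z (g z)).
  { intros z; unfold F, g.
    assert (D : Cder (fun w => w - p)%C z (1 - 0)%C) by (apply Cder_minus; [apply Cder_id|apply Cder_const]).
    assert (D2 : Cder (fun w => (w - p) * (w - p) * l * / 2)%C z ((z - p) * l)%C).
    { apply (Cder_ext (fun w => (l * / 2) * ((w - p) * (w - p)))%C _ z
        ((l * / 2) * ((1 - 0) * (z - p) + (z - p) * (1 - 0)))%C).
      - intros w; ring.
      - field; apply RtoC_nz; lra.
      - apply Cder_scal, (Cder_mult _ _ _ _ _ D D). }
    apply (Cder_ext _ _ z (f p * 1 + (z - p) * l)%C) with (3 := Cder_plus _ _ _ _ _ (Cder_scal _ _ _ _ (Cder_id z)) D2);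
      [reflexivity|ring]. }
  assert (Hg : forall z, exists l', Cder g z l').
  { intros z; eexists; unfold g; apply Cder_plus; [apply Cder_const|].
    apply Cder_mult; [apply Cder_minus; [apply Cder_id|apply Cder_const]|apply Cder_const]. }
  assert (Hb : forall x y, a <= x <= b -> c <= y <= d -> Cmod (f (x, y) - g (x, y)) <= eps * (b - a + (d - c))).
  { intros x y Hx' Hy'; unfold g.
    replace (f (x, y) - (f p + ((x, y) - p) * l))%C with (f (x, y) - f p - ((x, y) - p) * l)%C by ring.
    eapply Rle_trans; [apply H; auto|]; apply Rmult_le_compat_l; auto.
    destruct p as [p1 p2]; simpl in *.
    unfold Cminus, Cplus, Copp; simpl.
    eapply Rle_trans; [apply Cmod_le_Rabs|].
    apply Rplus_le_compat; apply Rabs_le; lra. }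
  destruct (is_RCInt_edges_primitive F g a b c d HF Hg) as [G1 G2].
  (* Only one component of each further instance is kept: b in the place of a gives the right edge,
     and d in the place of c gives the top edge. *)
  destruct (is_RCInt_edges_primitive F g b a c d HF Hg) as [_ G3].
  destruct (is_RCInt_edges_primitive F g a b d d HF Hg) as [G4 _].
  assert (Hcd : c <= d) by lra. assert (Hab : a <= b) by lra.
  assert (Eh : forall y, c <= y <= d -> ex_RCInt (fun x => f (x, y)) a b)
    by (intros y Hy'; apply (ex_RCInt_horizontal f a b c d); auto; lra).
  assert (Ev : forall x, a <= x <= b -> ex_RCInt (fun y => f (x, y)) c d)
    by (intros x Hx'; apply (ex_RCInt_vertical f a b c d); auto; lra).
  replace (rectangle_integral f a b c d)
    with (RCInt (fun x => f (x, c) - g (x, c))%C a b + Ci * RCInt (fun y => f (b, y) - g (b, y))%C c d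
      - RCInt (fun x => f (x, d) - g (x, d))%C a b - Ci * RCInt (fun y => f (a, y) - g (a, y))%C c d)%C.
  - assert (Bh : forall y, c <= y <= d -> ex_RCInt (fun x => g (x, y)) a b ->
      Cmod (RCInt (fun x => f (x, y) - g (x, y))%C a b) <= (b - a) * (eps * (b - a + (d - c)))).
    { intros y Hy' Hgy; apply RCInt_bound; auto; apply ex_RCInt_minus; auto. }
    assert (Bv : forall x, a <= x <= b -> ex_RCInt (fun y => g (x, y)) c d ->
      Cmod (Ci * RCInt (fun y => f (x, y) - g (x, y))%C c d) <= (d - c) * (eps * (b - a + (d - c)))).
    { intros x Hx' Hgx; rewrite Cmod_mult, Cmod_Ci, Rmult_1_l; apply RCInt_bound; auto; apply ex_RCInt_minus; auto. }
    eapply Rle_trans; [apply Cmod_minus_triangle|].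
    eapply Rle_trans; [apply Rplus_le_compat_r, Cmod_minus_triangle|].
    eapply Rle_trans; [apply Rplus_le_compat_r, Rplus_le_compat_r, Cmod_triangle|].
    assert (B1 := Bh c ltac:(lra) (ex_intro _ _ G1)).
    assert (B2 := Bh d ltac:(lra) (ex_intro _ _ G4)).
    assert (B3 := Bv a ltac:(lra) (ex_intro _ _ G2)).
    assert (B4 := Bv b ltac:(lra) (ex_intro _ _ G3)).
    nra.
  - assert (S1 := RCInt_minus (fun x => f (x, c)) (fun x => g (x, c)) a b (Eh c ltac:(lra)) (ex_intro _ _ G1)).
    assert (S2 := RCInt_minus (fun x => f (x, d)) (fun x => g (x, d)) a b (Eh d ltac:(lra)) (ex_intro _ _ G4)).
    assert (S3 := RCInt_minus (fun y => f (a, y)) (fun y => g (a, y)) c d (Ev a ltac:(lra)) (ex_intro _ _ G2)).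
    assert (S4 := RCInt_minus (fun y => f (b, y)) (fun y => g (b, y)) c d (Ev b ltac:(lra)) (ex_intro _ _ G3)).
    rewrite (RCInt_unique _ _ _ _ G1) in S1; rewrite (RCInt_unique _ _ _ _ G4) in S2.
    rewrite (RCInt_unique _ _ _ _ G2) in S3; rewrite (RCInt_unique _ _ _ _ G3) in S4.
    unfold rectangle_integral; rewrite S1, S2, S3, S4; field; apply Ci_nz.
Qed.

(** The local bound 2 eps (width + height)^2 is additive under quartering, since each quarter has
    half the width and half the height. Hence it holds for the whole rectangle, and this is
    impossible for the eps taken proportional to the supposedly nonzero integral. *)
Theorem goursat_rectangle (f : C -> C) (a b c d : R) : a <= b -> c <= d ->
  holomorphic_on f a b c d -> rectangle_integral f a b c d = 0%C.
Proof.
  intros Hab Hcd Hf.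
  apply Cmod_eq_0, Rle_antisym; [|apply Cmod_ge_0].
  set (W := (b - a + (d - c)) ^ 2).
  assert (HW : 0 <= W) by apply pow2_ge_0.
  apply Rnot_lt_le; intros Hpos.
  assert (He : 0 < Cmod (rectangle_integral f a b c d) / (2 * W + 1)) by (apply Rdiv_lt_0_compat; lra).
  set (eps := Cmod (rectangle_integral f a b c d) / (2 * W + 1)) in *.
  assert (HP : a <= a -> b <= b -> c <= c -> d <= d -> Cmod (rectangle_integral f a b c d) <= 2 * eps * W).
  { apply (cousin_rectangle (fun a' b' c' d' => a <= a' -> b' <= b -> c <= c' -> d' <= d ->
      Cmod (rectangle_integral f a' b' c' d') <= 2 * eps * (b' - a' + (d' - c')) ^ 2)); auto.
    - intros a' b' c' d' H1 H2 P1 P2 P3 P4 Ha Hb Hc Hd.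
      rewrite (rectangle_integral_split f a' b' c' d' ((a' + b') / 2) ((c' + d') / 2)); try lra.
      + specialize (P1 ltac:(lra) ltac:(lra) ltac:(lra) ltac:(lra)).
        specialize (P2 ltac:(lra) ltac:(lra) ltac:(lra) ltac:(lra)).
        specialize (P3 ltac:(lra) ltac:(lra) ltac:(lra) ltac:(lra)).
        specialize (P4 ltac:(lra) ltac:(lra) ltac:(lra) ltac:(lra)).
        eapply Rle_trans; [apply Cmod_triangle|].
        eapply Rle_trans; [apply Rplus_le_compat; apply Cmod_triangle|].
        eapply Rle_trans; [apply (Rplus_le_compat _ _ _ _ (Rplus_le_compat _ _ _ _ P1 P2) (Rplus_le_compat _ _ _ _ P3 P4))|].
        right; field.
      + intros x y Hx Hy; apply Hf; lra.
    - intros x y Hx Hy; destruct (Hf x y Hx Hy) as [l Hl].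
      destruct (proj1 (Cder_eps f (x, y) l) Hl eps He) as [del [Hdel H]].
      (* Both sides are shorter than del / 2, so every point of the small rectangle is within del of
         (x, y). *)
      exists (del / 2); split; [lra|].
      intros a' b' c' d' Ha Hb Hc Hd Hw Hh _ _ _ _.
      apply (rectangle_integral_local f (x, y) l eps); simpl; try lra.
      + intros x' y' Hx' Hy'; apply Hf; lra.
      + intros x' y' Hx' Hy'; apply H.
        unfold Cminus, Cplus, Copp; simpl.
        eapply Rle_lt_trans; [apply Cmod_le_Rabs|].
        assert (Rabs (x' + - x) < del / 2) by (apply Rabs_def1; lra).
        assert (Rabs (y' + - y) < del / 2) by (apply Rabs_def1; lra).
        lra. }
  specialize (HP ltac:(lra) ltac:(lra) ltac:(lra) ltac:(lra)).
  assert (E : Cmod (rectangle_integral f a b c d) = eps * (2 * W + 1)) by (unfold eps; field; lra).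
  rewrite E in HP; nra.
Qed.

(** * Unique continuation *)

Lemma RCInt_const (c : C) (a b : R) : is_RCInt (fun _ => c) a b ((b - a)%R * c)%C.
Proof.
  assert (H := is_RInt_const (V := C_R_NormedModule) a b c).
  change (scal (b - a) c) with (scal (V := C_R_ModuleSpace) (b - a) c) in H.
  rewrite scal_R_Cmult in H; exact H.
Qed.

Lemma RCInt_ext (f g : R -> C) (a b : R) : (forall t, f t = g t) -> RCInt f a b = RCInt g a b.
Proof. intros H; exact (RInt_ext (V := C_R_CompleteNormedModule) f g a b (fun x _ => H x)). Qed.

(* Goursat for w |-> f (c + exp w) on [rho0, rho] x [0, 2 PI]: the horizontal sides cancel by
   periodicity, so the circle averages do not depend on the radius; let rho0 -> -infinity. *)
Lemma circle_bound_center (f : C -> C) (c : C) (rho M : R) :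
  (forall z, Cmod (z - c) <= exp rho -> exists l, Cder f z l) ->
  (forall y, 0 <= y <= 2 * PI -> Cmod (f (c + Cexp (rho, y))%C) <= M) ->
  Cmod (f c) <= M.
Proof.
  intros Hf HM; assert (HPI := PI_RGT_0).
  apply le_epsilon; intros eps He.
  destruct (Hf c) as [l0 Hl0].
  { replace (c - c)%C with (RtoC 0) by ring; rewrite Cmod_0; left; apply exp_pos. }
  destruct (Cder_continuous f c l0 Hl0 eps He) as [d [Hd Hc]].
  (* On the circle of radius exp rho0 the function stays within eps of its value at the centre. *)
  set (rho0 := Rmin rho (ln (d / 2))).
  assert (Hr0 : rho0 <= rho) by apply Rmin_l.
  assert (Hr1 : exp rho0 < d).
  { apply Rle_lt_trans with (d / 2); [|lra].
    rewrite <- (exp_ln (d / 2)) by lra; apply exp_le, Rmin_r. }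
  set (h := fun w => f (c + Cexp w)%C).
  assert (Hhol : holomorphic_on h rho0 rho 0 (2 * PI)).
  { intros x y Hx Hy; destruct (Hf (c + Cexp (x, y))%C) as [l Hl].
    - replace (c + Cexp (x, y) - c)%C with (Cexp (x, y)) by ring.
      rewrite Cmod_Cexp; apply exp_le; simpl; lra.
    - eexists; unfold h; apply (Cder_comp f (fun w => c + Cexp w)%C); [exact Hl|].
      apply Cder_plus; [apply Cder_const|apply Cder_Cexp]. }
  assert (HG := goursat_rectangle h rho0 rho 0 (2 * PI) Hr0 ltac:(lra) Hhol).
  unfold rectangle_integral in HG.
  rewrite (RCInt_ext (fun x => h (x, 2 * PI)) (fun x => h (x, 0))) in HG.
  2:{ intros x; unfold h, Cexp; simpl; rewrite cos_2PI, sin_2PI, cos_0, sin_0; reflexivity. }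
  assert (HE : RCInt (fun y => h (rho, y)) 0 (2 * PI) = RCInt (fun y => h (rho0, y)) 0 (2 * PI)).
  { set (I1 := RCInt (fun y => h (rho, y)) 0 (2 * PI)) in *.
    set (I2 := RCInt (fun y => h (rho0, y)) 0 (2 * PI)) in *.
    assert (Ci * (I1 - I2) = 0)%C by (rewrite <- HG; ring).
    apply Ceq_minus; replace (I1 - I2)%C with (/ Ci * (Ci * (I1 - I2)))%C by (field; apply Ci_nz).
    rewrite H; ring. }
  assert (B1 : Cmod (RCInt (fun y => h (rho, y)) 0 (2 * PI)) <= (2 * PI - 0) * M).
  { apply RCInt_bound; [lra| |exact HM].
    apply (ex_RCInt_vertical h rho0 rho 0 (2 * PI)); auto; lra. }
  assert (B2 : Cmod (RCInt (fun y => h (rho0, y) - f c)%C 0 (2 * PI)) <= (2 * PI - 0) * eps).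
  { apply RCInt_bound; [lra| |].
    - apply ex_RCInt_minus; [|eexists; apply RCInt_const].
      apply (ex_RCInt_vertical h rho0 rho 0 (2 * PI)); auto; lra.
    - intros y _; left; apply Hc.
      replace (c + Cexp (rho0, y) - c)%C with (Cexp (rho0, y)) by ring.
      rewrite Cmod_Cexp; exact Hr1. }
  rewrite RCInt_minus, <- HE, (RCInt_unique _ _ _ _ (RCInt_const (f c) 0 (2 * PI))) in B2.
  2: apply (ex_RCInt_vertical h rho0 rho 0 (2 * PI)); auto; lra.
  2: eexists; apply RCInt_const.
  assert (B3 := Cmod_le_add ((2 * PI - 0)%R * f c)%C (RCInt (fun y => h (rho, y)) 0 (2 * PI))).
  rewrite Cmod_sym in B2.
  rewrite Cmod_mult, Cmod_R, Rabs_right in B3 by lra.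
  apply Rmult_le_reg_l with (2 * PI); lra.
Qed.

Lemma Cmod_continuous (f : R -> C) (t : R) : RCcont f t -> continuity_pt (fun u => Cmod (f u)) t.
Proof.
  intros H; apply continuity_pt_filterlim, filterlim_locally; intros eps.
  destruct (proj1 (RCcont_eps f t) H eps (cond_pos eps)) as [d [Hd Hf]].
  exists (mkposreal d Hd); intros y Hy.
  specialize (Hf y Hy).
  change (Rabs (Cmod (f y) - Cmod (f t)) < eps).
  assert (H1 := Cmod_le_add (f y) (f t)); assert (H2 := Cmod_le_add (f t) (f y)).
  rewrite (Cmod_sym (f t)) in H2; apply Rabs_def1; lra.
Qed.

Lemma circle_bounded (f : C -> C) (c : C) (rho : R) :
  (forall z, Cmod (z - c) <= exp rho -> exists l, Cder f z l) ->
  exists M, 0 <= M /\ forall y, 0 <= y <= 2 * PI -> Cmod (f (c + Cexp (rho, y))%C) <= M.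
Proof.
  intros Hf; assert (HPI := PI_RGT_0).
  destruct (continuity_ab_maj (fun y => Cmod (f (c + Cexp (rho, y))%C)) 0 (2 * PI)) as [m [Hm _]].
  - lra.
  - intros y _; apply Cmod_continuous.
    destruct (Hf (c + Cexp (rho, y))%C) as [l Hl].
    { replace (c + Cexp (rho, y) - c)%C with (Cexp (rho, y)) by ring.
      rewrite Cmod_Cexp; simpl; lra. }
    apply (RCcont_vertical (fun w => f (c + Cexp w)%C) rho y (Cexp (rho, y) * l)%C).
    apply (Cder_comp f (fun w => c + Cexp w)%C); [exact Hl|].
    eapply Cder_ext; [reflexivity| |apply Cder_plus; [apply Cder_const|apply Cder_Cexp]]; ring.
  - eexists; split; [apply Cmod_ge_0|exact Hm].
Qed.

Lemma Cder_pow (f : C -> C) (z l : C) (n : nat) :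
  Cder f z l -> exists l', Cder (fun w => f w ^ n)%C z l'.
Proof.
  intros H; induction n as [|n [l' IH]].
  - exists 0%C; exact (Cder_const 1%C z).
  - exists (l * f z ^ n + f z * l')%C; exact (Cder_mult f (fun w => f w ^ n)%C z l l' H IH).
Qed.

(* If f vanishes near p, then f / (z - p)^n is holomorphic for every n; its value at w is bounded
   by its values on the circle, and n -> infinity forces f w = 0. *)
Lemma zero_propagates (f : C -> C) (w p : C) (r del : R) : 0 < r -> 0 < del ->
  (forall z, Cmod (z - w) <= r -> exists l, Cder f z l) ->
  (forall z, Cmod (z - p) < del -> f z = 0%C) ->
  Cmod (w - p) < r / 2 -> f w = 0%C.
Proof.
  intros Hr Hdel Hf Hz Hwp.
  destruct (Ceq_dec w p) as [->|Hne].
  { apply Hz; replace (p - p)%C with (RtoC 0) by ring; rewrite Cmod_0; auto. }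
  assert (Ht : 0 < Cmod (w - p)) by (apply Cmod_gt_0, Cminus_eq_contra; auto).
  set (t := Cmod (w - p)) in *.
  assert (Hrr : exp (ln r) = r) by (apply exp_ln; auto).
  destruct (circle_bounded f w (ln r)) as [M [HM0 HM]]; [rewrite Hrr; exact Hf|].
  assert (Hn : forall n, Cmod (f w) * (/ t) ^ n <= M * (/ (r - t)) ^ n).
  { intros n.
    assert (E : Cmod (f w) * (/ t) ^ n = Cmod (f w * (/ (w - p)) ^ n)%C).
    { rewrite Cmod_mult, Cmod_pow, Cmod_inv; auto; apply Cminus_eq_contra; auto. }
    rewrite E.
    apply (circle_bound_center (fun z => f z * (/ (z - p)) ^ n)%C w (ln r)).
    - rewrite Hrr; intros z Hzr.
      (* Near p the product is identically 0, because f is; this also covers the point p itself. *)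
      destruct (Rlt_le_dec (Cmod (z - p)) del) as [Hlt|Hge].
      + exists 0%C; apply (Cder_ext_near (fun _ => RtoC 0) _ z _ (del - Cmod (z - p))); [lra| |apply Cder_const].
        intros y Hy; rewrite (Hz y), Cmult_0_l; auto.
        replace (y - p)%C with ((y - z) + (z - p))%C by ring.
        eapply Rle_lt_trans; [apply Cmod_triangle|lra].
      + destruct (Hf z Hzr) as [l Hl].
        assert (Hzp : (z - p)%C <> 0%C) by (apply Cmod_gt_0; lra).
        destruct (Cder_pow (fun u => / (u - p))%C z ((1 - 0) * - / ((z - p) * (z - p)))%C n) as [l' Hl'].
        { apply (Cder_comp (fun u => / u)%C (fun u => u - p)%C); [apply Cder_inv; auto|].
          apply Cder_minus; [apply Cder_id|apply Cder_const]. }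
        eexists; apply (Cder_mult f (fun u => (/ (u - p)) ^ n)%C z l l' Hl Hl').
    - intros y Hy; rewrite Cmod_mult; apply Rmult_le_compat; auto using Cmod_ge_0.
      rewrite Cmod_pow; apply pow_incr; split; [apply Cmod_ge_0|].
      set (z := (w + Cexp (ln r, y))%C).
      (* The circle of radius r about w keeps a distance of at least r - t from p. *)
      assert (Hzp : r - t <= Cmod (z - p)).
      { assert (H := Cmod_minus_triangle (z - p) (w - p)).
        replace (z - p - (w - p))%C with (Cexp (ln r, y)) in H by (unfold z; ring).
        rewrite Cmod_Cexp in H; simpl in H; rewrite Hrr in H; unfold t; lra. }
      assert (z - p <> 0)%C by (apply Cmod_gt_0; lra).
      rewrite Cmod_inv by auto; apply Rinv_le_contravar; lra. }
  apply Cmod_eq_0, Rle_antisym; [|apply Cmod_ge_0].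
  apply Rnot_lt_le; intros Hpos.
  (* The ratio is below 1 because t < r / 2; its powers drive the bound on f w to 0. *)
  set (k := t / (r - t)).
  assert (Hk : Rabs k < 1).
  { unfold k; rewrite Rabs_right by (apply Rle_ge, Rdiv_le_0_compat; lra).
    apply Rmult_lt_reg_r with (r - t); [lra|]; unfold Rdiv; rewrite Rmult_assoc, Rinv_l; lra. }
  destruct (pow_lt_1_zero k Hk (Cmod (f w) / (M + 1))) as [N HN]; [apply Rdiv_lt_0_compat; lra|].
  specialize (HN N (Nat.le_refl N)); specialize (Hn N).
  assert (Hk0 : 0 <= k ^ N) by (apply pow_le; unfold k; apply Rdiv_le_0_compat; lra).
  rewrite Rabs_right in HN by lra.
  assert (Ek : k ^ N = t ^ N * (/ (r - t)) ^ N) by (unfold k, Rdiv; apply Rpow_mult_distr).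
  assert (Hc : Cmod (f w) <= M * k ^ N).
  { apply Rmult_le_compat_r with (r := t ^ N) in Hn; [|apply pow_le; lra].
    rewrite Rmult_assoc, <- Rpow_mult_distr, Rinv_l, pow1 in Hn by lra.
    rewrite Ek; lra. }
  apply Rmult_lt_compat_r with (r := M + 1) in HN; [|lra].
  unfold Rdiv in HN; rewrite Rmult_assoc, Rinv_l in HN by lra; nra.
Qed.

(** The zeros advance to the left by 1 / 4 at a time. The unit disc about w stays in the upper
    half-plane because Im w > 1; the point p = w + 3 / 8 has a neighbourhood of radius at most 1 / 8
    in the region already treated, and 3 / 8 is less than half the radius. *)
Lemma upper_half_plane_unique (f : C -> C) (A : R) :
  (forall z, 0 < Im z -> exists l, Cder f z l) ->
  (forall z, 0 < Im z -> A < Re z -> f z = 0%C) ->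
  forall z, 1 < Im z -> f z = 0%C.
Proof.
  intros Hf Hz.
  assert (H : forall n z, 1 < Im z -> A - INR n * / 4 < Re z -> f z = 0%C).
  { induction n as [|n IH]; intros w Hi Hr; [apply Hz; simpl in Hr; lra|].
    rewrite S_INR in Hr.
    apply (zero_propagates f w (w + RtoC (3 / 8))%C 1 (Rmin (/ 8) (Im w - 1))); try lra.
    - apply Rmin_pos; lra.
    - intros z Hzw; apply Hf.
      assert (H := Rle_trans _ _ _ (im_le_Cmod (z - w)) Hzw).
      unfold Cminus in H; rewrite im_plus, im_opp in H; apply Rabs_le_between in H; lra.
    - intros z Hzp.
      assert (H1 := Rle_lt_trans _ _ _ (im_le_Cmod _) (Rlt_le_trans _ _ _ Hzp (Rmin_r _ _))).
      assert (H2 := Rle_lt_trans _ _ _ (re_le_Cmod _) (Rlt_le_trans _ _ _ Hzp (Rmin_l _ _))).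
      unfold Cminus in H1, H2; rewrite im_plus, im_opp, im_plus, im_RtoC in H1.
      rewrite re_plus, re_opp, re_plus, re_RtoC in H2.
      apply Rabs_def2 in H1; apply Rabs_def2 in H2; apply IH; lra.
    - replace (w - (w + (3 / 8)%R))%C with (- (3 / 8)%R)%C by ring.
      rewrite Cmod_opp, Cmod_R, Rabs_right; lra. }
  intros z Hi.
  destruct (nfloor_ex (Rmax 0 (4 * (A - Re z)))) as [n Hn]; [apply Rmax_l|].
  apply (H (S n) z Hi).
  assert (H4 := Rmax_r 0 (4 * (A - Re z))).
  rewrite S_INR; lra.
Qed.

(* Two half-planes avoiding 1: first the upper one, then { Re z < 1 } = { 1 + i u | Im u > 0 }. *)
Lemma unique_continuation_left (f : C -> C) (A : R) :
  (forall z : C, z <> RtoC 1 -> exists l, Cder f z l) ->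
  (forall z, A < Re z -> f z = 0%C) ->
  forall z, Re z < 0 -> f z = 0%C.
Proof.
  intros Hf Hz.
  assert (H1 : forall z, 1 < Im z -> f z = 0%C).
  { apply (upper_half_plane_unique f A); [|auto].
    intros z Hi; apply Hf; intros ->; rewrite im_RtoC in Hi; lra. }
  (* With z = 1 + i u, the points Re u > 1 are those with Im z > 1, where f is already known to
     vanish. *)
  assert (H2 : forall u, 1 < Im u -> f (1 + Ci * u)%C = 0%C).
  { apply (upper_half_plane_unique (fun u => f (1 + Ci * u)%C) 1).
    - intros u Hu; destruct (Hf (1 + Ci * u)%C) as [l Hl].
      { destruct u as [u v]; intros E; apply (f_equal Re) in E; unfold Ci in E; simpl in E, Hu; lra. }
      eexists; apply (Cder_comp f (fun u => 1 + Ci * u)%C); [exact Hl|].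
      apply Cder_plus; [apply Cder_const|apply Cder_scal, Cder_id].
    - intros [u v] _ Hu; apply H1; unfold Ci; simpl in *; lra. }
  intros z Hr.
  replace z with (1 + Ci * (- Ci * (z - 1)))%C.
  - apply H2; destruct z as [x y]; unfold Ci; simpl in *; lra.
  - replace (Ci * (- Ci * (z - 1)))%C with (- (Ci * Ci) * (z - 1))%C by ring.
    replace (Ci * Ci)%C with (- (1))%C; [ring|].
    unfold Ci, Cmult, Copp, RtoC; simpl; f_equal; ring.
Qed.

(** * Integrals over the real line *)

(** Continuity is part of the notion, so that every truncated integral exists; the two ends tend to
    infinity independently. *)
Definition is_line_integral (f : R -> C) (l : C) : Prop :=
  (forall t, RCcont f t) /\
  forall eps, 0 < eps -> exists M, forall A B, M <= A -> M <= B ->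
    Cmod (RCInt f (- A) B - l) < eps.

(** A choice operator makes the Mellin transform a total function of s; the value is meaningful only
    where an integral exists. *)
Definition line_integral (f : R -> C) : C := epsilon (inhabits (RtoC 0)) (is_line_integral f).

Lemma ex_RCInt_cont (f : R -> C) (a b : R) : (forall t, RCcont f t) -> ex_RCInt f a b.
Proof. intros H; apply (ex_RInt_continuous (V := C_R_CompleteNormedModule)); auto. Qed.

Lemma is_line_integral_unique (f : R -> C) (l1 l2 : C) :
  is_line_integral f l1 -> is_line_integral f l2 -> l1 = l2.
Proof.
  intros [_ H1] [_ H2]; apply Ceq_minus, Cmod_eq_0, Rle_antisym; [|apply Cmod_ge_0].
  apply le_epsilon; intros eps He; rewrite Rplus_0_l.
  assert (He2 : 0 < eps / 2) by lra.
  destruct (H1 _ He2) as [M1 HM1]; destruct (H2 _ He2) as [M2 HM2].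
  specialize (HM1 _ _ (Rmax_l M1 M2) (Rmax_l M1 M2)).
  specialize (HM2 _ _ (Rmax_r M1 M2) (Rmax_r M1 M2)).
  set (I := RCInt f (- Rmax M1 M2) (Rmax M1 M2)) in *.
  replace (l1 - l2)%C with ((I - l2) - (I - l1))%C by ring.
  eapply Rle_trans; [apply Cmod_minus_triangle|lra].
Qed.

Lemma line_integral_unique (f : R -> C) (l : C) : is_line_integral f l -> line_integral f = l.
Proof.
  intros H; apply (is_line_integral_unique f); auto.
  unfold line_integral; apply epsilon_spec; exists l; exact H.
Qed.

Lemma is_line_integral_ext (f g : R -> C) (l : C) :
  (forall t, f t = g t) -> is_line_integral f l -> is_line_integral g l.
Proof.
  intros E [Hc H]; split.
  - intros t; apply (RCcont_ext f); auto.
  - intros eps He; destruct (H eps He) as [M HM]; exists M; intros A B HA HB.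
    rewrite <- (RCInt_ext f g); auto.
Qed.

Lemma is_RCInt_plus (f g : R -> C) (a b : R) (lf lg : C) :
  is_RCInt f a b lf -> is_RCInt g a b lg -> is_RCInt (fun t => f t + g t)%C a b (lf + lg)%C.
Proof. exact (is_RInt_plus (V := C_R_NormedModule) f g a b lf lg). Qed.

Lemma is_line_integral_plus (f g : R -> C) (lf lg : C) :
  is_line_integral f lf -> is_line_integral g lg ->
  is_line_integral (fun t => f t + g t)%C (lf + lg)%C.
Proof.
  intros [Cf Hf] [Cg Hg]; split; [intros t; apply RCcont_plus; auto|].
  intros eps He; assert (He2 : 0 < eps / 2) by lra.
  destruct (Hf _ He2) as [M1 H1]; destruct (Hg _ He2) as [M2 H2].
  exists (Rmax M1 M2); intros A B HA HB.
  assert (L := Rmax_l M1 M2); assert (L' := Rmax_r M1 M2).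
  specialize (H1 A B ltac:(lra) ltac:(lra)); specialize (H2 A B ltac:(lra) ltac:(lra)).
  rewrite (RCInt_unique _ _ _ _ (is_RCInt_plus f g (- A) B _ _
    (RCInt_correct _ _ _ (ex_RCInt_cont f _ _ Cf)) (RCInt_correct _ _ _ (ex_RCInt_cont g _ _ Cg)))).
  replace (RCInt f (- A) B + RCInt g (- A) B - (lf + lg))%C
    with ((RCInt f (- A) B - lf) + (RCInt g (- A) B - lg))%C by ring.
  eapply Rle_lt_trans; [apply Cmod_triangle|lra].
Qed.

(* Multiplication by i exchanges the components up to sign, so that complex linearity follows
   from the real one. *)
Lemma is_RCInt_Ci (f : R -> C) (a b : R) (l : C) :
  is_RCInt f a b l -> is_RCInt (fun t => Ci * f t)%C a b (Ci * l)%C.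
Proof.
  intros H.
  assert (H1 := is_RInt_fct_extend_fst (U := R_NormedModule) (V := R_NormedModule) f a b l H).
  assert (H2 := is_RInt_fct_extend_snd (U := R_NormedModule) (V := R_NormedModule) f a b l H).
  replace (Ci * l)%C with ((- snd l, fst l) : C)
    by (destruct l; unfold Ci, Cmult; simpl; f_equal; ring).
  apply (is_RInt_ext (V := C_R_NormedModule) (fun t => (- snd (f t), fst (f t)) : C)).
  { intros t _; destruct (f t); unfold Ci, Cmult; simpl; f_equal; ring. }
  apply (is_RInt_fct_extend_pair (U := R_NormedModule) (V := R_NormedModule)); simpl.
  - exact (is_RInt_opp (V := R_NormedModule) _ a b _ H2).
  - exact H1.
Qed.

Lemma is_RCInt_Rscal (k : R) (f : R -> C) (a b : R) (l : C) :
  is_RCInt f a b l -> is_RCInt (fun t => k * f t)%C a b (k * l)%C.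
Proof.
  intros H; rewrite <- scal_R_Cmult.
  apply (is_RInt_ext (V := C_R_NormedModule) (fun t => scal (V := C_R_ModuleSpace) k (f t))).
  { intros t _; apply scal_R_Cmult. }
  exact (is_RInt_scal (V := C_R_NormedModule) f a b k l H).
Qed.

Lemma is_RCInt_scal (k : C) (f : R -> C) (a b : R) (l : C) :
  is_RCInt f a b l -> is_RCInt (fun t => k * f t)%C a b (k * l)%C.
Proof.
  intros H; assert (E : k = (RtoC (Re k) + Ci * RtoC (Im k))%C)
    by (destruct k; unfold Ci, Cmult, Cplus, RtoC; simpl; f_equal; ring).
  replace (k * l)%C with (RtoC (Re k) * l + Ci * (RtoC (Im k) * l))%C by (rewrite E at 3; ring).
  apply (is_RInt_ext (V := C_R_NormedModule) (fun t => (RtoC (Re k) * f t + Ci * (RtoC (Im k) * f t))%C : C)).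
  { intros t _; change ((Re k * f t + Ci * (Im k * f t))%C = (k * f t)%C); rewrite E at 3; ring. }
  apply is_RCInt_plus; [|apply is_RCInt_Ci]; apply is_RCInt_Rscal; auto.
Qed.

Lemma is_line_integral_scal (k : C) (f : R -> C) (l : C) :
  is_line_integral f l -> is_line_integral (fun t => k * f t)%C (k * l)%C.
Proof.
  intros [Cf Hf]; split; [intros t; apply RCcont_mult; [apply RCcont_const|auto]|].
  intros eps He; assert (Hk := Cmod_ge_0 k).
  assert (He2 : 0 < eps / (Cmod k + 1)) by (apply Rdiv_lt_0_compat; lra).
  destruct (Hf _ He2) as [M H1]; exists M; intros A B HA HB; specialize (H1 A B HA HB).
  rewrite (RCInt_unique _ _ _ _ (is_RCInt_scal k f (- A) B _
    (RCInt_correct _ _ _ (ex_RCInt_cont f _ _ Cf)))).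
  replace (k * RCInt f (- A) B - k * l)%C with (k * (RCInt f (- A) B - l))%C by ring.
  rewrite Cmod_mult.
  apply Rmult_lt_compat_r with (r := Cmod k + 1) in H1; [|lra].
  unfold Rdiv in H1; rewrite Rmult_assoc, Rinv_l, Rmult_1_r in H1 by lra.
  assert (H0 := Cmod_ge_0 (RCInt f (- A) B - l)); nra.
Qed.

Lemma is_line_integral_minus (f g : R -> C) (lf lg : C) :
  is_line_integral f lf -> is_line_integral g lg ->
  is_line_integral (fun t => f t - g t)%C (lf - lg)%C.
Proof.
  intros Hf Hg.
  apply (is_line_integral_ext (fun t => f t + (- (1)) * g t)%C); [intros; ring|].
  replace (lf - lg)%C with (lf + (- (1)) * lg)%C by ring.
  apply is_line_integral_plus; auto; apply is_line_integral_scal; auto.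
Qed.

Lemma is_line_integral_shift (f : R -> C) (l : C) (v : R) :
  is_line_integral f l -> is_line_integral (fun t => f (t + v)) l.
Proof.
  intros [Cf Hf].
  assert (Cs : forall t, RCcont (fun t => f (t + v)) t).
  { intros t; apply (continuous_comp (fun t => t + v) f t); [|apply Cf].
    apply (continuous_plus (fun t => t) (fun _ => v)); [apply continuous_id|apply continuous_const]. }
  split; [exact Cs|].
  intros eps He; destruct (Hf eps He) as [M HM]; exists (M + Rabs v); intros A B HA HB.
  assert (V1 := Rle_abs v); assert (V2 := Rle_abs (- v)); rewrite Rabs_Ropp in V2.
  specialize (HM (A - v) (B + v) ltac:(lra) ltac:(lra)).
  replace (RCInt (fun t => f (t + v)) (- A) B) with (RCInt f (- (A - v)) (B + v)); auto.
  symmetry; apply RCInt_unique.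
  apply (is_RInt_ext (V := C_R_NormedModule) (fun t => scal (V := C_R_ModuleSpace) 1 (f (1 * t + v)))).
  { intros t _; rewrite scal_R_Cmult, Cmult_1_l, Rmult_1_l; reflexivity. }
  apply (is_RInt_comp_lin (V := C_R_NormedModule) f 1 v (- A) B).
  replace (1 * - A + v) with (- (A - v)) by ring; replace (1 * B + v) with (B + v) by ring.
  apply RCInt_correct, ex_RCInt_cont; auto.
Qed.

Lemma inv_le_1 (x : R) : 1 <= x -> / x <= 1.
Proof. intros H; rewrite <- Rinv_1; apply Rinv_le_contravar; lra. Qed.

(* exp (- d |u|) is dominated by four times the logistic density, whose primitive is explicit. *)
Lemma exp_abs_le_logistic (d u : R) : 0 < d ->
  exp (- d * Rabs u) <= 4 * (exp (d * u) / (1 + exp (d * u)) ^ 2).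
Proof.
  intros Hd; assert (Hx := exp_pos (d * u)); set (x := exp (d * u)) in *.
  assert (Hq : 0 < (1 + x) ^ 2) by (apply pow_lt; lra).
  apply Rmult_le_reg_r with ((1 + x) ^ 2); auto.
  replace (4 * (x / (1 + x) ^ 2) * (1 + x) ^ 2) with (4 * x) by (field; lra).
  destruct (Rle_lt_dec 0 u) as [Hu|Hu].
  - rewrite Rabs_right by lra; replace (- d * u) with (- (d * u)) by ring.
    rewrite exp_Ropp; fold x.
    assert (1 <= x) by (unfold x; rewrite <- exp_0; apply exp_le; nra).
    apply Rmult_le_reg_l with x; auto.
    replace (x * (/ x * (1 + x) ^ 2)) with ((1 + x) ^ 2) by (field; lra); nra.
  - rewrite Rabs_left by lra; replace (- d * - u) with (d * u) by ring; fold x.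
    assert (x <= 1) by (unfold x; rewrite <- exp_0; apply exp_le; nra).
    assert ((1 + x) ^ 2 <= 4) by nra; nra.
Qed.

(** The exact increment of the logistic primitive is kept: it is small on tails and at most 1
    overall, so the same bound serves for convergence and for the size of the whole integral. *)
Lemma RCInt_dominated (f : R -> C) (K d : R) : 0 < d -> (forall t, RCcont f t) ->
  (forall u, Cmod (f u) <= K * exp (- d * Rabs u)) ->
  forall a b, a <= b ->
  Cmod (RCInt f a b) <= 4 * K / d * (/ (1 + exp (d * a)) - / (1 + exp (d * b))).
Proof.
  intros Hd Hc Hf a b Hab.
  assert (HK : 0 <= K).
  { specialize (Hf 0); rewrite Rabs_R0, Rmult_0_r, exp_0 in Hf.
    generalize (Cmod_ge_0 (f 0)); lra. }
  set (g := fun u => 4 * K * (exp (d * u) / (1 + exp (d * u)) ^ 2)).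
  assert (Hg : is_RInt g a b (4 * K / d * (/ (1 + exp (d * a)) - / (1 + exp (d * b))))).
  { replace (4 * K / d * (/ (1 + exp (d * a)) - / (1 + exp (d * b))))
      with (minus ((fun u => - (4 * K / d) / (1 + exp (d * u))) b) ((fun u => - (4 * K / d) / (1 + exp (d * u))) a)).
    - apply (is_RInt_derive (fun u => - (4 * K / d) / (1 + exp (d * u))) g).
      + intros x _; assert (Hx := exp_pos (d * x)); unfold g; auto_derive; [lra|field; lra].
      + intros x _; assert (Hx := exp_pos (d * x)).
        apply (ex_derive_continuous g x); unfold g; auto_derive.
        repeat split; nra.
    - assert (Ha := exp_pos (d * a)); assert (Hb := exp_pos (d * b)).
      unfold minus, plus, opp; simpl; field; lra. }
  rewrite <- RC_norm.
  apply (norm_RInt_le (V := C_R_NormedModule) f g a b); auto.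
  - intros u _; rewrite RC_norm; eapply Rle_trans; [apply Hf|].
    unfold g; rewrite (Rmult_comm 4 K), Rmult_assoc; apply Rmult_le_compat_l; auto.
    apply exp_abs_le_logistic; auto.
  - apply RCInt_correct, ex_RCInt_cont; auto.
Qed.

Lemma RCInt_swap (f : R -> C) (a b : R) : ex_RCInt f a b -> RCInt f b a = (- RCInt f a b)%C.
Proof.
  intros H; apply RCInt_unique.
  exact (is_RInt_swap (V := C_R_NormedModule) f b a _ (RCInt_correct f a b H)).
Qed.

(** Both endpoints lie beyond M on the same side, in either order: this is what remains when two
    truncated integrals are subtracted. *)
Lemma RCInt_tail (f : R -> C) (K d M : R) : 0 < d -> (forall t, RCcont f t) ->
  (forall u, Cmod (f u) <= K * exp (- d * Rabs u)) ->
  forall a b, (M <= a /\ M <= b) \/ (a <= - M /\ b <= - M) ->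
  Cmod (RCInt f a b) <= 4 * K / d * exp (- d * M).
Proof.
  intros Hd Hc Hf.
  assert (HK : 0 <= K).
  { specialize (Hf 0); rewrite Rabs_R0, Rmult_0_r, exp_0 in Hf.
    generalize (Cmod_ge_0 (f 0)); lra. }
  assert (H : forall a b, a <= b -> (M <= a /\ M <= b) \/ (a <= - M /\ b <= - M) ->
    Cmod (RCInt f a b) <= 4 * K / d * exp (- d * M)).
  { intros a b Hab HM.
    eapply Rle_trans; [apply (RCInt_dominated f K d Hd Hc Hf a b Hab)|].
    apply Rmult_le_compat_l; [apply Rdiv_le_0_compat; lra|].
    assert (Ha := exp_pos (d * a)); assert (Hb := exp_pos (d * b)).
    assert (Hm := exp_pos (- d * M)).
    destruct HM as [HM|HM].
    - assert (E : / exp (d * a) <= exp (- d * M)).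
      { rewrite <- exp_Ropp; apply exp_le; nra. }
      assert (/ (1 + exp (d * a)) <= / exp (d * a)) by (apply Rinv_le_contravar; lra).
      assert (0 < / (1 + exp (d * b))) by (apply Rinv_0_lt_compat; lra).
      lra.
    - assert (E : exp (d * b) <= exp (- d * M)) by (apply exp_le; nra).
      assert (/ (1 + exp (d * a)) <= 1) by (apply inv_le_1; lra).
      assert (1 - / (1 + exp (d * b)) <= exp (d * b)).
      { replace (1 - / (1 + exp (d * b))) with (exp (d * b) * / (1 + exp (d * b))) by (field; lra).
        assert (/ (1 + exp (d * b)) <= 1) by (apply inv_le_1; lra); nra. }
      lra. }
  intros a b HM; destruct (Rle_lt_dec a b) as [Hab|Hab]; [auto|].
  rewrite (RCInt_swap f b a) by (apply ex_RCInt_cont; auto); rewrite Cmod_opp.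
  apply H; [lra|tauto].
Qed.

Lemma exp_decay_eventually (K d eps : R) : 0 < d -> 0 < eps ->
  exists M, 0 <= M /\ K * exp (- d * M) < eps.
Proof.
  intros Hd He.
  set (M := Rmax 0 ((Rabs K / eps) / d)).
  exists M; split; [apply Rmax_l|].
  assert (HM : Rabs K / eps <= d * M).
  { assert (H := Rmax_r 0 ((Rabs K / eps) / d)); fold M in H.
    apply Rmult_le_compat_l with (r := d) in H; [|lra].
    replace (d * (Rabs K / eps / d)) with (Rabs K / eps) in H by (field; lra); auto. }
  assert (HE : 1 + d * M <= exp (d * M)) by apply exp_ineq1_le.
  replace (- d * M) with (- (d * M)) by ring; rewrite exp_Ropp.
  assert (Hp := exp_pos (d * M)).
  apply Rmult_lt_reg_r with (exp (d * M)); auto.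
  rewrite Rmult_assoc, Rinv_l, Rmult_1_r by lra.
  assert (K <= Rabs K) by apply Rle_abs.
  assert (Rabs K = eps * (Rabs K / eps)) by (field; lra).
  nra.
Qed.

(** Cauchy criterion: the truncations at integers have convergent real and imaginary parts, and
    every other truncation is close to these. *)
Lemma ex_line_integral (f : R -> C) (K d : R) : 0 < d -> (forall t, RCcont f t) ->
  (forall u, Cmod (f u) <= K * exp (- d * Rabs u)) -> exists l, is_line_integral f l.
Proof.
  intros Hd Hc Hf.
  assert (Hdiff : forall eps, 0 < eps -> exists M, forall A B A' B',
    M <= A -> M <= B -> M <= A' -> M <= B' ->
    Cmod (RCInt f (- A) B - RCInt f (- A') B') < eps).
  { intros eps He.
    destruct (exp_decay_eventually (2 * (4 * K / d)) d eps Hd He) as [M [HM0 HM]].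
    exists M; intros A B A' B' HA HB HA' HB'.
    rewrite (RCInt_Chasles f (- A) (- A') B), (RCInt_Chasles f (- A') B' B)
      by (apply ex_RCInt_cont; auto).
    replace (RCInt f (- A) (- A') + (RCInt f (- A') B' + RCInt f B' B) - RCInt f (- A') B')%C
      with (RCInt f (- A) (- A') + RCInt f B' B)%C by ring.
    eapply Rle_lt_trans; [apply Cmod_triangle|].
    assert (T := RCInt_tail f K d M Hd Hc Hf).
    assert (T1 := T (- A) (- A') ltac:(lra)); assert (T2 := T B' B ltac:(lra)); lra. }
  set (u := fun n => RCInt f (- INR n) (INR n)).
  assert (Hu : forall eps, 0 < eps -> exists N, forall n m, (N <= n)%nat -> (N <= m)%nat ->
    Cmod (u n - u m) < eps).
  { intros eps He; destruct (Hdiff eps He) as [M HM].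
    destruct (nfloor_ex (Rmax 0 M) (Rmax_l _ _)) as [N HN].
    exists (S N); intros n m Hn Hm.
    apply le_INR in Hn; apply le_INR in Hm; rewrite S_INR in Hn, Hm.
    assert (H := Rmax_r 0 M); apply HM; lra. }
  assert (Hre : ex_finite_lim_seq (fun n => Re (u n))).
  { apply ex_lim_seq_cauchy_corr; intros eps; destruct (Hu eps (cond_pos eps)) as [N HN].
    exists N; intros n m Hn Hm; eapply Rle_lt_trans; [|apply (HN n m Hn Hm)].
    eapply Rle_trans; [|apply re_le_Cmod]; right; unfold Cminus; rewrite re_plus, re_opp; auto. }
  assert (Him : ex_finite_lim_seq (fun n => Im (u n))).
  { apply ex_lim_seq_cauchy_corr; intros eps; destruct (Hu eps (cond_pos eps)) as [N HN].
    exists N; intros n m Hn Hm; eapply Rle_lt_trans; [|apply (HN n m Hn Hm)].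
    eapply Rle_trans; [|apply im_le_Cmod]; right; unfold Cminus; rewrite im_plus, im_opp; auto. }
  destruct Hre as [lr Hr]; destruct Him as [li Hi].
  exists (lr, li); split; auto; intros eps He.
  assert (He2 : 0 < eps / 2) by lra; assert (He4 : 0 < eps / 4) by lra.
  destruct (Hdiff _ He2) as [M HM]; exists M; intros A B HA HB.
  apply is_lim_seq_spec in Hr; apply is_lim_seq_spec in Hi.
  destruct (Hr (mkposreal _ He4)) as [N1 HN1]; destruct (Hi (mkposreal _ He4)) as [N2 HN2].
  destruct (nfloor_ex (Rmax 0 M) (Rmax_l _ _)) as [N3 HN3].
  set (n := (N1 + N2 + S N3)%nat).
  specialize (HN1 n ltac:(unfold n; lia)); specialize (HN2 n ltac:(unfold n; lia)); simpl in HN1, HN2.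
  assert (Hn : M <= INR n).
  { apply Rle_trans with (INR (S N3)); [rewrite S_INR; generalize (Rmax_r 0 M); lra|].
    apply le_INR; unfold n; lia. }
  specialize (HM A B (INR n) (INR n) HA HB Hn Hn); fold (u n) in HM.
  replace (RCInt f (- A) B - (lr, li))%C with ((RCInt f (- A) B - u n) + (u n - (lr, li)))%C by ring.
  eapply Rle_lt_trans; [apply Cmod_triangle|].
  assert (Cmod (u n - (lr, li)) < eps / 2).
  { destruct (u n) as [p q]; simpl in *.
    unfold Cminus, Cplus, Copp; simpl.
    eapply Rle_lt_trans; [apply Cmod_le_Rabs|]; unfold Rminus in *; lra. }
  lra.
Qed.

(** The quantitative tool behind every limit taken under the integral sign: a small coefficient K
    gives a small integral. *)
Lemma line_integral_bound (f : R -> C) (l : C) (K d : R) : 0 < d -> is_line_integral f l ->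
  (forall u, Cmod (f u) <= K * exp (- d * Rabs u)) -> Cmod l <= 4 * K / d.
Proof.
  intros Hd [Hc H] Hf; apply le_epsilon; intros eps He.
  destruct (H eps He) as [M HM].
  set (A := Rmax 0 M).
  specialize (HM A A (Rmax_r _ _) (Rmax_r _ _)).
  assert (HA : 0 <= A) by apply Rmax_l.
  assert (HB := RCInt_dominated f K d Hd Hc Hf (- A) A ltac:(lra)).
  assert (HK : 0 <= 4 * K / d).
  { specialize (Hf 0); rewrite Rabs_R0, Rmult_0_r, exp_0 in Hf.
    apply Rdiv_le_0_compat; generalize (Cmod_ge_0 (f 0)); lra. }
  assert (E1 := exp_pos (d * - A)); assert (E2 := exp_pos (d * A)).
  assert (/ (1 + exp (d * - A)) <= 1) by (apply inv_le_1; lra).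
  assert (0 < / (1 + exp (d * A))) by (apply Rinv_0_lt_compat; lra).
  assert (H3 := Cmod_le_add l (RCInt f (- A) A)); rewrite Cmod_sym in H3.
  nra.
Qed.

(** * Mellin transforms *)

(** Here g is already a function of u = ln t; the weight t^(-s) dt becomes exp ((1 - s) u) du. *)
Definition mellin_integrand (g : R -> R) (s : C) (u : R) : C := (Cexp (u * (1 - s)) * g u)%C.

(* With t = exp u this is the Mellin type integral of t^(-s) g over (0, infinity). *)
Definition mellin (g : R -> R) (s : C) : C := line_integral (mellin_integrand g s).

(** In terms of t = exp u, the first bound controls g near t = 0 by t^(hi - 1), the second controls
    it at infinity by t^(lo - 1). The integrand then decays at both ends as soon as lo < Re s <
    hi. *)
Definition mellin_strip (g : R -> R) (lo hi : R) : Prop :=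
  (forall u, continuous g u) /\
  exists K, forall u, Rabs (g u) <= K * exp ((hi - 1) * u) /\ Rabs (g u) <= K * exp ((lo - 1) * u).

Lemma Cmod_mellin_integrand (g : R -> R) (s : C) (u : R) :
  Cmod (mellin_integrand g s u) = exp (u * (1 - Re s)) * Rabs (g u).
Proof.
  unfold mellin_integrand; rewrite Cmod_mult, Cmod_Cexp, Cmod_R; do 2 f_equal.
  destruct s as [x y]; unfold RtoC; simpl; ring.
Qed.

Lemma RCcont_mellin_integrand (g : R -> R) (s : C) (u : R) :
  continuous g u -> RCcont (mellin_integrand g s) u.
Proof.
  intros H; apply RCcont_mult; [apply RCcont_Cexp_line|apply RCcont_RtoC; auto].
Qed.

(** The rate d is the distance from Re s to the boundary of the strip; the inequalities on d are
    exported so that small displacements of s stay inside. *)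
Lemma mellin_integrand_decay (g : R -> R) (lo hi : R) (s : C) : mellin_strip g lo hi ->
  lo < Re s < hi -> exists K d, 0 < d /\ 0 <= K /\ (d <= Re s - lo /\ d <= hi - Re s) /\
  forall u, Cmod (mellin_integrand g s u) <= K * exp (- d * Rabs u).
Proof.
  intros [_ [K HK]] Hs.
  exists K, (Rmin (Re s - lo) (hi - Re s)).
  assert (M1 := Rmin_l (Re s - lo) (hi - Re s)); assert (M2 := Rmin_r (Re s - lo) (hi - Re s)).
  assert (M0 : 0 < Rmin (Re s - lo) (hi - Re s)) by (apply Rmin_pos; lra).
  set (d := Rmin (Re s - lo) (hi - Re s)) in *.
  assert (HK0 : 0 <= K).
  { destruct (HK 0) as [H _]; rewrite Rmult_0_r, exp_0 in H; generalize (Rabs_pos (g 0)); lra. }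
  repeat split; auto; intros u; rewrite Cmod_mellin_integrand.
  destruct (HK u) as [H1 H2].
  assert (HE := exp_pos (u * (1 - Re s))).
  destruct (Rle_lt_dec 0 u) as [Hu|Hu].
  - rewrite Rabs_right with (r := u) by lra.
    apply Rle_trans with (exp (u * (1 - Re s)) * (K * exp ((lo - 1) * u))); [apply Rmult_le_compat_l; lra|].
    replace (exp (u * (1 - Re s)) * (K * exp ((lo - 1) * u)))
      with (K * exp (u * (1 - Re s) + (lo - 1) * u)) by (rewrite exp_plus; ring).
    apply Rmult_le_compat_l; auto; apply exp_le; nra.
  - rewrite Rabs_left with (r := u) by lra.
    apply Rle_trans with (exp (u * (1 - Re s)) * (K * exp ((hi - 1) * u))); [apply Rmult_le_compat_l; lra|].
    replace (exp (u * (1 - Re s)) * (K * exp ((hi - 1) * u)))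
      with (K * exp (u * (1 - Re s) + (hi - 1) * u)) by (rewrite exp_plus; ring).
    apply Rmult_le_compat_l; auto; apply exp_le; nra.
Qed.

Lemma is_mellin (g : R -> R) (lo hi : R) (s : C) : mellin_strip g lo hi ->
  lo < Re s < hi -> is_line_integral (mellin_integrand g s) (mellin g s).
Proof.
  intros Hg Hs; destruct (mellin_integrand_decay g lo hi s Hg Hs) as [K [d [Hd [_ [_ H]]]]].
  destruct (ex_line_integral (mellin_integrand g s) K d Hd) as [l Hl]; auto.
  { intros t; apply RCcont_mellin_integrand, Hg. }
  unfold mellin; rewrite (line_integral_unique _ l); auto.
Qed.

Lemma sqr_le_exp (x : R) : 0 <= x -> x ^ 2 <= 4 * exp x.
Proof.
  intros Hx; replace (exp x) with (exp (x / 2) * exp (x / 2)) by (rewrite <- exp_plus; f_equal; field).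
  assert (H := exp_ineq1_le (x / 2)); nra.
Qed.

Lemma abs_le_exp (x : R) : 0 <= x -> x <= exp x.
Proof. intros Hx; generalize (exp_ineq1_le x); lra. Qed.

(** Differentiation under the integral sign: the derivative has integrand - u times the original
    one, and [Cexp_bound2] makes the integrated remainder quadratic in h. *)
Lemma mellin_holomorphic (g : R -> R) (lo hi : R) (s : C) : mellin_strip g lo hi ->
  lo < Re s < hi -> exists l, Cder (mellin g) s l.
Proof.
  intros Hg Hs; destruct (mellin_integrand_decay g lo hi s Hg Hs) as [K [d [Hd [HK [Hds H]]]]].
  set (F' := fun u : R => (- u * mellin_integrand g s u)%C).
  assert (Hc : forall t, RCcont F' t).
  { intros t; apply RCcont_mult; [|apply RCcont_mellin_integrand, Hg].
    apply (RCcont_ext (fun u => RtoC (- u))); [intros u; apply RtoC_opp|].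
    apply RCcont_RtoC, (continuous_opp (K := R_AbsRing) (V := R_NormedModule) (fun u : R => u) t), continuous_id. }
  (* Half of the decay rate pays for the factor |u|, through x <= exp x at x = d |u| / 2. *)
  assert (HF' : forall u, Cmod (F' u) <= (K * (2 / d)) * exp (- (d / 2) * Rabs u)).
  { intros u; unfold F'; rewrite Cmod_mult, Cmod_opp, Cmod_R.
    assert (Hu := Rabs_pos u); assert (H1 := abs_le_exp (d / 2 * Rabs u) ltac:(nra)).
    specialize (H u); assert (H0 := Cmod_ge_0 (mellin_integrand g s u)).
    replace (- d * Rabs u) with (- (d / 2) * Rabs u + - (d / 2) * Rabs u) in H by field.
    rewrite exp_plus in H.
    set (E := exp (- (d / 2) * Rabs u)) in *.
    assert (HE : exp (d / 2 * Rabs u) = / E).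
    { unfold E; rewrite <- exp_Ropp; f_equal; ring. }
    assert (E0 : 0 < E) by apply exp_pos.
    rewrite HE in H1.
    assert (H2 : Rabs u <= 2 / d * / E).
    { apply Rmult_le_reg_l with (d / 2); [lra|].
      replace (d / 2 * (2 / d * / E)) with (/ E) by (field; split; lra); auto. }
    apply Rle_trans with (2 / d * / E * (K * (E * E))).
    - apply Rmult_le_compat; auto.
    - right; field; split; lra. }
  destruct (ex_line_integral F' (K * (2 / d)) (d / 2)) as [l Hl]; [lra|auto|auto|].
  exists l.
  (* The decay exp (- d |u|) is spent in quarters: one absorbs u^2, one absorbs exp |u h| as |h| < d
     / 4, and two are left for the integration. The constant 64 / d^2 is 4 / (d / 4)^2, from x^2 <=
     4 exp x. *)
  apply Cder_quadratic with (d / 4) (4 * (K * (64 / d ^ 2)) / (d / 2)); [lra|].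
  intros h Hh.
  assert (Hre : Rabs (Re h) < d / 4) by (eapply Rle_lt_trans; [apply re_le_Cmod|auto]).
  apply Rabs_def2 in Hre.
  assert (Hsh : lo < Re (s + h) < hi) by (rewrite re_plus; lra).
  assert (L : is_line_integral (fun u => mellin_integrand g (s + h)%C u - mellin_integrand g s u - h * F' u)%C
     (mellin g (s + h)%C - mellin g s - h * l)%C).
  { apply is_line_integral_minus; [apply is_line_integral_minus; eapply is_mellin; eauto|].
    apply is_line_integral_scal; auto. }
  replace (4 * (K * (64 / d ^ 2)) / (d / 2) * Cmod h ^ 2)
    with (4 * (K * (64 / d ^ 2) * Cmod h ^ 2) / (d / 2)) by (field; lra).
  refine (line_integral_bound _ _ _ (d / 2) ltac:(lra) L _).
  intros u.
  replace (mellin_integrand g (s + h)%C u - mellin_integrand g s u - h * F' u)%C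
    with (mellin_integrand g s u * (Cexp (- (u * h)) - 1 - - (u * h)))%C.
  2:{ unfold F', mellin_integrand.
      replace (u * (1 - (s + h)))%C with (u * (1 - s) + - (u * h))%C by ring.
      rewrite Cexp_plus; ring. }
  rewrite Cmod_mult.
  assert (Hu := Rabs_pos u); assert (H0 := Cmod_ge_0 h).
  assert (B := Cexp_bound2 (- (u * h))); rewrite Cmod_opp, Cmod_mult, Cmod_R in B.
  assert (Q := sqr_le_exp (d / 4 * Rabs u) ltac:(nra)).
  assert (Ex : exp (Rabs u * Cmod h) <= exp (d / 4 * Rabs u)) by (apply exp_le; nra).
  specialize (H u).
  set (E := exp (d / 4 * Rabs u)) in *.
  assert (E0 : 0 < E) by apply exp_pos.
  assert (HE : exp (- d * Rabs u) = / E ^ 4).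
  { replace (- d * Rabs u) with (- (d / 4 * Rabs u + d / 4 * Rabs u + d / 4 * Rabs u + d / 4 * Rabs u)) by field.
    rewrite exp_Ropp, !exp_plus; fold E; f_equal; ring. }
  assert (HE2 : exp (- (d / 2) * Rabs u) = / E ^ 2).
  { replace (- (d / 2) * Rabs u) with (- (d / 4 * Rabs u + d / 4 * Rabs u)) by field.
    rewrite exp_Ropp, !exp_plus; fold E; f_equal; ring. }
  rewrite HE in H; rewrite HE2.
  assert (Q2 : Rabs u ^ 2 <= 64 / d ^ 2 * E).
  { apply Rmult_le_reg_l with ((d / 4) ^ 2); [apply pow_lt; lra|].
    replace ((d / 4) ^ 2 * Rabs u ^ 2) with ((d / 4 * Rabs u) ^ 2) by ring.
    replace ((d / 4) ^ 2 * (64 / d ^ 2 * E)) with (4 * E) by (field; lra); auto. }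
  assert (P4 : 0 < / E ^ 4) by (apply Rinv_0_lt_compat, pow_lt; auto).
  apply Rle_trans with (K * / E ^ 4 * ((64 / d ^ 2 * E) * Cmod h ^ 2 * E)).
  - apply Rmult_le_compat; auto using Cmod_ge_0.
    eapply Rle_trans; [apply B|].
    assert (0 <= Rabs u ^ 2) by apply pow2_ge_0; assert (0 <= Cmod h ^ 2) by apply pow2_ge_0.
    rewrite Rpow_mult_distr.
    apply Rmult_le_compat; [apply Rmult_le_pos; auto|left; apply exp_pos| |auto].
    apply Rmult_le_compat_r; auto.
  - right; field; split; lra.
Qed.

(** * The secant integral *)

Lemma line_integral_symmetric_limit (f : R -> C) (l l' : C) : is_line_integral f l ->
  (forall eps, 0 < eps -> exists M, forall A, M <= A -> Cmod (RCInt f (- A) A - l') <= eps) ->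
  l = l'.
Proof.
  intros [_ H1] H2; apply Ceq_minus, Cmod_eq_0, Rle_antisym; [|apply Cmod_ge_0].
  apply le_epsilon; intros eps He; rewrite Rplus_0_l.
  assert (He2 : 0 < eps / 2) by lra.
  destruct (H1 _ He2) as [M1 HM1]; destruct (H2 _ He2) as [M2 HM2].
  specialize (HM1 _ _ (Rmax_l M1 M2) (Rmax_l M1 M2)).
  specialize (HM2 _ (Rmax_r M1 M2)).
  set (I := RCInt f (- Rmax M1 M2) (Rmax M1 M2)) in *.
  replace (l - l')%C with ((I - l') - (I - l))%C by ring.
  eapply Rle_trans; [apply Cmod_minus_triangle|lra].
Qed.

Lemma RCder_RtoC (f : R -> R) (t l : R) : is_derive f t l -> RCder (fun u => RtoC (f u)) t (RtoC l).
Proof. intros H; apply RCder_pair; [exact H|apply (is_derive_const (K := R_AbsRing) (V := R_NormedModule))]. Qed.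

(** The function 1 / (1 + t^2) at t = exp u. *)
Definition fermi (u : R) : R := / (1 + exp (2 * u)).

Lemma continuous_fermi (u : R) : continuous fermi u.
Proof.
  apply (ex_derive_continuous fermi u); unfold fermi; auto_derive.
  generalize (exp_pos (2 * u)); lra.
Qed.

Lemma fermi_strip : mellin_strip fermi (- 1) 1.
Proof.
  split; [apply continuous_fermi|].
  exists 1; intros u; unfold fermi; assert (H := exp_pos (2 * u)).
  rewrite Rabs_right by (apply Rle_ge; left; apply Rinv_0_lt_compat; lra); split.
  - replace ((1 - 1) * u) with 0 by ring; rewrite exp_0, Rmult_1_l; apply inv_le_1; lra.
  - replace ((- 1 - 1) * u) with (- (2 * u)) by ring; rewrite exp_Ropp, Rmult_1_l.
    apply Rinv_le_contravar; lra.
Qed.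

(** The arctangent integral of 1 / (1 + t^2); it is the one explicit value that normalizes the
    secant integral for all s. *)
Lemma mellin_fermi_0 : mellin fermi 0%C = RtoC (PI / 2).
Proof.
  apply (line_integral_symmetric_limit (mellin_integrand fermi 0%C)).
  { apply is_mellin with (- 1) 1; [apply fermi_strip|rewrite re_RtoC; lra]. }
  intros eps He.
  assert (Hcont : continuity_pt atan 0) by (apply derivable_continuous_pt, derivable_pt_atan).
  destruct (proj1 (filterlim_locally _ _) (proj1 (continuity_pt_filterlim _ _) Hcont) (mkposreal (eps / 2) ltac:(lra))) as [d Hd].
  destruct (exp_decay_eventually 1 1 d ltac:(lra) (cond_pos d)) as [M [HM0 HM]].
  exists M; intros A HA.
  assert (HI : is_RCInt (mellin_integrand fermi 0%C) (- A) A (RtoC (atan (exp A)) - RtoC (atan (exp (- A))))%C).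
  { apply (is_RCInt_derive (fun u => RtoC (atan (exp u)))).
    - intros u; apply (RCder_eq _ _ (RtoC (exp u / (1 + (exp u) ^ 2)))).
      + apply RCder_RtoC; auto_derive; [auto|unfold Rsqr; field].
        assert (H := exp_pos u); nra.
      + unfold mellin_integrand, fermi.
        replace (u * (1 - 0))%C with (RtoC u) by ring.
        rewrite Cexp_RtoC, <- RtoC_mult; f_equal.
        replace (2 * u) with (u + u) by ring; rewrite exp_plus; field.
        assert (H := exp_pos u); nra.
    - intros u; apply RCcont_mellin_integrand, continuous_fermi. }
  rewrite (RCInt_unique _ _ _ _ HI).
  assert (Hinv := atan_inv (exp A) (exp_pos A)); rewrite <- exp_Ropp in Hinv.
  assert (E : atan (exp A) = PI / 2 - atan (exp (- A))) by lra.
  rewrite E, <- RtoC_minus, <- RtoC_minus, Cmod_R.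
  assert (Hs : Rabs (atan (exp (- A)) - atan 0) < eps / 2).
  { apply (Hd (exp (- A))); change (Rabs (exp (- A) - 0) < d).
    rewrite Rminus_0_r, Rabs_right by (apply Rle_ge; left; apply exp_pos).
    eapply Rle_lt_trans; [|apply HM]; rewrite Rmult_1_l; apply exp_le; lra. }
  rewrite atan_0, Rminus_0_r in Hs; apply Rabs_def2 in Hs.
  apply Rabs_le; lra.
Qed.

Lemma cos_eq_1_small (y : R) : - PI <= y <= PI -> cos y = 1 -> y = 0.
Proof.
  intros Hy Hc; assert (HPI := PI_RGT_0).
  destruct (Rtotal_order y 0) as [H|[H|H]]; auto; exfalso.
  - assert (cos (- y) < cos 0) by (apply cos_decreasing_1; lra).
    rewrite cos_neg, cos_0 in H0; lra.
  - assert (cos y < cos 0) by (apply cos_decreasing_1; lra).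
    rewrite cos_0 in H0; lra.
Qed.

(** In this strip exp v = 1 only at v = 0, where [Cexp1] has the value 1. *)
Lemma Cexp1_nz (v : C) : - PI <= Im v <= PI -> Cexp1 v <> 0%C.
Proof.
  intros Hi E; assert (S := Cexp1_spec v); rewrite E, Cmult_0_r in S.
  assert (Ev : Cexp v = 1%C) by (apply Ceq_minus; auto).
  destruct (Cexp_eq_1 v Ev) as [H1 H2]; apply cos_eq_1_small in H2; auto.
  unfold Cexp1 in E; destruct (Ceq_dec v 0) as [_|N].
  - apply C1_nz; auto.
  - apply N; destruct v as [a b]; simpl in *; subst; reflexivity.
Qed.

Definition half_pi_i : C := (0, PI / 2).

Lemma Cexp_half_pi_i : Cexp half_pi_i = Ci.
Proof. unfold Cexp, half_pi_i, Ci; simpl; rewrite exp_0, cos_PI2, sin_PI2; f_equal; ring. Qed.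

Lemma Ci_sqr : (Ci * Ci)%C = (- (1))%C.
Proof. unfold Ci, Cmult, Copp, RtoC; simpl; f_equal; ring. Qed.

(* Twice the cosine of PI s / 2. *)
Definition two_cos (s : C) : C := (Cexp (half_pi_i * s) + Cexp (- half_pi_i * s))%C.

(** The value of exp (- s w) at w = i PI / 2, the zero of exp w + exp (- w) in the strip 0 <= Im w
    <= PI. *)
Definition kappa (s : C) : C := Cexp (- half_pi_i * s).

(* The quotient (exp(-s w) - kappa s) / (exp w + exp(-w)), with the removable singularity at
   w = i PI / 2 filled in. *)
Definition secant_kernel (s w : C) : C :=
  (- s * Cexp (- half_pi_i * s) * Cexp1 (- s * (w - half_pi_i)) * Cexp (w - half_pi_i)
    * / (2 * Ci * Cexp1 (2 * (w - half_pi_i))))%C.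

Lemma secant_kernel_den (w : C) : 0 <= Im w <= PI -> Cexp1 (2 * (w - half_pi_i)) <> 0%C.
Proof.
  intros Hw; apply Cexp1_nz; destruct w as [a b]; unfold half_pi_i; simpl in *; lra.
Qed.

(** With v = w - i PI / 2, the denominator exp w + exp (- w) is i exp (- v) 2 v [Cexp1] (2 v), and
    the numerator is - s v [kappa] s [Cexp1] (- s v); the common factor v cancels. *)
Lemma secant_kernel_spec (s : C) (w : C) : 0 <= Im w <= PI ->
  (secant_kernel s w * (Cexp w + Cexp (- w)))%C = (Cexp (- s * w) - kappa s)%C.
Proof.
  intros Hw; assert (Hd := secant_kernel_den w Hw).
  unfold secant_kernel, kappa; set (v := (w - half_pi_i)%C) in *.
  assert (S1 := Cexp1_spec (2 * v)); assert (S2 := Cexp1_spec (- s * v)).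
  assert (E1 : Cexp w = (Ci * Cexp v)%C).
  { rewrite <- Cexp_half_pi_i, <- Cexp_plus; f_equal; unfold v; ring. }
  assert (E2 : Cexp (- w) = (- Ci * / Cexp v)%C).
  { rewrite Cexp_inv, E1, <- Ci_inv; field; split; [apply Cexp_nz|apply Ci_nz]. }
  assert (E3 : Cexp (2 * v) = (Cexp v * Cexp v)%C) by (rewrite <- Cexp_plus; f_equal; ring).
  assert (E4 : Cexp (- s * w) = (Cexp (- half_pi_i * s) * Cexp (- s * v))%C).
  { rewrite <- Cexp_plus; f_equal; unfold v; ring. }
  assert (Hv := Cexp_nz v); assert (Hi := Ci_nz).
  rewrite E1, E2, E4.
  assert (S2' : Cexp (- s * v) = (1 + - s * v * Cexp1 (- s * v))%C) by (rewrite S2; ring).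
  assert (S1' : (Cexp v * Cexp v)%C = (1 + 2 * v * Cexp1 (2 * v))%C) by (rewrite S1, E3; ring).
  rewrite S2'.
  transitivity (- s * Cexp (- half_pi_i * s) * Cexp1 (- s * v) * (Cexp v * Cexp v - 1) / (2 * Cexp1 (2 * v)))%C.
  - field; repeat split; auto; apply RtoC_nz; lra.
  - rewrite S1'; field; repeat split; auto; apply RtoC_nz; lra.
Qed.

Lemma secant_kernel_holomorphic (s : C) (A : R) : holomorphic_on (secant_kernel s) (- A) A 0 PI.
Proof.
  intros x y _ Hy.
  assert (D : Cder (fun w => w - half_pi_i)%C (x, y) (1 - 0)%C)
    by (apply Cder_minus; [apply Cder_id|apply Cder_const]).
  destruct (Cder_Cexp1 (- s * ((x, y) - half_pi_i))%C) as [l1 H1].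
  destruct (Cder_Cexp1 (2 * ((x, y) - half_pi_i))%C) as [l2 H2].
  assert (D1 : Cder (fun w => Cexp1 (- s * (w - half_pi_i)))%C (x, y) (- s * (1 - 0) * l1)%C).
  { apply (Cder_comp Cexp1 (fun w => - s * (w - half_pi_i))%C); [exact H1|].
    apply Cder_scal; exact D. }
  assert (D2 : Cder (fun w => 2 * Ci * Cexp1 (2 * (w - half_pi_i)))%C (x, y) (2 * Ci * (2 * (1 - 0) * l2))%C).
  { apply Cder_scal, (Cder_comp Cexp1 (fun w => 2 * (w - half_pi_i))%C); [exact H2|].
    apply Cder_scal; exact D. }
  assert (D3 : Cder (fun w => Cexp (w - half_pi_i))%C (x, y) ((1 - 0) * Cexp ((x, y) - half_pi_i))%C).
  { apply (Cder_comp Cexp (fun w => w - half_pi_i)%C); [apply Cder_Cexp|exact D]. }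
  assert (Hn : (2 * Ci * Cexp1 (2 * ((x, y) - half_pi_i)))%C <> 0%C).
  { apply Cmult_neq_0; [apply Cmult_neq_0; [apply RtoC_nz; lra|apply Ci_nz]|].
    apply secant_kernel_den; exact Hy. }
  assert (D4 := Cder_comp (fun u => / u)%C (fun w => 2 * Ci * Cexp1 (2 * (w - half_pi_i)))%C (x, y) _ _ (Cder_inv _ Hn) D2).
  eexists; unfold secant_kernel.
  apply (Cder_mult (fun w => - s * Cexp (- half_pi_i * s) * Cexp1 (- s * (w - half_pi_i)) * Cexp (w - half_pi_i))%C
    (fun w => / (2 * Ci * Cexp1 (2 * (w - half_pi_i))))%C); [|exact D4].
  apply (Cder_mult (fun w => - s * Cexp (- half_pi_i * s) * Cexp1 (- s * (w - half_pi_i)))%C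
    (fun w => Cexp (w - half_pi_i))%C); [|exact D3].
  apply Cder_scal; exact D1.
Qed.

(** On the vertical sides the denominator is at least exp A / 2, as exp (- A) <= exp A / 2 for A >=
    1, while the numerator grows at most like exp (|Re s| A). These sides therefore vanish in the
    limit when |Re s| < 1. *)
Lemma secant_kernel_side (s : C) (A x y : R) : 1 <= A -> Rabs x = A -> 0 <= y <= PI ->
  Cmod (secant_kernel s (x, y)) <= 4 * (exp (Rabs (Im s) * PI) + Cmod (kappa s)) * exp (- (1 - Rabs (Re s)) * A).
Proof.
  intros HA Hx Hy; assert (HPI := PI_RGT_0).
  set (w := (x, y) : C).
  assert (E := f_equal Cmod (secant_kernel_spec s w Hy)).
  rewrite Cmod_mult in E.
  assert (Hden : exp A / 2 <= Cmod (Cexp w + Cexp (- w))).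
  { assert (H1 : exp A - exp (- A) <= Cmod (Cexp w + Cexp (- w))).
    { assert (T1 := Cmod_le_add (Cexp w) (- Cexp (- w))).
      assert (T2 := Cmod_le_add (- Cexp (- w)) (Cexp w)).
      replace (Cexp w - - Cexp (- w))%C with (Cexp w + Cexp (- w))%C in T1 by ring.
      replace (- Cexp (- w) - Cexp w)%C with (- (Cexp w + Cexp (- w)))%C in T2 by ring.
      rewrite !Cmod_opp, !Cmod_Cexp in T1; rewrite !Cmod_opp, !Cmod_Cexp in T2.
      rewrite re_opp in T1, T2; simpl in T1, T2.
      revert Hx; unfold Rabs; destruct (Rcase_abs x); intros <-; [|lra].
      rewrite Ropp_involutive; lra. }
    assert (H2 : exp (- A) <= exp A / 2).
    { rewrite exp_Ropp; assert (H3 := exp_ineq1_le A); assert (H4 : 2 <= exp A) by lra.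
      apply Rmult_le_reg_l with (exp A); [lra|]; rewrite Rinv_r by lra; nra. }
    lra. }
  assert (Hnum : Cmod (Cexp (- s * w) - kappa s) <= (exp (Rabs (Im s) * PI) + Cmod (kappa s)) * exp (Rabs (Re s) * A)).
  { eapply Rle_trans; [apply Cmod_minus_triangle|].
    rewrite Cmod_Cexp.
    assert (Hre : Re (- s * w) <= Rabs (Im s) * PI + Rabs (Re s) * A).
    { destruct s as [a b]; simpl.
      assert (T1 : - a * x <= Rabs a * A).
      { rewrite <- Hx, <- Rabs_mult; replace (- a * x) with (- (a * x)) by ring.
        rewrite <- Rabs_Ropp; apply Rle_abs. }
      assert (T2 : b * y <= Rabs b * PI).
      { assert (H1 := Rle_abs b); assert (H2 := Rabs_pos b); nra. }
      lra. }
    assert (H1 := exp_le _ _ Hre); rewrite exp_plus in H1.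
    assert (H2 : 1 <= exp (Rabs (Re s) * A)).
    { rewrite <- exp_0; apply exp_le; generalize (Rabs_pos (Re s)); nra. }
    assert (H3 := Cmod_ge_0 (kappa s)); nra. }
  assert (HeA := exp_pos A).
  assert (H0 := Cmod_ge_0 (secant_kernel s w)).
  replace (exp (- (1 - Rabs (Re s)) * A)) with (exp (Rabs (Re s) * A) * / exp A)
    by (rewrite <- exp_Ropp, <- exp_plus; f_equal; ring).
  assert (H1 : Cmod (secant_kernel s w) * (exp A / 2) <= (exp (Rabs (Im s) * PI) + Cmod (kappa s)) * exp (Rabs (Re s) * A)).
  { rewrite <- E in Hnum; eapply Rle_trans; [|apply Hnum]; apply Rmult_le_compat_l; auto. }
  apply Rmult_le_reg_r with (exp A / 2); [lra|].
  eapply Rle_trans; [apply H1|].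
  set (X := (exp (Rabs (Im s) * PI) + Cmod (kappa s)) * exp (Rabs (Re s) * A)) in *.
  replace (4 * (exp (Rabs (Im s) * PI) + Cmod (kappa s)) * (exp (Rabs (Re s) * A) * / exp A) * (exp A / 2))
    with (2 * X) by (unfold X; field; lra).
  assert (0 <= X) by (eapply Rle_trans; [|apply H1]; apply Rmult_le_pos; lra).
  lra.
Qed.

(** A shift of w by i PI changes the sign of exp w + exp (- w) and multiplies exp (- s w) by [kappa]
    s squared. The subtracted constant contributes the integrand at s = 0. *)
Lemma secant_kernel_bottom_top (s : C) (u : R) :
  (secant_kernel s (u, 0) - secant_kernel s (u, PI))%C =
  ((1 + kappa s * kappa s) * mellin_integrand fermi s u - 2 * kappa s * mellin_integrand fermi 0 u)%C.
Proof.
  assert (HPI := PI_RGT_0).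
  assert (S1 := secant_kernel_spec s (u, 0) ltac:(simpl; lra)).
  assert (S2 := secant_kernel_spec s (u, PI) ltac:(simpl; lra)).
  assert (E0 : ((u, 0) : C) = RtoC u) by reflexivity.
  assert (E1 : ((u, PI) : C) = (RtoC u + (half_pi_i + half_pi_i))%C).
  { unfold half_pi_i, RtoC, Cplus; simpl; f_equal; field. }
  assert (Eu := exp_pos u).
  assert (Hn : RtoC (exp u + / exp u) <> 0%C).
  { apply RtoC_nz; assert (0 < / exp u) by (apply Rinv_0_lt_compat; lra); lra. }
  rewrite E0, <- RtoC_opp, !Cexp_RtoC, exp_Ropp, <- RtoC_plus in S1.
  assert (T1 : Cexp (RtoC u + (half_pi_i + half_pi_i)) = (- RtoC (exp u))%C).
  { rewrite !Cexp_plus, Cexp_half_pi_i, Ci_sqr, Cexp_RtoC; ring. }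
  assert (T2 : Cexp (- (RtoC u + (half_pi_i + half_pi_i))) = (- RtoC (/ exp u))%C).
  { rewrite Cexp_inv, T1, RtoC_inv by lra; field; apply RtoC_nz; lra. }
  assert (T3 : Cexp (- s * (RtoC u + (half_pi_i + half_pi_i))) = (Cexp (- s * u) * (kappa s * kappa s))%C).
  { unfold kappa; rewrite <- !Cexp_plus; f_equal; ring. }
  rewrite E1, T1, T2, T3 in S2; rewrite E0, E1.
  assert (F : forall r : C, mellin_integrand fermi r u = (Cexp (- r * u) / RtoC (exp u + / exp u))%C).
  { intros r; unfold mellin_integrand, fermi.
    replace (u * (1 - r))%C with (- r * u + RtoC u)%C by ring.
    rewrite Cexp_plus, Cexp_RtoC; unfold Cdiv; rewrite <- RtoC_inv.
    - rewrite <- Cmult_assoc, <- RtoC_mult; do 2 f_equal.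
      replace (2 * u) with (u + u) by ring; rewrite exp_plus; field; split; nra.
    - assert (0 < / exp u) by (apply Rinv_0_lt_compat; lra); lra. }
  rewrite !F.
  replace (- 0 * u)%C with (RtoC 0) by ring; rewrite Cexp_0.
  set (D := RtoC (exp u + / exp u)) in *.
  assert (S1' : secant_kernel s u = ((Cexp (- s * u) - kappa s) / D)%C) by (rewrite <- S1; field; auto).
  assert (ED : (- RtoC (exp u) + - RtoC (/ exp u))%C = (- D)%C) by (unfold D; rewrite RtoC_plus; ring).
  rewrite ED in S2.
  assert (S2' : secant_kernel s (u + (half_pi_i + half_pi_i)) = (- ((Cexp (- s * u) * (kappa s * kappa s) - kappa s) / D))%C).
  { rewrite <- S2; field; auto. }
  rewrite S1', S2'; field; auto.
Qed.

(** Goursat on growing rectangles gives (1 + [kappa]^2) times the transform equal to 2 [kappa] PI /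
    2; division by [kappa] turns 1 + [kappa]^2 into [two_cos]. *)
Lemma mellin_fermi_two_cos (s : C) : - 1 < Re s < 1 -> (mellin fermi s * two_cos s)%C = RtoC PI.
Proof.
  intros Hs.
  assert (HPI := PI_RGT_0).
  assert (Hk : kappa s <> 0%C) by apply Cexp_nz.
  assert (L1 := is_mellin fermi (- 1) 1 s fermi_strip Hs).
  assert (L0 := is_mellin fermi (- 1) 1 0%C fermi_strip ltac:(rewrite re_RtoC; lra)).
  rewrite mellin_fermi_0 in L0.
  assert (L : is_line_integral (fun u => secant_kernel s (u, 0%R) - secant_kernel s (u, PI))%C
     ((1 + kappa s * kappa s) * mellin fermi s - 2 * kappa s * RtoC (PI / 2))%C).
  { apply (is_line_integral_ext (fun u => (1 + kappa s * kappa s) * mellin_integrand fermi s u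
        - 2 * kappa s * mellin_integrand fermi 0 u)%C).
    - intros u; symmetry; apply secant_kernel_bottom_top.
    - apply is_line_integral_minus; apply is_line_integral_scal; auto. }
  assert (Hr1 : Rabs (Re s) < 1) by (apply Rabs_def1; lra).
  apply (line_integral_symmetric_limit _ _ 0%C) in L.
  - assert (E : (mellin fermi s * two_cos s)%C = (/ kappa s * ((1 + kappa s * kappa s) * mellin fermi s))%C).
    { unfold two_cos.
      replace (Cexp (half_pi_i * s)) with (/ kappa s)%C.
      - fold (kappa s); field; auto.
      - unfold kappa; rewrite <- Cexp_inv; f_equal; ring. }
    rewrite E.
    replace ((1 + kappa s * kappa s) * mellin fermi s)%C
      with (((1 + kappa s * kappa s) * mellin fermi s - 2 * kappa s * RtoC (PI / 2)) + 2 * kappa s * RtoC (PI / 2))%C by ring.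
    rewrite L, RtoC_div by lra; field; auto.
  - intros eps He.
    set (K := 4 * (exp (Rabs (Im s) * PI) + Cmod (kappa s))).
    destruct (exp_decay_eventually (2 * PI * K) (1 - Rabs (Re s)) eps ltac:(lra) He) as [M [HM0 HM]].
    exists (Rmax 1 M); intros A HA.
    assert (HA1 := Rle_trans _ _ _ (Rmax_l _ _) HA); assert (HA2 := Rle_trans _ _ _ (Rmax_r _ _) HA).
    assert (Hol := secant_kernel_holomorphic s A).
    assert (G := goursat_rectangle (secant_kernel s) (- A) A 0 PI ltac:(lra) ltac:(lra) Hol).
    unfold rectangle_integral in G.
    rewrite (RCInt_minus (fun u => secant_kernel s (u, 0)) (fun u => secant_kernel s (u, PI)));
      try (apply (ex_RCInt_horizontal (secant_kernel s) (- A) A 0 PI); auto; lra).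
    set (I1 := RCInt (fun x => secant_kernel s (x, 0)) (- A) A) in *.
    set (I2 := RCInt (fun x => secant_kernel s (x, PI)) (- A) A) in *.
    set (J1 := RCInt (fun y => secant_kernel s (A, y)) 0 PI) in *.
    set (J2 := RCInt (fun y => secant_kernel s (- A, y)) 0 PI) in *.
    assert (B : forall x, Rabs x = A -> - A <= x <= A -> Cmod (RCInt (fun y => secant_kernel s (x, y)) 0 PI)
      <= (PI - 0) * (K * exp (- (1 - Rabs (Re s)) * A))).
    { intros x Hx Hx'; apply RCInt_bound; [lra| |].
      - apply (ex_RCInt_vertical (secant_kernel s) (- A) A 0 PI); auto; lra.
      - intros y Hy; apply secant_kernel_side; auto. }
    assert (B1 := B A ltac:(apply Rabs_right; lra) ltac:(lra)); fold J1 in B1.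
    assert (B2 := B (- A) ltac:(rewrite Rabs_Ropp; apply Rabs_right; lra) ltac:(lra)); fold J2 in B2.
    replace (I1 - I2 - 0)%C with (Ci * J2 - Ci * J1 + (I1 + Ci * J1 - I2 - Ci * J2))%C by ring.
    rewrite G, Cplus_0_r.
    eapply Rle_trans; [apply Cmod_minus_triangle|].
    rewrite !Cmod_mult, Cmod_Ci.
    assert (HK : 0 <= K).
    { unfold K; generalize (exp_pos (Rabs (Im s) * PI)) (Cmod_ge_0 (kappa s)); lra. }
    assert (exp (- (1 - Rabs (Re s)) * A) <= exp (- (1 - Rabs (Re s)) * M)) by (apply exp_le; nra).
    assert (PI * K * exp (- (1 - Rabs (Re s)) * A) <= PI * K * exp (- (1 - Rabs (Re s)) * M)).
    { apply Rmult_le_compat_l; auto; apply Rmult_le_pos; lra. }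
    lra.
Qed.

(** * Partial fractions of the cotangent *)

Lemma sum_n_interleave {G : AbelianMonoid} (c a0 a1 : nat -> G) :
  (forall j, c (2 * j)%nat = a0 j) -> (forall j, c (2 * j + 1)%nat = a1 j) ->
  forall j, sum_n c (2 * j + 1) = plus (sum_n a0 j) (sum_n a1 j).
Proof.
  intros H0 H1; induction j as [|j IH].
  - simpl; rewrite sum_Sn, !sum_O; f_equal; [apply (H0 O)|apply (H1 O)].
  - replace (2 * S j + 1)%nat with (S (S (2 * j + 1))) by lia.
    rewrite !sum_Sn, IH.
    replace (S (2 * j + 1)) with (2 * S j)%nat by lia; rewrite H0.
    replace (S (2 * S j)) with (2 * S j + 1)%nat by lia; rewrite H1.
    rewrite <- !plus_assoc; f_equal; rewrite !plus_assoc; f_equal; apply plus_comm.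
Qed.

(** Used twice: to split the cotangent sum by parity in its duplication formula, and to intersperse
    zeros among the terms of even n in the final series. *)
Lemma is_series_interleave {K : AbsRing} {V : NormedModule K} (c a0 a1 : nat -> V) (l0 l1 : V) :
  (forall j, c (2 * j)%nat = a0 j) -> (forall j, c (2 * j + 1)%nat = a1 j) ->
  is_series a0 l0 -> is_series a1 l1 -> is_series c (plus l0 l1).
Proof.
  intros H0 H1 S0 S1.
  assert (HS := sum_n_interleave c a0 a1 H0 H1).
  unfold is_series in *.
  apply filterlim_locally_ball_norm; intros eps.
  assert (He2 : 0 < eps / 2) by (generalize (cond_pos eps); lra).
  destruct (proj1 (filterlim_locally_ball_norm (sum_n a0) l0) S0 (mkposreal _ He2)) as [N0 HN0];
    destruct (proj1 (filterlim_locally_ball_norm (sum_n a1) l1) S1 (mkposreal _ He2)) as [N1 HN1].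
  unfold ball_norm in *; simpl in HN0, HN1.
  assert (Hcomb : forall x y, norm (minus x l0) < eps / 2 -> norm (minus y l1) < eps / 2 ->
    norm (minus (plus x y) (plus l0 l1)) < eps).
  { intros x y Hx Hy.
    replace (minus (plus x y) (plus l0 l1)) with (plus (minus x l0) (minus y l1)).
    - eapply Rle_lt_trans; [apply norm_triangle|lra].
    - unfold minus.
      assert (E : opp (plus l0 l1) = plus (opp l0) (opp l1)) by apply (opp_plus (G := V)).
      rewrite E, <- !plus_assoc; f_equal; rewrite !plus_assoc; f_equal; apply plus_comm. }
  exists (2 * (N0 + N1) + 2)%nat; intros n Hn.
  destruct (Nat.Even_or_Odd n) as [[j ->]|[j ->]].
  - destruct j as [|j]; [lia|].
    replace (2 * S j)%nat with (S (2 * j + 1)) by lia.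
    rewrite sum_Sn, HS.
    replace (plus (plus (sum_n a0 j) (sum_n a1 j)) (c (S (2 * j + 1)))) with (plus (sum_n a0 (S j)) (sum_n a1 j)).
    + apply Hcomb; [apply HN0|apply HN1]; lia.
    + rewrite sum_Sn; replace (S (2 * j + 1)) with (2 * S j)%nat by lia; rewrite H0.
      rewrite <- !plus_assoc; f_equal; apply plus_comm.
  - rewrite HS; apply Hcomb; [apply HN0|apply HN1]; lia.
Qed.

Lemma is_series_telescope : is_series (fun k => / ((INR k + 1) * (INR k + 2))) 1.
Proof.
  assert (HS : forall n, sum_n (fun k => / ((INR k + 1) * (INR k + 2))) n = 1 - / (INR n + 2)).
  { induction n as [|n IH].
    - rewrite sum_O; simpl; field.
    - rewrite sum_Sn, IH, S_INR; unfold plus; simpl; assert (H := pos_INR n); field; lra. }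
  change (is_lim_seq (sum_n (fun k => / ((INR k + 1) * (INR k + 2)))) (Finite 1)).
  apply (is_lim_seq_ext (fun n => 1 - / (INR n + 2))); [intros n; symmetry; apply HS|].
  replace (Finite 1) with (Finite (1 - 0)) by (f_equal; ring).
  apply is_lim_seq_minus'; [apply is_lim_seq_const|].
  apply (is_lim_seq_inv (fun n => INR n + 2) p_infty); [|discriminate].
  eapply is_lim_seq_plus; [apply is_lim_seq_INR|apply is_lim_seq_const|reflexivity].
Qed.

(** Comparison with the telescoping series of 1 / ((k + 1) (k + 2)), whose tail after N is 1 / (N +
    2). *)
Lemma series_tail_bound (a : nat -> R) (l M : R) (N : nat) :
  (forall k, (N < k)%nat -> 0 <= a k <= M * / ((INR k + 1) * (INR k + 2))) ->
  is_series a l -> 0 <= l - sum_n a N <= M / (INR N + 2).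
Proof.
  intros Ha Hl.
  assert (HN := pos_INR N).
  assert (HM : 0 <= M).
  { destruct (Ha (S N) ltac:(lia)) as [H1 H2].
    assert (0 < / ((INR (S N) + 1) * (INR (S N) + 2))).
    { apply Rinv_0_lt_compat, Rmult_lt_0_compat; rewrite S_INR; lra. }
    apply Rmult_le_reg_r with (/ ((INR (S N) + 1) * (INR (S N) + 2))); lra. }
  assert (HS : forall n, 0 <= sum_n a (N + n) - sum_n a N <= M * (/ (INR N + 2) - / (INR (N + n) + 2))).
  { induction n as [|n IH].
    - rewrite Nat.add_0_r; lra.
    - rewrite Nat.add_succ_r, sum_Sn.
      change (plus (sum_n a (N + n)) (a (S (N + n)))) with (sum_n a (N + n) + a (S (N + n))).
      specialize (Ha (S (N + n)) ltac:(lia)).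
      rewrite S_INR in Ha; rewrite S_INR.
      assert (H := pos_INR (N + n)).
      replace (/ ((INR (N + n) + 1 + 1) * (INR (N + n) + 1 + 2)))
        with (/ (INR (N + n) + 2) - / (INR (N + n) + 1 + 2)) in Ha by (field; lra).
      lra. }
  assert (HL : is_lim_seq (fun n => sum_n a (N + n) - sum_n a N) (l - sum_n a N)).
  { apply is_lim_seq_minus'; [|apply is_lim_seq_const].
    apply (is_lim_seq_ext (fun n => sum_n a (n + N))); [intros n; f_equal; lia|].
    apply is_lim_seq_incr_n; exact Hl. }
  split.
  - apply (is_lim_seq_le (fun _ => 0) (fun n => sum_n a (N + n) - sum_n a N) 0 (l - sum_n a N)).
    + intros n; apply HS.
    + apply is_lim_seq_const.
    + exact HL.
  - apply (is_lim_seq_le (fun n => sum_n a (N + n) - sum_n a N) (fun _ => M / (INR N + 2)) (l - sum_n a N) (M / (INR N + 2))).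
    + intros n; destruct (HS n) as [_ H]; eapply Rle_trans; [apply H|].
      unfold Rdiv; apply Rmult_le_compat_l; auto.
      assert (0 < / (INR (N + n) + 2)) by (apply Rinv_0_lt_compat; generalize (pos_INR (N + n)); lra).
      lra.
    + exact HL.
    + apply is_lim_seq_const.
Qed.

(** This is 1 / b - Re (1 / (b + i t)); without the subtraction of the value at t = 0 the sum over b
    = k + a would diverge. *)
Definition cot_term (b t : R) : R := t ^ 2 / (b * (b ^ 2 + t ^ 2)).

Definition cot_sum (a t : R) : R := Series (fun k => cot_term (INR k + a) t).

Lemma cot_term_pos (b t : R) : 0 < b -> 0 <= cot_term b t.
Proof.
  intros Hb; unfold cot_term; apply Rdiv_le_0_compat; [apply pow2_ge_0|].
  apply Rmult_lt_0_compat; auto; assert (H := pow2_ge_0 t); nra.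
Qed.

Lemma cot_term_le_cube (b t : R) : 0 < b -> cot_term b t <= t ^ 2 * / b ^ 3.
Proof.
  intros Hb; unfold cot_term, Rdiv; apply Rmult_le_compat_l; [apply pow2_ge_0|].
  apply Rinv_le_contravar; [apply pow_lt; auto|].
  assert (H := pow2_ge_0 t); simpl; nra.
Qed.

Lemma cot_sum_is_series (a t : R) : 0 < a <= 1 ->
  is_series (fun k => cot_term (INR k + a) t) (cot_sum a t).
Proof.
  intros Ha; apply Series_correct.
  apply (ex_series_le (V := R_CompleteNormedModule) _ (fun k => (2 * t ^ 2 / a ^ 3) * / ((INR k + 1) * (INR k + 2)))).
  - intros k; assert (Hk := pos_INR k).
    change (norm (cot_term (INR k + a) t)) with (Rabs (cot_term (INR k + a) t)).
    rewrite Rabs_right by (apply Rle_ge, cot_term_pos; lra).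
    eapply Rle_trans; [apply cot_term_le_cube; lra|].
    replace (2 * t ^ 2 / a ^ 3 * / ((INR k + 1) * (INR k + 2)))
      with (t ^ 2 * / (a ^ 3 * ((INR k + 1) * (INR k + 2) / 2))) by (field; lra).
    apply Rmult_le_compat_l; [apply pow2_ge_0|].
    assert (Ha3 : 0 < a ^ 3) by (apply pow_lt; lra).
    apply Rinv_le_contravar; [apply Rmult_lt_0_compat; [lra|nra]|].
    apply Rle_trans with ((a * (INR k + 1)) ^ 3).
    + rewrite Rpow_mult_distr; apply Rmult_le_compat_l; [lra|simpl; nra].
    + apply pow_incr; split; nra.
  - exists (scal (2 * t ^ 2 / a ^ 3) 1); apply (is_series_scal (V := R_NormedModule) (2 * t ^ 2 / a ^ 3)), is_series_telescope.
Qed.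

(** The partial sum always contains the term k = 0, the only one with a small denominator, so the
    bound does not depend on a. The factor t^2 / (1 + t) comes from x^2 + t^2 >= x (1 + t) / 2 for x
    >= 1. *)
Lemma cot_sum_tail (a t : R) (N : nat) : 0 < a <= 1 -> 0 < t ->
  0 <= cot_sum a t - sum_n (fun k => cot_term (INR k + a) t) N <= 16 * t ^ 2 / (1 + t) / (INR N + 2).
Proof.
  intros Ha Ht; apply series_tail_bound; [|apply cot_sum_is_series; auto].
  intros k Hk; split; [apply cot_term_pos; generalize (pos_INR k); lra|].
  assert (Hk1 : 1 <= INR k) by (change 1 with (INR 1); apply le_INR; lia).
  set (x := INR k) in *.
  replace (16 * t ^ 2 / (1 + t) * / ((x + 1) * (x + 2)))
    with (t ^ 2 * / ((1 + t) * ((x + 1) * (x + 2)) / 16)) by (field; lra).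
  unfold cot_term, Rdiv at 1; apply Rmult_le_compat_l; [apply pow2_ge_0|].
  assert (Hden : 0 < (1 + t) * ((x + 1) * (x + 2))) by (apply Rmult_lt_0_compat; [lra|nra]).
  apply Rinv_le_contravar; [lra|].
  assert (H1 : x ^ 2 + t ^ 2 <= (x + a) ^ 2 + t ^ 2) by nra.
  assert (H2 : x * (1 + t) / 2 <= x ^ 2 + t ^ 2).
  { assert (2 * (x * t) <= x ^ 2 + t ^ 2) by (assert (H := pow2_ge_0 (x - t)); lra).
    assert (0 < x * t) by (apply Rmult_lt_0_compat; lra).
    assert (x <= x ^ 2) by nra. assert (0 <= t ^ 2) by apply pow2_ge_0. lra. }
  assert (H3 : (x + 1) * (x + 2) <= 6 * (x * x)) by nra.
  apply Rle_trans with (x * (x * (1 + t) / 2)).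
  - assert ((1 + t) * ((x + 1) * (x + 2)) <= (1 + t) * (6 * (x * x))) by (apply Rmult_le_compat_l; lra).
    assert (0 <= (1 + t) * (x * x)) by (apply Rmult_le_pos; nra).
    lra.
  - apply Rmult_le_compat; try lra. apply Rmult_le_pos; [apply Rmult_le_pos; lra|lra].
Qed.

(** [cot_term] is homogeneous of degree - 1 in (b, t); the even and the odd indices k give k + a = 2
    (j + a / 2) and k + a = 2 (j + (a + 1) / 2). *)
Lemma cot_sum_duplication (a t : R) : 0 < a <= 1 ->
  2 * cot_sum a t = cot_sum (a / 2) (t / 2) + cot_sum ((a + 1) / 2) (t / 2).
Proof.
  intros Ha.
  assert (S := is_series_scal (V := R_NormedModule) 2 _ _ (cot_sum_is_series a t Ha)).
  apply is_series_unique in S; unfold scal in S; simpl in S; unfold mult in S; simpl in S.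
  rewrite <- S; apply is_series_unique.
  apply (is_series_interleave (V := R_NormedModule) (fun k => 2 * cot_term (INR k + a) t)
    (fun k => cot_term (INR k + a / 2) (t / 2)) (fun k => cot_term (INR k + (a + 1) / 2) (t / 2))).
  - intros j; match goal with |- @eq _ ?x ?y => change (@eq R x y) end; rewrite mult_INR; change (INR 2) with 2; unfold cot_term.
    assert (Hj := pos_INR j); assert (Ht := pow2_ge_0 t).
    field; repeat split; nra.
  - intros j; match goal with |- @eq _ ?x ?y => change (@eq R x y) end; rewrite plus_INR, mult_INR; change (INR 2) with 2; change (INR 1) with 1; unfold cot_term.
    assert (Hj := pos_INR j); assert (Ht := pow2_ge_0 t).
    field; repeat split; nra.
  - apply cot_sum_is_series; lra.
  - apply cot_sum_is_series; lra.
Qed.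

(* cot (PI a) - Re cot (PI (a + i t)) *)
Definition cot_drop (a t : R) : R :=
  cos (PI * a) / sin (PI * a) * (sinh (PI * t) ^ 2 / (sinh (PI * t) ^ 2 + sin (PI * a) ^ 2)).

Lemma sin_PI_pos (a : R) : 0 < a < 1 -> 0 < sin (PI * a).
Proof. intros Ha; assert (H := PI_RGT_0); apply sin_gt_0; nra. Qed.

Lemma sinh_pos (x : R) : 0 < x -> 0 < sinh x.
Proof. intros Hx; unfold sinh; assert (exp (- x) < exp x) by (apply exp_increasing; lra); lra. Qed.

Lemma cot_drop_reflection (a t : R) : cot_drop (1 - a) t = - cot_drop a t.
Proof.
  unfold cot_drop; replace (PI * (1 - a)) with (PI - PI * a) by ring.
  rewrite cos_minus, sin_minus, cos_PI, sin_PI.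
  replace (-1 * cos (PI * a) + 0 * sin (PI * a)) with (- cos (PI * a)) by ring.
  replace (0 * cos (PI * a) - -1 * sin (PI * a)) with (sin (PI * a)) by ring.
  unfold Rdiv; ring.
Qed.

Lemma sinh_double (x : R) : sinh (2 * x) = 2 * sinh x * cosh x.
Proof.
  unfold sinh, cosh; replace (- (2 * x)) with (- x + - x) by ring.
  replace (2 * x) with (x + x) by ring; rewrite !exp_plus; field.
Qed.

Lemma cosh_sqr (x : R) : cosh x ^ 2 = 1 + sinh x ^ 2.
Proof.
  unfold sinh, cosh.
  assert (H : exp x * exp (- x) = 1) by (rewrite <- exp_plus, Rplus_opp_r; apply exp_0).
  nra.
Qed.

(** The real part of 2 cot (2 z) = cot z + cot (z + PI / 2), subtracted from the same identity on
    the real axis. *)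
Lemma cot_drop_duplication (a t : R) : 0 < a < 1 -> 0 < t ->
  2 * cot_drop a t = cot_drop (a / 2) (t / 2) + cot_drop ((a + 1) / 2) (t / 2).
Proof.
  intros Ha Ht; assert (HPI := PI_RGT_0); unfold cot_drop.
  set (x := PI * (a / 2)); set (y := PI * (t / 2)).
  replace (PI * a) with (2 * x) by (unfold x; field).
  replace (PI * t) with (2 * y) by (unfold y; field).
  replace (PI * ((a + 1) / 2)) with (x + PI / 2) by (unfold x; field).
  rewrite sinh_double, sin_2a, cos_2a, cos_plus, sin_plus, cos_PI2, sin_PI2.
  assert (Hs : 0 < sin x) by (unfold x; apply sin_PI_pos; lra).
  assert (Hc : 0 < cos x) by (apply cos_gt_0; unfold x; nra).
  assert (Hy : 0 < sinh y) by (apply sinh_pos; unfold y; nra).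
  assert (C2 := cosh_sqr y); assert (T := sin2_cos2 x); unfold Rsqr in T.
  set (s := sin x) in *; set (c := cos x) in *; set (S := sinh y) in *; set (K := cosh y) in *.
  replace ((2 * S * K) ^ 2) with (4 * S ^ 2 * (1 + S ^ 2)) by (rewrite <- C2; ring).
  replace (c * 0 - s * 1) with (- s) by ring; replace (s * 0 + c * 1) with c by ring.
  assert (E1 : s * s = 1 - c * c) by lra.
  assert (S2 : 0 < S ^ 2) by (apply pow_lt; auto).
  replace (2 * (( c * c - s * s) / (2 * s * c) * (4 * S ^ 2 * (1 + S ^ 2) / (4 * S ^ 2 * (1 + S ^ 2) + (2 * s * c) ^ 2))))
    with ((c * c - s * s) / (s * c) * (S ^ 2 * (1 + S ^ 2) / ((S ^ 2 + s ^ 2) * (S ^ 2 + c ^ 2)))).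
  - assert (E2 : 1 = s ^ 2 + c ^ 2) by (simpl; lra).
    replace (S ^ 2 * (1 + S ^ 2)) with (S ^ 2 * (s ^ 2 + c ^ 2 + S ^ 2)) by (rewrite <- E2; ring).
    field_simplify_eq; [|repeat split; nra]. ring.
  - replace (4 * S ^ 2 * (1 + S ^ 2) + (2 * s * c) ^ 2) with (4 * ((S ^ 2 + s ^ 2) * (S ^ 2 + c ^ 2))).
    + field; repeat split; nra.
    + assert (E2 : 1 = s ^ 2 + c ^ 2) by (simpl; lra).
      replace (1 + S ^ 2) with (s ^ 2 + c ^ 2 + S ^ 2) by lra; ring.
Qed.

Lemma sin_lower (x : R) : 0 <= x <= 2 -> x - x ^ 3 / 6 <= sin x.
Proof.
  intros Hx; destruct (pre_sin_bound x 0) as [H _]; try lra.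
  eapply Rle_trans; [|apply H]; unfold sin_approx, sin_term; simpl; right; field.
Qed.

Lemma cos_lower (x : R) : 0 <= x <= 2 -> 1 - x ^ 2 / 2 <= cos x.
Proof.
  intros Hx; destruct (pre_cos_bound x 0) as [H _]; try lra.
  eapply Rle_trans; [|apply H]; unfold cos_approx, cos_term; simpl; right; field.
Qed.

Lemma sinh_bound (x : R) : 0 <= x <= 1 -> Rabs (sinh x - x) <= 3 * x ^ 3.
Proof.
  intros Hx.
  assert (B1 := Cexp_bound3 (RtoC x)); assert (B2 := Cexp_bound3 (RtoC (- x))).
  rewrite Cexp_RtoC, Cmod_R, Rabs_right in B1 by lra.
  rewrite Cexp_RtoC, Cmod_R, Rabs_Ropp, Rabs_right in B2 by lra.
  assert (E : forall y, (RtoC (exp y) - 1 - RtoC y - RtoC y * RtoC y / 2)%C = RtoC (exp y - 1 - y - y * y / 2)).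
  { intros y; rewrite !RtoC_minus, RtoC_div, RtoC_mult by lra; reflexivity. }
  rewrite E, Cmod_R in B1; rewrite E, Cmod_R in B2.
  assert (Hexp : x ^ 3 * exp x <= x ^ 3 * 3).
  { apply Rmult_le_compat_l; [apply pow_le; lra|].
    apply Rle_trans with (exp 1); [apply exp_le; lra|apply exp_le_3]. }
  apply Rabs_le_between in B1; apply Rabs_le_between in B2.
  apply Rabs_le; unfold sinh; nra.
Qed.

(** The bound must be uniform in A, because duplication moves a as well as t and a may become small
    compared with t. Here A = PI b and T = PI t later on. *)
Lemma cot_estimate (A T : R) : 0 < A <= 2 -> sin A > 0 -> 0 < T <= / 3 ->
  Rabs (T ^ 2 / (A * (A ^ 2 + T ^ 2)) - cos A / sin A * (sinh T ^ 2 / (sinh T ^ 2 + sin A ^ 2))) <= 35 * T.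
Proof.
  intros HA Hs HT.
  assert (B1 := sin_lower A ltac:(lra)); assert (B2 := cos_lower A ltac:(lra)).
  assert (B3 := sin_lt_x A ltac:(lra)); assert (B4 := COS_bound A).
  assert (B5 := sinh_bound T ltac:(lra)); apply Rabs_le_between in B5.
  set (s := sin A) in *; set (c := cos A) in *; set (S := sinh T) in *.
  assert (HA2 : 0 < A ^ 2 <= 4) by nra.
  assert (HT2 : 0 < T ^ 2 <= / 9) by nra.
  assert (Hs3 : A / 3 <= s) by nra.
  assert (HS1 : 2 / 3 * T <= S) by nra.
  assert (HS2 : S <= 4 / 3 * T) by nra.
  set (u := T ^ 2 / (A ^ 2 + T ^ 2)); set (w := S ^ 2 / (S ^ 2 + s ^ 2)).
  assert (Hw0 : 0 <= w) by (unfold w; apply Rdiv_le_0_compat; nra).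
  assert (Hden : A ^ 2 + T ^ 2 <= 9 * (S ^ 2 + s ^ 2)).
  { assert (4 / 9 * T ^ 2 <= S ^ 2) by nra.
    assert (A ^ 2 / 9 <= s ^ 2) by nra. lra. }
  set (X := A ^ 2 + T ^ 2) in *; set (Y := S ^ 2 + s ^ 2) in *.
  assert (HX : 0 < X) by (unfold X; lra). assert (HY : 0 < Y) by lra.
  (* The difference u - w will be divided by A; the Taylor errors of sin A and of sinh T supply the
     factor A that compensates. *)
  assert (Huw : Rabs (u - w) <= 32 * (A * T)).
  { assert (E : u - w = (T ^ 2 * s ^ 2 - S ^ 2 * A ^ 2) / (X * Y)) by (unfold u, w, X, Y in *; field; lra).
    rewrite E; unfold Rdiv; rewrite Rabs_mult.
    assert (HXY : 0 < X * Y) by (apply Rmult_lt_0_compat; lra).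
    rewrite (Rabs_right (/ (X * Y))) by (apply Rle_ge; left; apply Rinv_0_lt_compat; auto).
    apply Rmult_le_reg_r with (X * Y); auto.
    rewrite Rmult_assoc, Rinv_l, Rmult_1_r by lra.
    assert (N1 : 0 <= A ^ 2 - s ^ 2 <= A ^ 4 / 3).
    { split; [nra|].
      replace (A ^ 2 - s ^ 2) with ((A - s) * (A + s)) by ring.
      replace (A ^ 4 / 3) with ((A ^ 3 / 6) * (2 * A)) by field.
      apply Rmult_le_compat; lra. }
    assert (N2 : - (7 * T ^ 4) <= T ^ 2 - S ^ 2 <= 7 * T ^ 4).
    { replace (T ^ 2 - S ^ 2) with ((T - S) * (T + S)) by ring.
      assert (0 <= T ^ 3) by (apply pow_le; lra).
      assert (T ^ 3 * T = T ^ 4) by ring.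
      assert (- (3 * T ^ 3) * (7 / 3 * T) <= (T - S) * (T + S)) by nra.
      assert ((T - S) * (T + S) <= (3 * T ^ 3) * (7 / 3 * T)) by nra.
      lra. }
    assert (N3 : Rabs (T ^ 2 * s ^ 2 - S ^ 2 * A ^ 2) <= 7 * (A ^ 2 * T ^ 2) * X).
    { replace (T ^ 2 * s ^ 2 - S ^ 2 * A ^ 2) with (- (T ^ 2 * (A ^ 2 - s ^ 2)) + A ^ 2 * (T ^ 2 - S ^ 2)) by ring.
      assert (P1 : 0 <= T ^ 2 * (A ^ 2 - s ^ 2)) by (apply Rmult_le_pos; lra).
      assert (P2 : T ^ 2 * (A ^ 2 - s ^ 2) <= T ^ 2 * (A ^ 4 / 3)) by (apply Rmult_le_compat_l; lra).
      assert (P3 : A ^ 2 * (T ^ 2 - S ^ 2) <= A ^ 2 * (7 * T ^ 4)) by (apply Rmult_le_compat_l; lra).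
      assert (P4 : A ^ 2 * - (7 * T ^ 4) <= A ^ 2 * (T ^ 2 - S ^ 2)) by (apply Rmult_le_compat_l; lra).
      assert (P5 : 0 <= T ^ 2 * A ^ 4) by (apply Rmult_le_pos; [lra|apply pow_le; lra]).
      unfold X; apply Rabs_le; lra. }
    assert (HAT : 0 < A * T) by (apply Rmult_lt_0_compat; lra).
    assert (N4 : 2 * (A * T) <= X) by (assert (H := pow2_ge_0 (A - T)); unfold X; lra).
    assert (N5 : 7 * (A ^ 2 * T ^ 2) * X <= 7 / 2 * (A * T) * X * X).
    { replace (7 * (A ^ 2 * T ^ 2) * X) with (7 / 2 * (A * T) * X * (2 * (A * T))) by field.
      apply Rmult_le_compat_l; auto; apply Rmult_le_pos; lra. }
    assert (N6 : 7 / 2 * (A * T) * X * X <= 7 / 2 * (A * T) * X * (9 * Y)).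
    { apply Rmult_le_compat_l; auto; apply Rmult_le_pos; lra. }
    assert (0 <= A * T * (X * Y)) by (apply Rmult_le_pos; lra).
    lra. }
  (* From 2 S s <= S^2 + s^2. The factor 1 / A is absorbed by the bound of order A on 1 / A - cot A
     below. *)
  assert (Hws : w <= 2 * T / A).
  { assert (w <= S / (2 * s)).
    { unfold w; fold Y; apply Rmult_le_reg_r with (Y * (2 * s)); [apply Rmult_lt_0_compat; lra|].
      replace (S ^ 2 / Y * (Y * (2 * s))) with (S * (2 * S * s)) by (field; lra).
      replace (S / (2 * s) * (Y * (2 * s))) with (S * Y) by (field; lra).
      apply Rmult_le_compat_l; [lra|]; assert (H := pow2_ge_0 (S - s)); unfold Y; lra. }
    eapply Rle_trans; [apply H|].
    apply Rmult_le_reg_r with (2 * s * A); [apply Rmult_lt_0_compat; lra|].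
    replace (S / (2 * s) * (2 * s * A)) with (S * A) by (field; lra).
    replace (2 * T / A * (2 * s * A)) with (4 * (T * s)) by (field; lra).
    assert (T * (A / 3) <= T * s) by (apply Rmult_le_compat_l; lra).
    assert (S * A <= 4 / 3 * T * A) by (apply Rmult_le_compat_r; lra). lra. }
  assert (Hc : Rabs (/ A - c / s) <= 3 / 2 * A).
  { replace (/ A - c / s) with ((s - A * c) / (A * s)) by (field; lra).
    assert (HAs : 0 < A * s) by (apply Rmult_lt_0_compat; lra).
    unfold Rdiv at 1; rewrite Rabs_mult, (Rabs_right (/ (A * s))) by (apply Rle_ge; left; apply Rinv_0_lt_compat; auto).
    apply Rmult_le_reg_r with (A * s); auto; rewrite Rmult_assoc, Rinv_l, Rmult_1_r by lra.
    assert (M1 : A * (1 - A ^ 2 / 2) <= A * c) by (apply Rmult_le_compat_l; lra).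
    assert (M2 : A * c <= A * 1) by (apply Rmult_le_compat_l; lra).
    assert (M3 : A ^ 3 / 2 <= 3 / 2 * A * (A * s)).
    { replace (A ^ 3 / 2) with (3 / 2 * A * (A * (A / 3))) by field.
      apply Rmult_le_compat_l; [lra|]; apply Rmult_le_compat_l; lra. }
    assert (0 < A ^ 3) by (apply pow_lt; lra).
    apply Rabs_le; lra. }
  replace (T ^ 2 / (A * X) - c / s * w) with (/ A * (u - w) + (/ A - c / s) * w)
    by (unfold u, w, X, Y in *; field; lra).
  eapply Rle_trans; [apply Rabs_triang|]; rewrite !Rabs_mult.
  rewrite (Rabs_right (/ A)) by (apply Rle_ge; left; apply Rinv_0_lt_compat; lra).
  rewrite (Rabs_right w) by lra.
  assert (F1 : / A * Rabs (u - w) <= 32 * T).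
  { apply Rmult_le_reg_l with A; [lra|]; rewrite <- Rmult_assoc, Rinv_r, Rmult_1_l by lra; lra. }
  assert (F2 : Rabs (/ A - c / s) * w <= 3 / 2 * A * (2 * T / A)).
  { apply Rmult_le_compat; auto using Rabs_pos. }
  replace (3 / 2 * A * (2 * T / A)) with (3 * T) in F2 by (field; lra).
  lra.
Qed.

(** The error in the partial fraction expansion of PI cot (PI a) - Re PI cot (PI (a + i t)), to be
    shown zero. *)
Definition cot_defect (a t : R) : R := cot_sum a t - cot_sum (1 - a) t - PI * cot_drop a t.

Lemma cot_defect_reflection (a t : R) : cot_defect (1 - a) t = - cot_defect a t.
Proof.
  unfold cot_defect; rewrite cot_drop_reflection.
  replace (1 - (1 - a)) with a by ring; ring.
Qed.

Lemma cot_defect_duplication (a t : R) : 0 < a < 1 -> 0 < t ->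
  2 * cot_defect a t = cot_defect (a / 2) (t / 2) + cot_defect ((a + 1) / 2) (t / 2).
Proof.
  intros Ha Ht; unfold cot_defect.
  assert (E1 := cot_sum_duplication a t ltac:(lra)).
  assert (E2 := cot_sum_duplication (1 - a) t ltac:(lra)).
  assert (E3 := cot_drop_duplication a t Ha Ht).
  replace (1 - a / 2) with ((1 - a + 1) / 2) by field.
  replace (1 - (a + 1) / 2) with ((1 - a) / 2) by field.
  apply (f_equal (Rmult PI)) in E3; lra.
Qed.

(** For b <= 1 / 2 only the first term of [cot_sum b] can be singular, and [cot_estimate] matches it
    with the cotangent; everything else is at most 8 t per piece. Reflection handles a > 1 / 2. The
    constant 1000 is generous. *)
Lemma cot_defect_small (a t : R) : 0 < a < 1 -> 0 < t -> PI * t <= / 3 ->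
  Rabs (cot_defect a t) <= 1000 * t.
Proof.
  intros Ha Ht Hsm; assert (HPI := PI_RGT_0); assert (HPI4 := PI_4).
  assert (HPI3 : 3 < PI) by (generalize PI2_3_2; lra).
  assert (Ht1 : t <= / 9) by nra.
  assert (H : forall b, 0 < b <= / 2 -> Rabs (cot_defect b t) <= 1000 * t).
  { intros b Hb.
    assert (Hsin := sin_PI_pos b ltac:(lra)).
    assert (Hpb : 0 < PI * b <= 2).
    { split; [apply Rmult_lt_0_compat; lra|].
      apply Rle_trans with (4 * / 2); [apply Rmult_le_compat; lra|lra]. }
    assert (Hpt : 0 < PI * t) by (apply Rmult_lt_0_compat; lra).
    assert (E := cot_estimate (PI * b) (PI * t) Hpb Hsin (conj Hpt Hsm)).
    assert (E1 : PI * ((PI * t) ^ 2 / (PI * b * ((PI * b) ^ 2 + (PI * t) ^ 2))) = cot_term b t).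
    { unfold cot_term; field; repeat split; nra. }
    assert (T1 := cot_sum_tail b t 0 ltac:(lra) Ht); assert (T2 := cot_sum_tail (1 - b) t 0 ltac:(lra) Ht).
    rewrite sum_O in T1, T2; simpl INR in T1, T2.
    replace (0 + b) with b in T1 by ring; replace (0 + (1 - b)) with (1 - b) in T2 by ring.
    assert (Hq : 16 * t ^ 2 / (1 + t) / (0 + 2) <= 8 * t).
    { replace (16 * t ^ 2 / (1 + t) / (0 + 2)) with (8 * t * (t / (1 + t))) by (field; lra).
      rewrite <- (Rmult_1_r (8 * t)) at 2; apply Rmult_le_compat_l; [lra|].
      apply Rmult_le_reg_r with (1 + t); [lra|]; unfold Rdiv; rewrite Rmult_assoc, Rinv_l; lra. }
    assert (T3 : 0 <= cot_term (1 - b) t <= 8 * t).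
    { split; [apply cot_term_pos; lra|].
      eapply Rle_trans; [apply cot_term_le_cube; lra|].
      assert (/ (1 - b) ^ 3 <= 8).
      { replace 8 with (/ ((/ 2) ^ 3)) by (simpl; field).
        apply Rinv_le_contravar; [apply pow_lt; lra|apply pow_incr; lra]. }
      apply Rle_trans with (t ^ 2 * 8); [apply Rmult_le_compat_l; [apply pow2_ge_0|auto]|nra]. }
    unfold cot_defect.
    apply Rmult_le_compat_l with (r := PI) in E; [|lra].
    rewrite <- (Rabs_right PI) in E at 1 by lra; rewrite <- Rabs_mult in E.
    rewrite Rmult_minus_distr_l, E1 in E.
    change (cos (PI * b) / sin (PI * b) * (sinh (PI * t) ^ 2 / (sinh (PI * t) ^ 2 + sin (PI * b) ^ 2)))
      with (cot_drop b t) in E.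
    assert (PI * (35 * (PI * t)) <= 560 * t) by nra.
    apply Rabs_le_between in E; apply Rabs_le; lra. }
  destruct (Rle_lt_dec a (/ 2)) as [Hle|Hgt]; [apply H; lra|].
  rewrite <- Rabs_Ropp, <- cot_defect_reflection; apply H; lra.
Qed.

(* The defect is the average of two values of itself at t / 2, and is O(t): it vanishes. *)
Lemma cot_defect_zero (a t : R) : 0 < a < 1 -> 0 < t -> cot_defect a t = 0.
Proof.
  intros Ha Ht; assert (HPI := PI_RGT_0).
  assert (H : forall n a t, 0 < a < 1 -> 0 < t -> PI * (t * (/ 2) ^ n) <= / 3 ->
    Rabs (cot_defect a t) <= 1000 * (t * (/ 2) ^ n)).
  { induction n as [|n IH]; intros b y Hb Hy Hsm.
    - simpl in *; rewrite Rmult_1_r in *; apply cot_defect_small; auto.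
    - assert (D := cot_defect_duplication b y Hb Hy).
      assert (E : y / 2 * (/ 2) ^ n = y * (/ 2) ^ S n) by (simpl; field).
      assert (I1 := IH (b / 2) (y / 2) ltac:(lra) ltac:(lra) ltac:(rewrite E; auto)).
      assert (I2 := IH ((b + 1) / 2) (y / 2) ltac:(lra) ltac:(lra) ltac:(rewrite E; auto)).
      rewrite E in I1, I2.
      apply Rabs_le_between in I1; apply Rabs_le_between in I2; apply Rabs_le; lra. }
  destruct (Req_dec (cot_defect a t) 0) as [|Hne]; auto; exfalso.
  apply Rabs_pos_lt in Hne.
  destruct (pow_half_small t (Rmin (/ 3 / PI) (Rabs (cot_defect a t) / 1000))) as [n Hn].
  { apply Rmin_pos; [apply Rdiv_lt_0_compat; lra|lra]. }
  assert (H1 := Rlt_le_trans _ _ _ Hn (Rmin_l _ _)); assert (H2 := Rlt_le_trans _ _ _ Hn (Rmin_r _ _)).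
  assert (H3 : PI * (t * (/ 2) ^ n) <= / 3).
  { apply Rlt_le, Rmult_lt_reg_r with (/ PI); [apply Rinv_0_lt_compat; auto|].
    replace (PI * (t * (/ 2) ^ n) * / PI) with (t * (/ 2) ^ n) by (field; lra); exact H1. }
  specialize (H n a t Ha Ht H3); lra.
Qed.

(** * Continuation of zeta(s, a) - zeta(s, 1 - a) *)

Lemma cpow_neg_Cexp (b : R) (s : C) : cpow_neg b s = Cexp (- s * ln b).
Proof.
  unfold cpow_neg, Cexp; destruct s as [x y]; simpl.
  replace (- x * ln b - - y * 0) with (- x * ln b) by ring.
  replace (- x * 0 + - y * ln b) with (- y * ln b) by ring; reflexivity.
Qed.

Definition cot_PI (a : R) : R := cos (PI * a) / sin (PI * a).

Definition drop_exp (a u : R) : R := cot_drop a (exp u).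

(* Re cot (PI (a + i t)) at t = exp u *)
Definition cot_exp (a u : R) : R := cot_PI a - drop_exp a u.

(** This form shows the decay at infinity, with sinh^2 in the denominator, and that the quotient
    never exceeds 1. *)
Lemma cot_exp_eq (a u : R) : 0 < a < 1 ->
  cot_exp a u = cot_PI a * (sin (PI * a) ^ 2 / (sinh (PI * exp u) ^ 2 + sin (PI * a) ^ 2)).
Proof.
  intros Ha; assert (Hs := sin_PI_pos a Ha).
  unfold cot_exp, drop_exp, cot_drop; fold (cot_PI a).
  assert (0 <= sinh (PI * exp u) ^ 2) by apply pow2_ge_0.
  field; nra.
Qed.

Lemma continuous_drop_exp (a u : R) : 0 < a < 1 -> continuous (drop_exp a) u.
Proof.
  intros Ha; assert (Hs := sin_PI_pos a Ha).
  apply (ex_derive_continuous (drop_exp a) u); unfold drop_exp, cot_drop, sinh; auto_derive.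
  set (x := (_ + - _) * / 2); nra.
Qed.

Lemma continuous_cot_exp (a u : R) : 0 < a < 1 -> continuous (cot_exp a) u.
Proof.
  intros Ha; apply (continuous_minus (V := R_NormedModule) (fun _ => cot_PI a) (drop_exp a));
    [apply continuous_const|apply continuous_drop_exp; auto].
Qed.

Lemma exp_2u (u : R) : exp (2 * u) = exp u ^ 2.
Proof. replace (2 * u) with (u + u) by ring; rewrite exp_plus; ring. Qed.

Lemma exp_INR_mult (n : nat) (u : R) : exp (INR n * u) = exp u ^ n.
Proof.
  induction n as [|n IH]; [simpl; rewrite Rmult_0_l; apply exp_0|].
  rewrite S_INR, Rmult_plus_distr_r, exp_plus, IH, Rmult_1_l; simpl; ring.
Qed.

Lemma cot_sum_le_sqr (a t : R) : 0 < a <= 1 -> 0 < t ->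
  0 <= cot_sum a t <= (/ a ^ 3 + 8) * t ^ 2.
Proof.
  intros Ha Ht; assert (T := cot_sum_tail a t 0 Ha Ht).
  rewrite sum_O in T; simpl INR in T; replace (0 + a) with a in T by ring.
  assert (T1 := cot_term_pos a t ltac:(lra)); assert (T2 := cot_term_le_cube a t ltac:(lra)).
  assert (16 * t ^ 2 / (1 + t) / (0 + 2) <= 8 * t ^ 2).
  { replace (16 * t ^ 2 / (1 + t) / (0 + 2)) with (8 * t ^ 2 * / (1 + t)) by (field; lra).
    assert (/ (1 + t) <= 1) by (apply inv_le_1; lra).
    assert (0 <= 8 * t ^ 2) by (generalize (pow2_ge_0 t); lra). nra. }
  lra.
Qed.

Lemma drop_exp_sum (a u : R) : 0 < a < 1 ->
  PI * drop_exp a u = cot_sum a (exp u) - cot_sum (1 - a) (exp u).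
Proof.
  intros Ha; assert (H := cot_defect_zero a (exp u) Ha (exp_pos u)).
  unfold cot_defect in H; unfold drop_exp; lra.
Qed.

Lemma drop_ratio (a u : R) : 0 < a < 1 ->
  0 <= sinh (PI * exp u) ^ 2 / (sinh (PI * exp u) ^ 2 + sin (PI * a) ^ 2) <= 1.
Proof.
  intros Ha; assert (Hs := sin_PI_pos a Ha).
  assert (0 <= sinh (PI * exp u) ^ 2) by apply pow2_ge_0.
  assert (0 < sin (PI * a) ^ 2) by (apply pow_lt; auto).
  split; [apply Rdiv_le_0_compat; lra|].
  apply Rmult_le_reg_r with (sinh (PI * exp u) ^ 2 + sin (PI * a) ^ 2); [lra|].
  unfold Rdiv; rewrite Rmult_assoc, Rinv_l; lra.
Qed.

(** The vanishing of order t^2 at t = 0 is read off the partial fractions. *)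
Lemma drop_exp_sqr_bound (a : R) : 0 < a < 1 ->
  exists K, 0 <= K /\ forall u, Rabs (drop_exp a u) <= K * exp (2 * u).
Proof.
  intros Ha; assert (HPI := PI_RGT_0).
  set (M := / a ^ 3 + / (1 - a) ^ 3 + 16).
  assert (H1 : 0 < / a ^ 3) by (apply Rinv_0_lt_compat, pow_lt; lra).
  assert (H2 : 0 < / (1 - a) ^ 3) by (apply Rinv_0_lt_compat, pow_lt; lra).
  exists (M / PI); split; [unfold M; apply Rdiv_le_0_compat; lra|]; intros u.
  assert (Hp : 0 <= exp u ^ 2) by apply pow2_ge_0.
  assert (C1 := cot_sum_le_sqr a (exp u) ltac:(lra) (exp_pos u)).
  assert (C2 := cot_sum_le_sqr (1 - a) (exp u) ltac:(lra) (exp_pos u)).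
  assert (E := drop_exp_sum a u Ha); rewrite exp_2u.
  apply Rmult_le_reg_l with PI; auto.
  rewrite <- (Rabs_right PI) at 1 by lra; rewrite <- Rabs_mult, E.
  replace (PI * (M / PI * exp u ^ 2)) with (M * exp u ^ 2) by (field; lra).
  unfold M; apply Rabs_le; nra.
Qed.

Lemma drop_exp_strip (a : R) : 0 < a < 1 -> mellin_strip (drop_exp a) 1 3.
Proof.
  intros Ha; split; [intros u; apply continuous_drop_exp; auto|].
  destruct (drop_exp_sqr_bound a Ha) as [K [HK HB]].
  exists (K + Rabs (cot_PI a)); intros u.
  assert (H0 := Rabs_pos (cot_PI a)); assert (He := exp_pos (2 * u)).
  split.
  - replace (3 - 1) with 2 by ring; specialize (HB u); nra.
  - replace ((1 - 1) * u) with 0 by ring; rewrite exp_0, Rmult_1_r.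
    unfold drop_exp, cot_drop; fold (cot_PI a); rewrite Rabs_mult.
    assert (R := drop_ratio a u Ha).
    rewrite (Rabs_right (_ / _)) by lra; nra.
Qed.

Lemma exp_minus_1_ge_pow (x : R) (n : nat) : 0 <= x -> (1 <= n)%nat ->
  x ^ n / INR (fact n) <= exp x - 1.
Proof.
  intros Hx Hn; assert (H := exp_ge_taylor x n Hx).
  destruct n as [|n]; [lia|]; rewrite tech5 in H.
  assert (1 <= sum_f_R0 (fun k => x ^ k / INR (fact k)) n).
  { clear H Hn; induction n as [|n IH]; [simpl; lra|].
    rewrite tech5.
    assert (0 <= x ^ S n / INR (fact (S n))); [|lra].
    apply Rdiv_le_0_compat; [apply pow_le; auto|apply INR_fact_lt_0]. }
  lra.
Qed.

Lemma cot_exp_bounded (a u : R) : 0 < a < 1 -> Rabs (cot_exp a u) <= Rabs (cot_PI a).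
Proof.
  intros Ha; assert (Hs := sin_PI_pos a Ha).
  rewrite cot_exp_eq by auto; rewrite Rabs_mult.
  assert (R := drop_ratio a u Ha).
  assert (0 <= sinh (PI * exp u) ^ 2) by apply pow2_ge_0.
  assert (0 < sin (PI * a) ^ 2) by (apply pow_lt; auto).
  assert (E : sin (PI * a) ^ 2 / (sinh (PI * exp u) ^ 2 + sin (PI * a) ^ 2)
    = 1 - sinh (PI * exp u) ^ 2 / (sinh (PI * exp u) ^ 2 + sin (PI * a) ^ 2)) by (field; lra).
  rewrite E, (Rabs_right (1 - _)) by lra.
  generalize (Rabs_pos (cot_PI a)); nra.
Qed.

(** sinh exceeds every power of t, so the Mellin strip of [cot_exp] extends as far to the left as
    desired. *)
Lemma cot_exp_decay (a : R) (n : nat) : 0 < a < 1 -> (1 <= n)%nat ->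
  exists K, 0 <= K /\ forall u, Rabs (cot_exp a u) <= K * exp (- (2 * INR n) * u).
Proof.
  intros Ha Hn; assert (Hs := sin_PI_pos a Ha); assert (HPI := PI_RGT_0).
  set (F := INR (fact n)); assert (HF : 0 < F) by apply INR_fact_lt_0.
  assert (H0 := Rabs_pos (cot_PI a)).
  assert (HPn : 0 < PI ^ n) by (apply pow_lt; auto).
  (* From sinh x >= (exp x - 1) / 2 >= x^n / (2 n!) at x = PI t. *)
  set (c := (PI ^ n / F) / 2); assert (Hc : 0 < c) by (unfold c; repeat apply Rdiv_lt_0_compat; lra).
  exists (Rabs (cot_PI a) / c ^ 2); split; [apply Rdiv_le_0_compat; [auto|apply pow_lt; auto]|].
  intros u; assert (Ht := exp_pos u).
  assert (Hx : 0 < PI * exp u) by (apply Rmult_lt_0_compat; auto).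
  assert (HS : c * exp u ^ n <= sinh (PI * exp u)).
  { assert (H := exp_minus_1_ge_pow (PI * exp u) n ltac:(lra) Hn).
    rewrite Rpow_mult_distr in H; unfold sinh.
    assert (exp (- (PI * exp u)) <= 1) by (rewrite <- exp_0; apply exp_le; lra).
    unfold c; fold F in H.
    replace (PI ^ n / F / 2 * exp u ^ n) with ((PI ^ n * exp u ^ n / F) / 2) by (field; lra). lra. }
  assert (Hpn : 0 < exp u ^ n) by (apply pow_lt; auto).
  assert (HS2 : (c * exp u ^ n) ^ 2 <= sinh (PI * exp u) ^ 2).
  { apply pow_incr; split; [apply Rmult_le_pos; lra|auto]. }
  assert (Hcp : 0 < (c * exp u ^ n) ^ 2) by (apply pow_lt, Rmult_lt_0_compat; auto).
  rewrite cot_exp_eq by auto; rewrite Rabs_mult.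
  replace (Rabs (cot_PI a) / c ^ 2 * exp (- (2 * INR n) * u)) with (Rabs (cot_PI a) * / (c * exp u ^ n) ^ 2).
  - apply Rmult_le_compat_l; auto.
    assert (Hs2 : 0 < sin (PI * a) ^ 2) by (apply pow_lt; auto).
    assert (Hs1 : sin (PI * a) ^ 2 <= 1) by (generalize (SIN_bound (PI * a)); nra).
    rewrite Rabs_right by (apply Rle_ge, Rdiv_le_0_compat; lra).
    apply Rle_trans with (1 * / (c * exp u ^ n) ^ 2); [|lra].
    apply Rmult_le_compat; try lra.
    + left; apply Rinv_0_lt_compat; lra.
    + apply Rinv_le_contravar; lra.
  - replace (- (2 * INR n) * u) with (- (INR n * u + INR n * u)) by ring.
    rewrite exp_Ropp, exp_plus.
    rewrite exp_INR_mult; field; split; lra.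
Qed.

Lemma cot_exp_strip (a : R) (n : nat) : 0 < a < 1 -> (1 <= n)%nat ->
  mellin_strip (cot_exp a) (1 - 2 * INR n) 1.
Proof.
  intros Ha Hn; split; [intros u; apply continuous_cot_exp; auto|].
  destruct (cot_exp_decay a n Ha Hn) as [K [HK H]].
  exists (K + Rabs (cot_PI a)); intros u; assert (H0 := Rabs_pos (cot_PI a)).
  split.
  - replace ((1 - 1) * u) with 0 by ring; rewrite exp_0, Rmult_1_r.
    assert (B := cot_exp_bounded a u Ha); lra.
  - replace ((1 - 2 * INR n - 1) * u) with (- (2 * INR n) * u) by ring.
    specialize (H u); generalize (exp_pos (- (2 * INR n) * u)); nra.
Qed.

(** The function t^2 / (1 + t^2) at t = exp u, small at 0 and bounded at infinity, as the cotangent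
    terms are. *)
Definition cofermi (u : R) : R := 1 - fermi u.

Lemma cofermi_eq (u : R) : cofermi u = exp (2 * u) * fermi u.
Proof. unfold cofermi, fermi; assert (H := exp_pos (2 * u)); field; lra. Qed.

Lemma fermi_bounds (u : R) : 0 < fermi u <= 1 /\ fermi u <= exp (- (2 * u)).
Proof.
  unfold fermi; assert (H := exp_pos (2 * u)); repeat split.
  - apply Rinv_0_lt_compat; lra.
  - apply inv_le_1; lra.
  - rewrite exp_Ropp; apply Rinv_le_contravar; lra.
Qed.

Lemma cofermi_strip : mellin_strip cofermi 1 3.
Proof.
  split.
  - intros u; apply (continuous_minus (V := R_NormedModule) (fun _ => 1) fermi);
      [apply continuous_const|apply continuous_fermi].
  - exists 1; intros u; assert (F := fermi_bounds u); assert (H := exp_pos (2 * u)); split.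
    + rewrite cofermi_eq, Rabs_right by nra; replace (3 - 1) with 2 by ring; nra.
    + replace ((1 - 1) * u) with 0 by ring; rewrite exp_0; unfold cofermi.
      apply Rabs_le; lra.
Qed.

(** The extra factor t^2 is a shift of s by 2, which moves the strip (-1, 1) to (1, 3). *)
Lemma mellin_cofermi (s : C) : 1 < Re s < 3 -> mellin cofermi s = mellin fermi (s - 2)%C.
Proof.
  intros Hs; apply line_integral_unique.
  apply (is_line_integral_ext (mellin_integrand fermi (s - 2)%C)).
  - intros u; unfold mellin_integrand; rewrite cofermi_eq, RtoC_mult, <- Cexp_RtoC, Cmult_assoc, <- Cexp_plus.
    do 2 f_equal; rewrite RtoC_mult; ring.
  - apply is_mellin with (- 1) 1; [apply fermi_strip|].
    unfold Cminus; rewrite re_plus, re_opp, re_RtoC; lra.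
Qed.

Lemma two_cos_shift (s : C) : two_cos (s - 2) = (- two_cos s)%C.
Proof.
  unfold two_cos.
  replace (half_pi_i * (s - 2))%C with (half_pi_i * s + - (half_pi_i + half_pi_i))%C by ring.
  replace (- half_pi_i * (s - 2))%C with (- half_pi_i * s + (half_pi_i + half_pi_i))%C by ring.
  rewrite !Cexp_plus, Cexp_inv, Cexp_plus, Cexp_half_pi_i, Ci_sqr.
  field; intros H; apply C1_nz; rewrite <- (Copp_0), <- H; ring.
Qed.

Lemma mellin_cofermi_two_cos (s : C) : 1 < Re s < 3 ->
  (mellin cofermi s * two_cos s)%C = (- PI)%C.
Proof.
  intros Hs; rewrite mellin_cofermi by auto.
  replace (two_cos s) with (- two_cos (s - 2))%C by (rewrite two_cos_shift; ring).
  assert (H := mellin_fermi_two_cos (s - 2)%C); rewrite <- H; [ring|].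
  unfold Cminus; rewrite re_plus, re_opp, re_RtoC; lra.
Qed.

(* Rescaling t by b is a translation of u by ln b. *)
Lemma mellin_cot_term (b : R) (s : C) : 0 < b -> 1 < Re s < 3 ->
  is_line_integral (mellin_integrand (fun u => cot_term b (exp u)) s)
    (cpow_neg b s * mellin cofermi s)%C.
Proof.
  intros Hb Hs.
  assert (L := is_line_integral_scal (cpow_neg b s) _ _
    (is_line_integral_shift _ _ (- ln b) (is_mellin cofermi 1 3 s cofermi_strip Hs))).
  refine (is_line_integral_ext _ _ _ _ L).
  intros u; unfold mellin_integrand; rewrite cpow_neg_Cexp.
  assert (E : (Cexp (- s * ln b) * Cexp ((u + - ln b)%R * (1 - s)) = Cexp (u * (1 - s)) * RtoC (/ b))%C).
  { rewrite <- (exp_ln b) at 3 by auto; rewrite <- exp_Ropp, <- Cexp_RtoC, <- !Cexp_plus; f_equal.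
    rewrite RtoC_plus, RtoC_opp; ring. }
  rewrite Cmult_assoc, E, <- Cmult_assoc, <- RtoC_mult; do 2 f_equal.
  rewrite cofermi_eq; unfold fermi, cot_term.
  rewrite exp_2u, exp_plus, exp_Ropp, exp_ln by auto.
  assert (H := exp_pos u); field; split; [|nra].
  assert (0 < exp u ^ 2) by (apply pow_lt; auto); nra.
Qed.

Notation C_sum_n f n := (@sum_n C_AbsRing f n : C).
Notation is_Cseries f l := (@is_series C_AbsRing C_NormedModule f (l : C)).

Lemma is_Cseries_eps (f : nat -> C) (l : C) :
  is_Cseries f l <-> forall eps, 0 < eps -> exists N, forall n, (N <= n)%nat ->
    Cmod (C_sum_n f n - l) < eps.
Proof.
  split.
  - intros H eps He.
    destruct (proj1 (filterlim_locally_ball_norm (U := C_NormedModule) (sum_n f) l) H (mkposreal eps He)) as [N HN].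
    exists N; intros n Hn; exact (HN n Hn).
  - intros H; apply (filterlim_locally_ball_norm (U := C_NormedModule) (sum_n f) l); intros eps.
    destruct (H eps (cond_pos eps)) as [N HN]; exists N; intros n Hn; exact (HN n Hn).
Qed.

Lemma C_sum_n_S (f : nat -> C) (n : nat) : C_sum_n f (S n) = (C_sum_n f n + f (S n))%C.
Proof. exact (sum_Sn (G := C_AbsRing) f n). Qed.

Lemma C_sum_n_0 (f : nat -> C) : C_sum_n f 0 = f 0%nat.
Proof. exact (sum_O (G := C_AbsRing) f). Qed.

Lemma is_line_integral_cot_partial (a : R) (s : C) (N : nat) : 0 < a <= 1 -> 1 < Re s < 3 ->
  is_line_integral (mellin_integrand (fun u => sum_n (fun k => cot_term (INR k + a) (exp u)) N) s)
    (C_sum_n (fun k => cpow_neg (INR k + a) s) N * mellin cofermi s)%C.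
Proof.
  intros Ha Hs; induction N as [|N IH].
  - rewrite C_sum_n_0.
    refine (is_line_integral_ext _ _ _ _ (mellin_cot_term (INR 0 + a) s _ Hs)); [|simpl; lra].
    intros u; unfold mellin_integrand; rewrite sum_O; reflexivity.
  - rewrite C_sum_n_S, Cmult_plus_distr_r.
    assert (Hp : 0 < INR (S N) + a) by (generalize (pos_INR (S N)); lra).
    refine (is_line_integral_ext _ _ _ _ (is_line_integral_plus _ _ _ _ IH (mellin_cot_term _ s Hp Hs))).
    intros u; unfold mellin_integrand; rewrite sum_Sn.
    match goal with |- context [plus ?x ?y] => change (plus x y) with (x + y) end.
    rewrite RtoC_plus; ring.
Qed.

(** The tail majorant t^2 / (1 + t) at t = exp u; its strip (2, 3) fixes the range of s in which the
    zeta series are compared with the integral. *)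
Definition sqr_ratio (u : R) : R := exp (2 * u) / (1 + exp u).

Lemma sqr_ratio_strip : mellin_strip sqr_ratio 2 3.
Proof.
  split.
  - intros u; apply (ex_derive_continuous sqr_ratio u); unfold sqr_ratio; auto_derive.
    generalize (exp_pos u); lra.
  - exists 1; intros u; unfold sqr_ratio; rewrite exp_2u; assert (H := exp_pos u).
    assert (H2 : 0 < exp u ^ 2) by (apply pow_lt; auto).
    rewrite Rabs_right by (apply Rle_ge, Rdiv_le_0_compat; lra).
    assert (Hi : / (1 + exp u) <= 1) by (apply inv_le_1; lra).
    split.
    + replace ((3 - 1) * u) with (2 * u) by ring; rewrite exp_2u; unfold Rdiv; nra.
    + replace ((2 - 1) * u) with u by ring.
      apply Rmult_le_reg_r with (1 + exp u); [lra|].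
      replace (exp u ^ 2 / (1 + exp u) * (1 + exp u)) with (exp u ^ 2) by (field; lra); nra.
Qed.

Lemma drop_exp_partial_sum (a u : R) (N : nat) : 0 < a < 1 ->
  Rabs (PI * drop_exp a u - (sum_n (fun k => cot_term (INR k + a) (exp u)) N
    - sum_n (fun k => cot_term (INR k + (1 - a)) (exp u)) N)) <= 16 / (INR N + 2) * sqr_ratio u.
Proof.
  intros Ha; rewrite drop_exp_sum by auto.
  assert (T1 := cot_sum_tail a (exp u) N ltac:(lra) (exp_pos u)).
  assert (T2 := cot_sum_tail (1 - a) (exp u) N ltac:(lra) (exp_pos u)).
  assert (HN := pos_INR N); assert (H := exp_pos u).
  replace (16 * exp u ^ 2 / (1 + exp u) / (INR N + 2)) with (16 / (INR N + 2) * sqr_ratio u) in T1, T2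
    by (unfold sqr_ratio; rewrite exp_2u; field; lra).
  apply Rabs_le; lra.
Qed.

Lemma inv_INR_small (K eps : R) : 0 < eps -> exists N, forall n, (N <= n)%nat -> K / (INR n + 2) < eps.
Proof.
  intros He; destruct (nfloor_ex (Rabs K / eps)) as [N HN].
  { apply Rdiv_le_0_compat; [apply Rabs_pos|auto]. }
  exists N; intros n Hn; apply le_INR in Hn.
  assert (H0 := pos_INR N); assert (H1 := Rle_abs K).
  apply Rmult_lt_reg_r with (INR n + 2); [lra|].
  unfold Rdiv; rewrite Rmult_assoc, Rinv_l, Rmult_1_r by lra.
  assert (E : Rabs K = eps * (Rabs K / eps)) by (field; lra).
  assert (Rabs K / eps < INR n + 2) by lra.
  nra.
Qed.

(** Exchange of sum and integral: each [cot_term] integrates to k + a to the power - s times one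
    fixed transform, and after N terms the rest is dominated by 16 / (N + 2) times [sqr_ratio]. *)
Lemma mellin_drop_exp (a : R) (s zeta1 zeta2 : C) : 0 < a < 1 -> 2 < Re s < 3 ->
  is_Cseries (fun k => cpow_neg (INR k + a) s) zeta1 ->
  is_Cseries (fun k => cpow_neg (INR k + (1 - a)) s) zeta2 ->
  (RtoC PI * mellin (drop_exp a) s = (zeta1 - zeta2) * mellin cofermi s)%C.
Proof.
  intros Ha Hs H1 H2.
  destruct (mellin_integrand_decay sqr_ratio 2 3 s sqr_ratio_strip Hs) as [K [d [Hd [HK [_ HB]]]]].
  set (L := mellin cofermi s) in *; set (X := (RtoC PI * mellin (drop_exp a) s)%C).
  assert (HN : forall N, Cmod (X - (C_sum_n (fun k => cpow_neg (INR k + a) s) N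
      - C_sum_n (fun k => cpow_neg (INR k + (1 - a)) s) N) * L) <= (64 * K / d) / (INR N + 2)).
  { intros N.
    assert (I1 := is_line_integral_cot_partial a s N ltac:(lra) ltac:(lra)).
    assert (I2 := is_line_integral_cot_partial (1 - a) s N ltac:(lra) ltac:(lra)).
    assert (I3 := is_line_integral_scal (RtoC PI) _ _ (is_mellin _ 1 3 s (drop_exp_strip a Ha) ltac:(lra))).
    assert (I := is_line_integral_minus _ _ _ _ I3 (is_line_integral_minus _ _ _ _ I1 I2)).
    assert (Hn := pos_INR N).
    replace (64 * K / d / (INR N + 2)) with (4 * (16 / (INR N + 2) * K) / d) by (field; lra).
    unfold X.
    replace (RtoC PI * mellin (drop_exp a) s - (C_sum_n (fun k => cpow_neg (INR k + a) s) N
      - C_sum_n (fun k => cpow_neg (INR k + (1 - a)) s) N) * L)%C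
      with (RtoC PI * mellin (drop_exp a) s - (C_sum_n (fun k => cpow_neg (INR k + a) s) N * L
      - C_sum_n (fun k => cpow_neg (INR k + (1 - a)) s) N * L))%C by ring.
    refine (line_integral_bound _ _ _ d Hd I _).
    intros u; specialize (HB u).
    rewrite Cmod_mellin_integrand in HB; unfold mellin_integrand.
    set (P := sum_n (fun k => cot_term (INR k + a) (exp u)) N) in *.
    set (Q := sum_n (fun k => cot_term (INR k + (1 - a)) (exp u)) N) in *.
    replace (RtoC PI * (Cexp (u * (1 - s)) * drop_exp a u) - (Cexp (u * (1 - s)) * P - Cexp (u * (1 - s)) * Q))%C
      with (Cexp (u * (1 - s)) * RtoC (PI * drop_exp a u - (P - Q)))%C
      by (rewrite !RtoC_minus, RtoC_mult; ring).
    rewrite Cmod_mult, Cmod_Cexp, Cmod_R.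
    replace (Re (u * (1 - s))) with (u * (1 - Re s)) by (destruct s; simpl; ring).
    assert (B := drop_exp_partial_sum a u N Ha); fold P in B; fold Q in B.
    assert (S0 : 0 <= 16 / (INR N + 2)) by (apply Rdiv_le_0_compat; lra).
    assert (E0 := exp_pos (u * (1 - Re s))).
    rewrite (Rabs_right (sqr_ratio u)) in HB.
    - apply Rle_trans with (exp (u * (1 - Re s)) * (16 / (INR N + 2) * sqr_ratio u)).
      + apply Rmult_le_compat_l; lra.
      + replace (exp (u * (1 - Re s)) * (16 / (INR N + 2) * sqr_ratio u))
          with (16 / (INR N + 2) * (exp (u * (1 - Re s)) * sqr_ratio u)) by ring.
        rewrite Rmult_assoc; apply Rmult_le_compat_l; auto.
    - apply Rle_ge; unfold sqr_ratio; left; apply Rdiv_lt_0_compat; [apply exp_pos|].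
      generalize (exp_pos u); lra. }
  apply Ceq_minus, Cmod_eq_0, Rle_antisym; [|apply Cmod_ge_0].
  apply le_epsilon; intros eps He; rewrite Rplus_0_l.
  assert (HL := Cmod_ge_0 L).
  set (eta := eps / 2 / (2 * (Cmod L + 1))).
  assert (Heta : 0 < eta) by (unfold eta; repeat apply Rdiv_lt_0_compat; lra).
  destruct (proj1 (is_Cseries_eps _ _) H1 eta Heta) as [N1 HN1].
  destruct (proj1 (is_Cseries_eps _ _) H2 eta Heta) as [N2 HN2].
  destruct (inv_INR_small (64 * K / d) (eps / 2) ltac:(lra)) as [N3 HN3].
  set (N := (N1 + N2 + N3)%nat).
  specialize (HN1 N ltac:(unfold N; lia)); specialize (HN2 N ltac:(unfold N; lia)).
  specialize (HN3 N ltac:(unfold N; lia)); specialize (HN N).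
  set (A := C_sum_n (fun k => cpow_neg (INR k + a) s) N) in *.
  set (B := C_sum_n (fun k => cpow_neg (INR k + (1 - a)) s) N) in *.
  replace (X - (zeta1 - zeta2) * L)%C
    with ((X - (A - B) * L) + ((A - zeta1) - (B - zeta2)) * L)%C by ring.
  eapply Rle_trans; [apply Cmod_triangle|]; rewrite Cmod_mult.
  assert (T := Cmod_minus_triangle (A - zeta1) (B - zeta2)).
  assert (Cmod (A - zeta1 - (B - zeta2)) * Cmod L <= (2 * eta) * (Cmod L + 1))
    by (apply Rmult_le_compat; try apply Cmod_ge_0; lra).
  replace (2 * eta * (Cmod L + 1)) with (eps / 2) in H by (unfold eta; field; lra).
  lra.
Qed.

(** Subtracting cot (PI a) / (1 + t^2) removes the value at t = 0, leaving O(t^2) there, and adds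
    only O(t^(-2)) at infinity; hence the wide strip (-1, 3). *)
Definition cot_exp_regular (a u : R) : R := cot_exp a u - cot_PI a * fermi u.

Lemma cot_exp_regular_eq (a u : R) : cot_exp_regular a u = - drop_exp a u + cot_PI a * cofermi u.
Proof. unfold cot_exp_regular, cot_exp, cofermi; ring. Qed.

Lemma cot_exp_regular_strip (a : R) : 0 < a < 1 -> mellin_strip (cot_exp_regular a) (- 1) 3.
Proof.
  intros Ha; split.
  - intros u; apply (continuous_minus (V := R_NormedModule) (cot_exp a) (fun u => cot_PI a * fermi u)).
    + apply continuous_cot_exp; auto.
    + apply (continuous_scal_r (V := R_NormedModule) (cot_PI a) fermi), continuous_fermi.
  - destruct (drop_exp_sqr_bound a Ha) as [K1 [HK1 B1]].
    destruct (cot_exp_decay a 1 Ha (Nat.le_refl 1)) as [K2 [HK2 B2]].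
    exists (K1 + K2 + Rabs (cot_PI a)); intros u.
    specialize (B1 u); specialize (B2 u); simpl INR in B2.
    assert (F := fermi_bounds u); assert (H0 := Rabs_pos (cot_PI a)).
    assert (E1 := exp_pos (2 * u)); assert (E2 := exp_pos (- (2 * u))).
    split.
    + rewrite cot_exp_regular_eq; replace ((3 - 1) * u) with (2 * u) by ring.
      eapply Rle_trans; [apply Rabs_triang|]; rewrite Rabs_Ropp, Rabs_mult.
      rewrite cofermi_eq, (Rabs_right (exp (2 * u) * fermi u)) by nra.
      assert (exp (2 * u) * fermi u <= exp (2 * u)) by nra.
      assert (Rabs (cot_PI a) * (exp (2 * u) * fermi u) <= Rabs (cot_PI a) * exp (2 * u)) by (apply Rmult_le_compat_l; auto).
      nra.
    + unfold cot_exp_regular; replace ((- 1 - 1) * u) with (- (2 * u)) by ring.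
      replace (- (2 * 1) * u) with (- (2 * u)) in B2 by ring.
      unfold Rminus; eapply Rle_trans; [apply Rabs_triang|]; rewrite Rabs_Ropp, Rabs_mult.
      rewrite (Rabs_right (fermi u)) by lra.
      assert (Rabs (cot_PI a) * fermi u <= Rabs (cot_PI a) * exp (- (2 * u))) by (apply Rmult_le_compat_l; lra).
      nra.
Qed.

(** The added constant is cot (PI a) times the secant integral PI of the subtracted 1 / (1 + t^2),
    continued past Re s = 1. *)
Definition continuation_mid (a : R) (s : C) : C :=
  (two_cos s * mellin (cot_exp_regular a) s + RtoC (PI * cot_PI a))%C.

Definition continuation_left (a : R) (s : C) : C := (two_cos s * mellin (cot_exp a) s)%C.

Lemma Cder_two_cos (s : C) :
  Cder two_cos s (half_pi_i * Cexp (half_pi_i * s) + - half_pi_i * Cexp (- half_pi_i * s))%C.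
Proof.
  apply (Cder_plus (fun s => Cexp (half_pi_i * s)%C) (fun s => Cexp (- half_pi_i * s)%C)); apply Cder_Cexp_scal.
Qed.

Lemma continuation_mid_holomorphic (a : R) (s : C) : 0 < a < 1 -> - 1 < Re s < 3 ->
  exists l, Cder (continuation_mid a) s l.
Proof.
  intros Ha Hs.
  destruct (mellin_holomorphic _ _ _ s (cot_exp_regular_strip a Ha) Hs) as [l Hl].
  eexists; apply Cder_plus; [|apply Cder_const].
  eapply (Cder_mult two_cos (mellin (cot_exp_regular a)) s _ l); [apply Cder_two_cos|exact Hl].
Qed.

Lemma exists_cot_exp_strip (a : R) (s : C) : 0 < a < 1 -> Re s < 1 ->
  exists lo, mellin_strip (cot_exp a) lo 1 /\ lo < Re s < 1.
Proof.
  intros Ha Hs; destruct (nfloor_ex (1 - Re s)) as [n Hn]; [lra|].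
  exists (1 - 2 * INR (S n)); split; [apply cot_exp_strip; [auto|lia]|].
  rewrite S_INR; generalize (pos_INR n); lra.
Qed.

Lemma continuation_left_holomorphic (a : R) (s : C) : 0 < a < 1 -> Re s < 1 ->
  exists l, Cder (continuation_left a) s l.
Proof.
  intros Ha Hs; destruct (exists_cot_exp_strip a s Ha Hs) as [lo [Hst Hlo]].
  destruct (mellin_holomorphic _ _ _ s Hst Hlo) as [l Hl].
  eexists; eapply (Cder_mult two_cos (mellin (cot_exp a)) s _ l); [apply Cder_two_cos|exact Hl].
Qed.

Lemma continuation_mid_left (a : R) (s : C) : 0 < a < 1 -> - 1 < Re s < 1 ->
  continuation_mid a s = continuation_left a s.
Proof.
  intros Ha Hs; unfold continuation_mid, continuation_left.
  assert (H := mellin_fermi_two_cos s Hs).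
  assert (E : mellin (cot_exp_regular a) s = (mellin (cot_exp a) s - cot_PI a * mellin fermi s)%C).
  { apply line_integral_unique.
    destruct (exists_cot_exp_strip a s Ha ltac:(lra)) as [lo [Hst Hlo]].
    refine (is_line_integral_ext _ _ _ _ (is_line_integral_minus _ _ _ _ (is_mellin _ _ _ s Hst Hlo)
      (is_line_integral_scal (cot_PI a) _ _ (is_mellin fermi (- 1) 1 s fermi_strip Hs)))).
    intros u; unfold mellin_integrand, cot_exp_regular; rewrite RtoC_minus, RtoC_mult; ring. }
  rewrite E, RtoC_mult, <- H; ring.
Qed.

(** After multiplication by [two_cos], each occurrence of the transform of [cofermi] becomes - PI:
    one cancels the constant PI cot (PI a), the other leaves the difference of the two series. *)
Lemma continuation_mid_zeta (a : R) (s zeta1 zeta2 : C) : 0 < a < 1 -> 2 < Re s < 3 ->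
  is_Cseries (fun k => cpow_neg (INR k + a) s) zeta1 ->
  is_Cseries (fun k => cpow_neg (INR k + (1 - a)) s) zeta2 ->
  (zeta1 - zeta2)%C = continuation_mid a s.
Proof.
  intros Ha Hs H1 H2; unfold continuation_mid.
  assert (HD := mellin_drop_exp a s zeta1 zeta2 Ha Hs H1 H2).
  assert (HC := mellin_cofermi_two_cos s ltac:(lra)).
  assert (HPI : RtoC PI <> 0%C) by (apply RtoC_nz; generalize PI_RGT_0; lra).
  assert (E : mellin (cot_exp_regular a) s = (cot_PI a * mellin cofermi s - mellin (drop_exp a) s)%C).
  { apply line_integral_unique.
    refine (is_line_integral_ext _ _ _ _ (is_line_integral_minus _ _ _ _
      (is_line_integral_scal (cot_PI a) _ _ (is_mellin cofermi 1 3 s cofermi_strip ltac:(lra)))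
      (is_mellin _ _ _ s (drop_exp_strip a Ha) ltac:(lra)))).
    intros u; unfold mellin_integrand; rewrite cot_exp_regular_eq, RtoC_plus, RtoC_mult, RtoC_opp; ring. }
  rewrite E.
  replace (two_cos s * (cot_PI a * mellin cofermi s - mellin (drop_exp a) s) + RtoC (PI * cot_PI a))%C
    with (cot_PI a * (mellin cofermi s * two_cos s) - / PI * two_cos s * (PI * mellin (drop_exp a) s) + PI * cot_PI a)%C
    by (rewrite RtoC_mult; field; auto).
  rewrite HD, HC.
  replace (/ PI * two_cos s * ((zeta1 - zeta2) * mellin cofermi s))%C
    with (/ PI * (zeta1 - zeta2) * (mellin cofermi s * two_cos s))%C by ring.
  rewrite HC; field; auto.
Qed.

(** The local formulas are glued into one function on the plane without 1, so that unique
    continuation applies once. *)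
Lemma hurwitz_difference_left (Z : R -> C -> C) (a : R) (s : C) : is_hurwitz_zeta Z ->
  0 < a < 1 -> Re s < 0 -> (Z a s - Z (1 - a)%R s)%C = continuation_left a s.
Proof.
  intros HZ Ha Hs.
  destruct (HZ a ltac:(lra)) as [D1 S1]; destruct (HZ (1 - a) ltac:(lra)) as [D2 S2].
  set (D := fun z => (Z a z - Z (1 - a)%R z)%C).
  assert (HD : forall z : C, z <> RtoC 1 -> exists l, Cder D z l).
  { intros z Hz; destruct (D1 z Hz) as [l1 H1]; destruct (D2 z Hz) as [l2 H2].
    exists (l1 - l2)%C; apply Cder_minus; auto. }
  (* For Re z >= 5 / 2 the difference is subtracted from itself. The seams lie where neighbouring
     formulas agree: at 5 / 2 inside the range 2 < Re z < 3 of the series, at 0 inside the strip -1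
     < Re z < 1. *)
  set (f := fun z : C => (D z - (if Rle_dec (5 / 2) (Re z) then D z
     else if Rle_dec 0 (Re z) then continuation_mid a z else continuation_left a z))%C).
  assert (Hright : forall z : C, 2 < Re z -> f z = 0%C).
  { intros z Hz; unfold f; destruct (Rle_dec (5 / 2) (Re z)); [ring|].
    destruct (Rle_dec 0 (Re z)); [|lra].
    unfold D; rewrite (continuation_mid_zeta a z (Z a z) (Z (1 - a) z)); auto; [ring|lra| |];
      [apply S1|apply S2]; lra. }
  assert (Hf : forall z : C, z <> RtoC 1 -> exists l, Cder f z l).
  { intros z Hz.
    assert (Hnear : forall w : C, forall del, Cmod (w - z) < del -> Re z - del < Re w < Re z + del).
    { intros w del Hw; assert (H := Rle_lt_trans _ _ _ (re_le_Cmod (w - z)) Hw).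
      unfold Cminus in H; rewrite re_plus, re_opp in H; apply Rabs_def2 in H; lra. }
    destruct (HD z Hz) as [lD HlD].
    destruct (Rlt_le_dec 2 (Re z)) as [Hz2|Hz2].
    { exists 0%C; apply (Cder_ext_near (fun _ => RtoC 0) f z _ (Re z - 2)); [lra| |apply Cder_const].
      intros w Hw; apply Hnear in Hw; symmetry; apply Hright; lra. }
    destruct (Rlt_le_dec (Re z) 0) as [Hz0|Hz0].
    { destruct (continuation_left_holomorphic a z Ha ltac:(lra)) as [l Hl].
      exists (lD - l)%C; apply (Cder_ext_near (fun w => D w - continuation_left a w)%C f z _ (- Re z)); [lra| |].
      - intros w Hw; apply Hnear in Hw; unfold f.
        destruct (Rle_dec (5 / 2) (Re w)); [lra|]; destruct (Rle_dec 0 (Re w)); [lra|reflexivity].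
      - apply Cder_minus; auto. }
    destruct (continuation_mid_holomorphic a z Ha ltac:(lra)) as [l Hl].
    (* Here 0 <= Re z <= 2, so radius 1 / 2 keeps Re w below 5 / 2 and above - 1. *)
    exists (lD - l)%C; apply (Cder_ext_near (fun w => D w - continuation_mid a w)%C f z _ (/ 2)); [lra| |].
    - intros w Hw; apply Hnear in Hw; unfold f.
      destruct (Rle_dec (5 / 2) (Re w)); [lra|]; destruct (Rle_dec 0 (Re w)); [reflexivity|].
      rewrite continuation_mid_left; auto; lra.
    - apply Cder_minus; auto. }
  assert (H := unique_continuation_left f 2 Hf Hright s Hs).
  unfold f in H; destruct (Rle_dec (5 / 2) (Re s)); [lra|]; destruct (Rle_dec 0 (Re s)); [lra|].
  apply Ceq_minus; exact H.
Qed.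

(** * The sine series *)

(** With t = exp u, the measure [gamma_density p c u] du is t^(p - 1) exp (- c t) dt. *)
Definition gamma_density (p : nat) (c u : R) : R := exp (INR p * u) * exp (- (c * exp u)).

Lemma continuous_gamma_density (p : nat) (c u : R) : continuous (gamma_density p c) u.
Proof. apply (ex_derive_continuous (gamma_density p c) u); unfold gamma_density; auto_derive; auto. Qed.

Lemma gamma_density_pos (p : nat) (c u : R) : 0 < gamma_density p c u.
Proof. apply Rmult_lt_0_compat; apply exp_pos. Qed.

Lemma gamma_density_decay (p : nat) (c : R) : (1 <= p)%nat -> 0 < c ->
  exists K, 0 <= K /\ forall u, gamma_density p c u <= K * exp (- (1) * Rabs u).
Proof.
  intros Hp Hc.
  set (K := INR (fact (S p)) / c ^ S p).
  assert (Hcp : 0 < c ^ S p) by (apply pow_lt; auto).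
  assert (HF := INR_fact_lt_0 (S p)).
  assert (HK : 0 < K) by (apply Rdiv_lt_0_compat; auto).
  exists (1 + K); split; [lra|]; intros u.
  assert (Ht := exp_pos u); assert (He := exp_pos (- 1 * Rabs u)).
  unfold gamma_density.
  destruct (Rle_lt_dec u 0) as [Hu|Hu].
  - rewrite Rabs_left1 in * by auto; replace (- (1) * - u) with u in * by ring.
    assert (E1 : exp (INR p * u) <= exp u).
    { apply exp_le; assert (1 <= INR p) by (change 1 with (INR 1); apply le_INR; auto); nra. }
    assert (E2 : exp (- (c * exp u)) <= 1) by (rewrite <- exp_0; apply exp_le; nra).
    assert (E3 := exp_pos (- (c * exp u))); assert (E4 := exp_pos (INR p * u)).
    apply Rle_trans with (exp u * 1); [apply Rmult_le_compat; lra|nra].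
  - rewrite Rabs_right in * by lra.
    assert (H := exp_minus_1_ge_pow (c * exp u) (S p) ltac:(nra) ltac:(lia)).
    rewrite Rpow_mult_distr in H.
    assert (Hx : c ^ S p * exp u ^ S p / INR (fact (S p)) = exp u ^ S p / K) by (unfold K; field; lra).
    rewrite Hx in H.
    assert (Htp : 0 < exp u ^ S p) by (apply pow_lt; auto).
    assert (HE : exp u ^ S p / K <= exp (c * exp u)) by lra.
    assert (HE0 : 0 < exp u ^ S p / K) by (apply Rdiv_lt_0_compat; auto).
    apply Rinv_le_contravar in HE; auto.
    rewrite exp_INR_mult; replace (- (1) * u) with (- u) by ring; rewrite !exp_Ropp.
    assert (Htp' : 0 < exp u ^ p) by (apply pow_lt; auto).
    apply Rle_trans with (exp u ^ p * / (exp u ^ S p / K)); [apply Rmult_le_compat_l; lra|].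
    replace (exp u ^ p * / (exp u ^ S p / K)) with (K * / exp u) by (simpl; field; lra).
    assert (0 < / exp u) by (apply Rinv_0_lt_compat; auto); nra.
Qed.

Lemma is_line_integral_gamma_density (p : nat) (c : R) : (1 <= p)%nat -> 0 < c ->
  exists l, is_line_integral (fun u => RtoC (gamma_density p c u)) l.
Proof.
  intros Hp Hc; destruct (gamma_density_decay p c Hp Hc) as [K [_ HK]].
  apply (ex_line_integral _ K 1); [lra| |].
  - intros t; apply RCcont_RtoC, continuous_gamma_density.
  - intros u; rewrite Cmod_R, Rabs_right; auto.
    apply Rle_ge; left; apply gamma_density_pos.
Qed.

Lemma line_integral_derive (F f : R -> R) (l : C) (L1 L2 : R) :
  is_line_integral (fun u => RtoC (f u)) l -> (forall u, is_derive F u (f u)) ->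
  (forall eps, 0 < eps -> exists M, forall A, M <= A -> Rabs (F A - L1) <= eps /\ Rabs (F (- A) - L2) <= eps) ->
  l = RtoC (L1 - L2).
Proof.
  intros Hl HF HL; apply (line_integral_symmetric_limit _ _ _ Hl); intros eps He.
  destruct (HL (eps / 2) ltac:(lra)) as [M HM]; exists M; intros A HA; destruct (HM A HA) as [H1 H2].
  rewrite (RCInt_unique _ _ _ _ (is_RCInt_derive (fun u => RtoC (F u)) (fun u => RtoC (f u)) (- A) A
    (fun t => RCder_RtoC F t (f t) (HF t)) (proj1 Hl))).
  rewrite <- !RtoC_minus, Cmod_R.
  apply Rabs_le_between in H1; apply Rabs_le_between in H2; apply Rabs_le; lra.
Qed.

(** Euler's integral p! / c^(p + 1), by induction: the derivative of the density of index q is q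
    times itself minus c times the density of index q + 1, and it integrates to 0 because the
    density vanishes at both ends. *)
Lemma gamma_density_integral (p : nat) (c : R) : 0 < c ->
  is_line_integral (fun u => RtoC (gamma_density (S p) c u)) (RtoC (INR (fact p) / c ^ S p)).
Proof.
  intros Hc; induction p as [|p IH].
  - destruct (is_line_integral_gamma_density 1 c ltac:(lia) Hc) as [l Hl].
    assert (E : l = RtoC (0 - - / c)).
    { apply (line_integral_derive (fun u => - / c * exp (- (c * exp u))) (gamma_density 1 c)); auto.
      - intros u; unfold gamma_density; simpl INR; rewrite (Rmult_1_l u); auto_derive; [auto|field; lra].
      - intros eps He.
        destruct (exp_decay_eventually (1 + / c ^ 2) 1 eps ltac:(lra) He) as [M [HM0 HM]].
        exists M; intros A HA.
        assert (HeA : exp (- A) <= exp (- (1) * M)) by (apply exp_le; lra).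
        assert (Hp := exp_pos (- A)); assert (Hp2 : 0 < / c ^ 2) by (apply Rinv_0_lt_compat, pow_lt; auto).
        assert (Hic : 0 < / c) by (apply Rinv_0_lt_compat; auto).
        assert (B : (1 + / c ^ 2) * exp (- A) <= eps).
        { apply Rle_trans with ((1 + / c ^ 2) * exp (- (1) * M)); [apply Rmult_le_compat_l; lra|lra]. }
        split.
        + replace (- / c * exp (- (c * exp A)) - 0) with (- (/ c * exp (- (c * exp A)))) by ring.
          rewrite Rabs_Ropp, Rabs_right by (apply Rle_ge, Rmult_le_pos; [lra|left; apply exp_pos]).
          assert (HE : c * exp A <= exp (c * exp A)).
          { apply abs_le_exp; generalize (exp_pos A); nra. }
          assert (0 < c * exp A) by (apply Rmult_lt_0_compat; [auto|apply exp_pos]).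
          apply Rinv_le_contravar in HE; auto; rewrite <- exp_Ropp in HE.
          rewrite Rinv_mult, <- exp_Ropp in HE.
          apply Rle_trans with (/ c * (/ c * exp (- A))); [apply Rmult_le_compat_l; lra|].
          replace (/ c * (/ c * exp (- A))) with (/ c ^ 2 * exp (- A)) by (field; lra). nra.
        + replace (- / c * exp (- (c * exp (- A))) - - / c) with (/ c * (1 - exp (- (c * exp (- A))))) by ring.
          assert (H1 := exp_ineq1_le (- (c * exp (- A)))).
          assert (H2 : exp (- (c * exp (- A))) <= 1) by (rewrite <- exp_0; apply exp_le; nra).
          rewrite Rabs_right by (apply Rle_ge, Rmult_le_pos; lra).
          apply Rle_trans with (/ c * (c * exp (- A))); [apply Rmult_le_compat_l; lra|].
          rewrite <- Rmult_assoc, Rinv_l, Rmult_1_l by lra; nra. }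
    rewrite E in Hl; replace (INR (fact 0) / c ^ 1) with (0 - - / c) by (simpl; field; lra); exact Hl.
  - destruct (is_line_integral_gamma_density (S (S p)) c ltac:(lia) Hc) as [l Hl].
    assert (Hd := is_line_integral_minus _ _ _ _
      (is_line_integral_scal (RtoC (INR (S p))) _ _ IH) (is_line_integral_scal (RtoC c) _ _ Hl)).
    assert (Hd' : is_line_integral (fun u => RtoC (INR (S p) * gamma_density (S p) c u - c * gamma_density (S (S p)) c u))
      (INR (S p) * RtoC (INR (fact p) / c ^ S p) - c * l)%C).
    { refine (is_line_integral_ext _ _ _ _ Hd); intros u; rewrite RtoC_minus, !RtoC_mult; reflexivity. }
    assert (E : (INR (S p) * RtoC (INR (fact p) / c ^ S p) - c * l)%C = RtoC (0 - 0)).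
    { apply (line_integral_derive (gamma_density (S p) c) _ _ 0 0 Hd').
      - intros u; unfold gamma_density; rewrite (S_INR (S p)); set (q := INR (S p)).
        replace (exp ((q + 1) * u)) with (exp (q * u) * exp u) by (rewrite <- exp_plus; f_equal; ring).
        auto_derive; [auto|ring].
      - intros eps He.
        destruct (gamma_density_decay (S p) c ltac:(lia) Hc) as [K [HK0 HK]].
        destruct (exp_decay_eventually K 1 eps ltac:(lra) He) as [M [HM0 HM]].
        assert (B : forall v, M <= Rabs v -> Rabs (gamma_density (S p) c v - 0) <= eps).
        { intros v Hv; rewrite Rminus_0_r, Rabs_right by (apply Rle_ge; left; apply gamma_density_pos).
          specialize (HK v); assert (exp (- (1) * Rabs v) <= exp (- (1) * M)) by (apply exp_le; lra).
          assert (0 < exp (- (1) * Rabs v)) by apply exp_pos; nra. }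
        exists M; intros A HA; split; apply B.
        + rewrite Rabs_right; lra.
        + rewrite Rabs_Ropp, Rabs_right; lra. }
    assert (Hcn : RtoC c <> 0%C) by (apply RtoC_nz; lra).
    assert (E2 : l = RtoC (INR (fact (S p)) / c ^ S (S p))).
    { replace l with (/ c * (INR (S p) * RtoC (INR (fact p) / c ^ S p)
        - (INR (S p) * RtoC (INR (fact p) / c ^ S p) - c * l)))%C by (field; auto).
      rewrite E, <- RtoC_inv, <- RtoC_mult, <- RtoC_minus, <- RtoC_mult by lra.
      f_equal; rewrite fact_simpl, mult_INR.
      assert (c ^ S p <> 0) by (apply pow_nonzero; lra).
      change (c ^ S (S p)) with (c * c ^ S p); field; lra. }
    rewrite <- E2; exact Hl.
Qed.

Definition sine_partial (r th : R) (n : nat) : R := sum_n (fun k => r ^ S k * sin (INR (S k) * th)) n.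

(** The imaginary part of a finite geometric sum in r exp (i th), kept real through sin (x + th) = 2
    cos th sin x - sin (x - th). *)
Lemma sine_partial_closed (r th : R) (n : nat) :
  (1 - 2 * r * cos th + r ^ 2) * sine_partial r th n =
  r * sin th - r ^ S (S n) * sin (INR (S (S n)) * th) + r ^ S (S (S n)) * sin (INR (S n) * th).
Proof.
  unfold sine_partial; induction n as [|n IH].
  - rewrite sum_O; change (INR 1) with 1; change (INR 2) with 2; rewrite Rmult_1_l, sin_2a; simpl; ring.
  - rewrite sum_Sn.
    match goal with |- context [plus ?x ?y] => change (plus x y) with (x + y) end.
    rewrite Rmult_plus_distr_l, IH.
    assert (E : sin (INR (S (S (S n))) * th) = 2 * cos th * sin (INR (S (S n)) * th) - sin (INR (S n) * th)).
    { rewrite (S_INR (S (S n))), (S_INR (S n)).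
      replace ((INR (S n) + 1 + 1) * th) with ((INR (S n) + 1) * th + th) by ring.
      replace (INR (S n) * th) with ((INR (S n) + 1) * th - th) by ring.
      rewrite sin_plus, sin_minus; ring. }
    rewrite E; simpl pow; ring.
Qed.

(** With r = exp (- 2 PI t) and th = 2 PI a, Re cot (PI (a + i t)) equals 2 r sin th / (1 - 2 r cos
    th + r^2). The bound on the remainder holds up to r = 1, that is t = 0, since the denominator
    stays above sin^2 (PI a). *)
Lemma cot_exp_sine_series (a u : R) (n : nat) : 0 < a < 1 ->
  Rabs (cot_exp a u - 2 * sine_partial (exp (- (2 * PI * exp u))) (2 * PI * a) n) <=
  4 / sin (PI * a) ^ 2 * exp (- (2 * PI * exp u)) ^ S (S n).
Proof.
  intros Ha; assert (Hs := sin_PI_pos a Ha).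
  rewrite cot_exp_eq by auto; unfold cot_PI.
  assert (Hr0 := exp_pos (- (PI * exp u))).
  set (rho := exp (- (PI * exp u))) in *.
  assert (Er : exp (- (2 * PI * exp u)) = rho ^ 2).
  { unfold rho; replace (- (2 * PI * exp u)) with (- (PI * exp u) + - (PI * exp u)) by ring.
    rewrite exp_plus; ring. }
  assert (ES : sinh (PI * exp u) = (1 - rho ^ 2) / (2 * rho)).
  { unfold sinh; fold rho; replace (exp (PI * exp u)) with (/ rho).
    - field; lra.
    - unfold rho; rewrite exp_Ropp; field; generalize (exp_pos (PI * exp u)); lra. }
  rewrite Er; set (r := rho ^ 2).
  assert (Hr : 0 < r) by (apply pow_lt; auto).
  replace (2 * PI * a) with (2 * (PI * a)) by ring.
  assert (C := sine_partial_closed r (2 * (PI * a)) n).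
  rewrite cos_2a_sin, sin_2a in C.
  set (s := sin (PI * a)) in *; set (c := cos (PI * a)) in *.
  set (Q := sine_partial r (2 * (PI * a)) n) in *.
  set (s1 := sin (INR (S (S n)) * (2 * (PI * a)))) in *; set (s2 := sin (INR (S n) * (2 * (PI * a)))) in *.
  set (D := (1 - r) ^ 2 + 4 * r * s ^ 2).
  assert (Hs2 : 0 < s ^ 2 <= 1).
  { split; [apply pow_lt; auto|]; assert (B := SIN_bound (PI * a)); fold s in B; nra. }
  (* D is rewritten as (1 - r)^2 (1 - s^2) + s^2 (1 + r)^2, where the second term alone suffices. *)
  assert (HD : s ^ 2 <= D).
  { unfold D; replace ((1 - r) ^ 2 + 4 * r * s ^ 2) with ((1 - r) ^ 2 * (1 - s ^ 2) + s ^ 2 * (1 + r) ^ 2) by ring.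
    assert (0 <= (1 - r) ^ 2 * (1 - s ^ 2)) by (apply Rmult_le_pos; [apply pow2_ge_0|lra]).
    assert (1 <= (1 + r) ^ 2) by nra. nra. }
  replace (1 - 2 * r * (1 - 2 * s * s) + r ^ 2) with D in C by (unfold D; ring).
  assert (Eq : c / s * (s ^ 2 / (sinh (PI * exp u) ^ 2 + s ^ 2)) = 4 * r * s * c / D).
  { rewrite ES; replace (((1 - rho ^ 2) / (2 * rho)) ^ 2 + s ^ 2) with (D / (4 * r)).
    - field; split; lra.
    - unfold D, r; field; lra. }
  rewrite Eq.
  replace (4 * r * s * c / D - 2 * Q) with (2 * (r ^ S (S n) * s1 - r ^ S (S (S n)) * s2) / D).
  2:{ replace (2 * Q) with (2 * (D * Q) / D) by (field; lra); rewrite C; field; lra. }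
  assert (Hr1 : r <= 1).
  { unfold r; assert (rho <= 1); [|nra].
    unfold rho; rewrite <- exp_0; apply exp_le.
    assert (0 < PI * exp u) by (apply Rmult_lt_0_compat; [apply PI_RGT_0|apply exp_pos]); lra. }
  assert (HP : 0 < r ^ S (S n)) by (apply pow_lt; auto).
  assert (B1 := SIN_bound (INR (S (S n)) * (2 * (PI * a)))); fold s1 in B1.
  assert (B2 := SIN_bound (INR (S n) * (2 * (PI * a)))); fold s2 in B2.
  change (r ^ S (S (S n))) with (r * r ^ S (S n)).
  set (P := r ^ S (S n)) in *.
  assert (HN : Rabs (2 * (P * s1 - r * P * s2)) <= 4 * P).
  { assert (- (1) <= r * s2 <= 1) by nra.
    replace (2 * (P * s1 - r * P * s2)) with (2 * P * (s1 - r * s2)) by ring.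
    rewrite Rabs_mult, (Rabs_right (2 * P)) by lra.
    assert (Rabs (s1 - r * s2) <= 2) by (apply Rabs_le; lra). nra. }
  unfold Rdiv at 1; rewrite Rabs_mult, (Rabs_right (/ D)) by (apply Rle_ge; left; apply Rinv_0_lt_compat; lra).
  replace (4 / s ^ 2 * P) with (4 * P * / s ^ 2) by (field; lra).
  apply Rmult_le_compat; auto using Rabs_pos.
  - left; apply Rinv_0_lt_compat; lra.
  - apply Rinv_le_contravar; lra.
Qed.

(** The integral over t > 0 of t^(2 m - 1) times 2 exp (- 2 PI n t) sin (2 PI n a), with n = k +
    1. *)
Definition sine_moment (a : R) (m k : nat) : R :=
  2 * sin (INR (S k) * (2 * PI * a)) * (INR (fact (2 * m - 1)) / (2 * PI * INR (S k)) ^ (2 * m)).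

Lemma sine_partial_integral (a : R) (m n : nat) : (1 <= m)%nat ->
  is_line_integral (fun u => RtoC (exp (INR (2 * m) * u) * (2 * sine_partial (exp (- (2 * PI * exp u))) (2 * PI * a) n)))
    (C_sum_n (fun k => RtoC (sine_moment a m k)) n).
Proof.
  intros Hm; assert (HPI := PI_RGT_0).
  assert (T : forall k, is_line_integral
    (fun u => RtoC (exp (INR (2 * m) * u) * (2 * (exp (- (2 * PI * exp u)) ^ S k * sin (INR (S k) * (2 * PI * a))))))
    (RtoC (sine_moment a m k))).
  { intros k.
    assert (Hk : 0 < 2 * PI * INR (S k)).
    { apply Rmult_lt_0_compat; [lra|]; rewrite S_INR; generalize (pos_INR k); lra. }
    assert (L := gamma_density_integral (2 * m - 1) (2 * PI * INR (S k)) Hk).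
    replace (S (2 * m - 1)) with (2 * m)%nat in L by lia.
    assert (L' := is_line_integral_scal (RtoC (2 * sin (INR (S k) * (2 * PI * a)))) _ _ L).
    unfold sine_moment; rewrite RtoC_mult.
    refine (is_line_integral_ext _ _ _ _ L'); intros u.
    rewrite <- RtoC_mult; f_equal; unfold gamma_density.
    rewrite <- exp_INR_mult.
    replace (INR (S k) * - (2 * PI * exp u)) with (- (2 * PI * INR (S k) * exp u)) by ring; ring. }
  induction n as [|n IH].
  - rewrite C_sum_n_0; refine (is_line_integral_ext _ _ _ _ (T 0%nat)); intros u.
    unfold sine_partial; rewrite sum_O; reflexivity.
  - rewrite C_sum_n_S.
    refine (is_line_integral_ext _ _ _ _ (is_line_integral_plus _ _ _ _ IH (T (S n)))); intros u.
    unfold sine_partial; rewrite sum_Sn.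
    match goal with |- context [plus ?x ?y] => change (plus x y) with (x + y) end.
    rewrite <- RtoC_plus; f_equal; ring.
Qed.

(** Termwise integration: the remainder carries r^(n + 2), of which one factor r keeps the integral
    convergent and the others make it small. *)
Lemma mellin_cot_exp_series (a : R) (m : nat) : 0 < a < 1 -> (1 <= m)%nat ->
  is_Cseries (fun k => RtoC (sine_moment a m k)) (mellin (cot_exp a) (RtoC (1 - 2 * INR m))).
Proof.
  intros Ha Hm; assert (HPI := PI_RGT_0).
  assert (Hm1 : 1 <= INR m) by (change 1 with (INR 1); apply le_INR; auto).
  set (s0 := RtoC (1 - 2 * INR m)).
  destruct (exists_cot_exp_strip a s0 Ha) as [lo [Hst Hlo]]; [unfold s0; rewrite re_RtoC; lra|].
  assert (L := is_mellin _ _ _ s0 Hst Hlo).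
  destruct (gamma_density_decay (2 * m - 1) (2 * PI) ltac:(lia) ltac:(lra)) as [K [HK0 HK]].
  assert (Hs := sin_PI_pos a Ha).
  assert (Hs2 : 0 < / sin (PI * a) ^ 2) by (apply Rinv_0_lt_compat, pow_lt; auto).
  apply is_Cseries_eps; intros eps He.
  set (W := 4 * / sin (PI * a) ^ 2).
  destruct (inv_INR_small (4 * (W * K)) eps He) as [N HN].
  exists N; intros n Hn; specialize (HN n Hn).
  eapply Rle_lt_trans; [|apply HN].
  rewrite Cmod_sym.
  assert (Hn0 := pos_INR n).
  replace (4 * (W * K) / (INR n + 2)) with (4 * (W / (INR n + 2) * K) / 1) by (field; lra).
  refine (line_integral_bound _ _ _ 1 ltac:(lra) (is_line_integral_minus _ _ _ _ L (sine_partial_integral a m n Hm)) _).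
  intros u; unfold mellin_integrand.
  replace (u * (1 - s0))%C with (RtoC (INR (2 * m) * u)).
  2:{ unfold s0; rewrite <- RtoC_minus, <- RtoC_mult; f_equal; rewrite mult_INR; change (INR 2) with 2; ring. }
  rewrite Cexp_RtoC, <- RtoC_mult, <- RtoC_minus, Cmod_R, <- Rmult_minus_distr_l, Rabs_mult.
  assert (E0 := exp_pos (INR (2 * m) * u)); rewrite (Rabs_right (exp _)) by lra.
  assert (B := cot_exp_sine_series a u n Ha).
  set (r := exp (- (2 * PI * exp u))) in *.
  assert (Hr : 0 < r) by apply exp_pos.
  (* From exp (- x) <= 1 / x. This costs one power of t, which the weight t^(2 m) du can afford as 2
     m - 1 >= 1. *)
  assert (Hrn : r ^ S n <= / exp u * / (INR n + 2)).
  { unfold r; rewrite <- exp_INR_mult.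
    replace (INR (S n) * - (2 * PI * exp u)) with (- (INR (S n) * (2 * PI) * exp u)) by ring.
    rewrite exp_Ropp, <- Rinv_mult.
    assert (Hu := exp_pos u).
    assert (H2 : INR n + 2 <= INR (S n) * (2 * PI)).
    { rewrite S_INR; assert (1 < PI) by (generalize PI2_3_2; lra); nra. }
    apply Rinv_le_contravar; [apply Rmult_lt_0_compat; lra|].
    eapply Rle_trans; [|apply abs_le_exp; apply Rmult_le_pos; lra].
    rewrite Rmult_comm; apply Rmult_le_compat_r; lra. }
  specialize (HK u).
  eapply Rle_trans; [apply Rmult_le_compat_l; [lra|apply B]|].
  apply Rle_trans with (W / (INR n + 2) * gamma_density (2 * m - 1) (2 * PI) u).
  - change (r ^ S (S n)) with (r * r ^ S n).
    assert (Eg : gamma_density (2 * m - 1) (2 * PI) u = exp (INR (2 * m) * u) * / exp u * r).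
    { unfold gamma_density; fold r; f_equal.
      rewrite minus_INR by lia; rewrite Rmult_minus_distr_r; unfold Rminus.
      rewrite exp_plus; f_equal; rewrite <- exp_Ropp; f_equal; simpl; ring. }
    rewrite Eg; unfold W.
    apply Rle_trans with (exp (INR (2 * m) * u) * (4 / sin (PI * a) ^ 2 * (r * (/ exp u * / (INR n + 2))))).
    + apply Rmult_le_compat_l; [lra|]; unfold Rdiv; apply Rmult_le_compat_l; [lra|].
      apply Rmult_le_compat_l; lra.
    + right; field; repeat split; try lra; generalize (exp_pos u); lra.
  - rewrite Rmult_assoc; apply Rmult_le_compat_l; auto.
    unfold W; apply Rdiv_le_0_compat; lra.
Qed.

(** * The derivative at 1 - 2m and the alternating series *)

Lemma Cexp_half_pi_i_even (m : nat) : Cexp (half_pi_i * RtoC (2 * INR m)) = RtoC ((- 1) ^ m).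
Proof.
  induction m as [|m IH].
  - simpl INR; rewrite Rmult_0_r, Cmult_0_r, Cexp_0; reflexivity.
  - rewrite S_INR; replace (half_pi_i * RtoC (2 * (INR m + 1)))%C
      with (half_pi_i * RtoC (2 * INR m) + (half_pi_i + half_pi_i))%C
      by (rewrite !RtoC_mult, RtoC_plus; ring).
    rewrite !Cexp_plus, IH, Cexp_half_pi_i, Ci_sqr.
    replace ((-1) ^ S m) with (- (-1) ^ m) by (simpl; ring); rewrite RtoC_opp; ring.
Qed.

(** The two exponentials are i (-1)^m and - i (-1)^m: they cancel in the cosine and reinforce each
    other in its derivative. *)
Lemma two_cos_at_odd (m : nat) : let s0 := RtoC (1 - 2 * INR m) in
  two_cos s0 = 0%C /\
  (half_pi_i * Cexp (half_pi_i * s0) + - half_pi_i * Cexp (- half_pi_i * s0))%C = RtoC (- PI * (- 1) ^ m).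
Proof.
  intros s0.
  assert (Hpm : (-1) ^ m * (-1) ^ m = 1).
  { rewrite <- Rpow_mult_distr; replace (-1 * -1) with 1 by ring; apply pow1. }
  assert (E2 : Cexp (- half_pi_i * s0) = (- Ci * RtoC ((- 1) ^ m))%C).
  { unfold s0; rewrite RtoC_minus.
    replace (- half_pi_i * (1 - RtoC (2 * INR m)))%C with (- half_pi_i + half_pi_i * RtoC (2 * INR m))%C by ring.
    rewrite Cexp_plus, Cexp_half_pi_i_even, Cexp_inv, Cexp_half_pi_i, Ci_inv; reflexivity. }
  assert (E1 : Cexp (half_pi_i * s0) = (Ci * RtoC ((- 1) ^ m))%C).
  { replace (half_pi_i * s0)%C with (- (- half_pi_i * s0))%C by ring.
    rewrite Cexp_inv, E2.
    assert (Hp : RtoC ((-1) ^ m) <> 0%C) by (apply RtoC_nz, pow_nonzero; lra).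
    transitivity (- / Ci * / RtoC ((-1) ^ m))%C; [field; split; auto using Ci_nz|].
    rewrite Ci_inv, <- RtoC_inv by (apply pow_nonzero; lra).
    replace (/ (-1) ^ m) with ((-1) ^ m); [ring|].
    apply Rmult_eq_reg_l with ((-1) ^ m); [|apply pow_nonzero; lra].
    rewrite Hpm, Rinv_r; [auto|apply pow_nonzero; lra]. }
  split.
  - unfold two_cos; rewrite E1, E2; ring.
  - rewrite E1, E2.
    replace half_pi_i with (RtoC (PI / 2) * Ci)%C
      by (unfold half_pi_i, Ci, RtoC, Cmult; simpl; f_equal; field).
    replace (RtoC (PI / 2) * Ci * (Ci * RtoC ((-1) ^ m)) + - (RtoC (PI / 2) * Ci) * (- Ci * RtoC ((-1) ^ m)))%C
      with (RtoC 2 * RtoC (PI / 2) * (Ci * Ci) * RtoC ((-1) ^ m))%C by ring.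
    rewrite Ci_sqr, <- RtoC_mult.
    replace (- PI * (-1) ^ m) with (- (2 * (PI / 2) * (-1) ^ m)) by field.
    rewrite RtoC_opp, (RtoC_mult (2 * (PI / 2))); ring.
Qed.

(** In the product rule the unknown derivative of the Mellin transform is multiplied by [two_cos s0]
    = 0. *)
Lemma hurwitz_derivative_difference (Z : R -> C -> C) (a : R) (m : nat) : is_hurwitz_zeta Z ->
  0 < a < 1 -> (1 <= m)%nat ->
  let s0 := RtoC (1 - 2 * INR m) in
  (hurwitz_zeta' Z s0 a - hurwitz_zeta' Z s0 (1 - a)%R)%C =
  (RtoC (- PI * (- 1) ^ m) * mellin (cot_exp a) s0)%C.
Proof.
  intros HZ Ha Hm s0.
  assert (Hm1 : 1 <= INR m) by (change 1 with (INR 1); apply le_INR; auto).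
  assert (Hs0 : Re s0 < 0) by (unfold s0; rewrite re_RtoC; lra).
  assert (Hne : s0 <> RtoC 1) by (intros E; rewrite E, re_RtoC in Hs0; lra).
  destruct (HZ a ltac:(lra)) as [D1 _]; destruct (HZ (1 - a) ltac:(lra)) as [D2 _].
  assert (F1 := C_derive_correct (Z a) s0 0%C (D1 s0 Hne)).
  assert (F2 := C_derive_correct (Z (1 - a)) s0 0%C (D2 s0 Hne)).
  unfold hurwitz_zeta'.
  assert (F := Cder_minus _ _ _ _ _ F1 F2).
  destruct (exists_cot_exp_strip a s0 Ha ltac:(lra)) as [lo [Hst Hlo]].
  destruct (mellin_holomorphic _ _ _ s0 Hst Hlo) as [l Hl].
  assert (G := Cder_mult two_cos (mellin (cot_exp a)) s0 _ _ (Cder_two_cos s0) Hl).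
  assert (G' : Cder (fun s => Z a s - Z (1 - a)%R s)%C s0
    ((half_pi_i * Cexp (half_pi_i * s0) + - half_pi_i * Cexp (- half_pi_i * s0)) * mellin (cot_exp a) s0 + two_cos s0 * l)%C).
  { refine (Cder_ext_near _ _ _ _ (- Re s0) ltac:(lra) _ G).
    intros w Hw; symmetry; apply hurwitz_difference_left; auto.
    assert (H := Rle_lt_trans _ _ _ (re_le_Cmod (w - s0)) Hw).
    unfold Cminus in H; rewrite re_plus, re_opp in H; apply Rabs_def2 in H; lra. }
  rewrite (Cder_unique _ _ _ _ F G').
  destruct (two_cos_at_odd m) as [T1 T2]; fold s0 in T1, T2; rewrite T1, T2; ring.
Qed.

Lemma is_Cseries_scal (c : C) (f : nat -> C) (l : C) :
  is_Cseries f l -> is_Cseries (fun k => c * f k)%C (c * l)%C.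
Proof. exact (is_series_scal (V := C_NormedModule) c f l). Qed.

Lemma is_Cseries_minus (f g : nat -> C) (lf lg : C) :
  is_Cseries f lf -> is_Cseries g lg -> is_Cseries (fun k => f k - g k)%C (lf - lg)%C.
Proof. exact (is_series_minus (V := C_NormedModule) f g lf lg). Qed.

Lemma is_Cseries_ext (f g : nat -> C) (l l' : C) :
  (forall k, f k = g k) -> l = l' -> is_Cseries f l -> is_Cseries g l'.
Proof. intros H <-; apply is_series_ext; exact H. Qed.

Lemma is_Cseries_0 : is_Cseries (fun _ => RtoC 0) 0%C.
Proof.
  apply is_Cseries_eps; intros eps He; exists 0%nat; intros n _.
  replace (C_sum_n (fun _ => RtoC 0) n) with (RtoC 0).
  - replace (0 - 0)%C with (RtoC 0) by ring; rewrite Cmod_0; auto.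
  - symmetry; induction n as [|n IH]; [apply C_sum_n_0|rewrite C_sum_n_S, IH; ring].
Qed.

(** The minus sign in - PI (-1)^m reverses the roles of a and 1 - a, and (-1)^m is its own
    inverse. *)
Lemma sine_series_hurwitz (Z : R -> C -> C) (a : R) (m : nat) : is_hurwitz_zeta Z ->
  0 < a < 1 -> (1 <= m)%nat ->
  let s0 := RtoC (1 - 2 * INR m) in
  is_Cseries (fun k => RtoC (sin (INR (S k) * (2 * PI * a)) / INR (S k) ^ (2 * m)))
    (RtoC ((- 1) ^ m * (2 * PI) ^ (2 * m - 1) / INR (fact (2 * m - 1)))
      * (hurwitz_zeta' Z s0 (1 - a)%R - hurwitz_zeta' Z s0 a))%C.
Proof.
  intros HZ Ha Hm s0; assert (HPI := PI_RGT_0).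
  assert (HD := hurwitz_derivative_difference Z a m HZ Ha Hm); fold s0 in HD.
  assert (HF := INR_fact_lt_0 (2 * m - 1)).
  assert (HP : 0 < (2 * PI) ^ (2 * m - 1)) by (apply pow_lt; lra).
  assert (Ep : (2 * PI) ^ (2 * m) = 2 * PI * (2 * PI) ^ (2 * m - 1)).
  { replace (2 * m)%nat with (S (2 * m - 1)) at 1 by lia; reflexivity. }
  (* The inverse of the factor of [sine_moment] that does not depend on k. *)
  set (c := (2 * PI) ^ (2 * m) / (2 * INR (fact (2 * m - 1)))).
  refine (is_Cseries_ext _ _ _ _ _ _ (is_Cseries_scal (RtoC c) _ _ (mellin_cot_exp_series a m Ha Hm))).
  - intros k; rewrite <- RtoC_mult; f_equal; unfold c, sine_moment.
    rewrite (Rpow_mult_distr (2 * PI) (INR (S k))).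
    assert (Hk : 0 < INR (S k)) by (rewrite S_INR; generalize (pos_INR k); lra).
    assert (0 < INR (S k) ^ (2 * m)) by (apply pow_lt; auto).
    assert (0 < (2 * PI) ^ (2 * m)) by (apply pow_lt; lra).
    field; repeat split; lra.
  - fold s0.
    replace (hurwitz_zeta' Z s0 (1 - a)%R - hurwitz_zeta' Z s0 a)%C
      with (- (hurwitz_zeta' Z s0 a - hurwitz_zeta' Z s0 (1 - a)%R))%C by ring.
    rewrite HD.
    replace (RtoC c) with (RtoC ((-1) ^ m * (2 * PI) ^ (2 * m - 1) / INR (fact (2 * m - 1))) * - RtoC (- PI * (-1) ^ m))%C;
      [ring|].
    rewrite <- RtoC_opp, <- RtoC_mult; f_equal; unfold c; rewrite Ep.
    assert (Hpm : (-1) ^ m * (-1) ^ m = 1).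
    { rewrite <- Rpow_mult_distr; replace (-1 * -1) with 1 by ring; apply pow1. }
    transitivity (((-1) ^ m * (-1) ^ m) * (PI * (2 * PI) ^ (2 * m - 1) / INR (fact (2 * m - 1)))); [|rewrite Hpm]; field; lra.
Qed.

(** The alternating series is the plain sine series minus twice its terms of even n. For n = 2 j
    these are sin (j 2 x) / (2 j)^(2 m), so twice their sum is 2^(1 - 2 m) times the sine series at
    2 x, that is at a = x / PI. *)
Theorem mainTheorem3 :
  forall (Z : R -> C -> C), is_hurwitz_zeta Z ->
  forall (m : nat) (x : R), (1 <= m)%nat -> 0 < x < PI ->
  let s0 : C := RtoC (1 - 2 * INR m)%R in
  let z' := hurwitz_zeta' Z s0 in
  is_series
    (fun k : nat =>
       RtoC ((-1) ^ k * sin (INR (k + 1) * x) / INR (k + 1) ^ (2 * m))%R)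
    (Cmult (RtoC ((-1) ^ m * PI ^ (2 * m - 1) / INR (fact (2 * m - 1)))%R)
       (Cplus
         (Cminus
           (Cminus
             (Cmult (RtoC (2 ^ (2 * m - 1))%R) (z' (1 - x / (2 * PI))%R))
             (Cmult (RtoC (2 ^ (2 * m - 1))%R) (z' (x / (2 * PI))%R)))
           (z' (1 - x / PI)%R))
         (z' (x / PI)%R))).
Proof.
  intros Z HZ m x Hm Hx s0 z'; assert (HPI := PI_RGT_0).
  assert (Hx1 : 0 < x / (2 * PI) < 1).
  { split; [apply Rdiv_lt_0_compat; lra|].
    apply Rmult_lt_reg_r with (2 * PI); [lra|]; unfold Rdiv; rewrite Rmult_assoc, Rinv_l; lra. }
  assert (Hx2 : 0 < x / PI < 1).
  { split; [apply Rdiv_lt_0_compat; lra|].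
    apply Rmult_lt_reg_r with PI; [lra|]; unfold Rdiv; rewrite Rmult_assoc, Rinv_l; lra. }
  assert (S1 := sine_series_hurwitz Z (x / (2 * PI)) m HZ Hx1 Hm).
  assert (S2 := sine_series_hurwitz Z (x / PI) m HZ Hx2 Hm).
  cbv zeta in S1, S2; fold s0 in S1, S2; fold z' in S1, S2.
  set (f := fun k : nat => sin (INR (S k) * (2 * PI * (x / (2 * PI)))) / INR (S k) ^ (2 * m)) in S1.
  set (g := fun k : nat => sin (INR (S k) * (2 * PI * (x / PI))) / INR (S k) ^ (2 * m)) in S2.
  (* Indices start at 0: even n = k + 1 means odd k. *)
  set (e := fun k : nat => RtoC (if Nat.even k then 0 else 2 * f k)).
  assert (H2 : 0 < 2 ^ (2 * m - 1)) by (apply pow_lt; lra).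
  assert (E2 : 2 ^ (2 * m) = 2 * 2 ^ (2 * m - 1)).
  { replace (2 * m)%nat with (S (2 * m - 1)) at 1 by lia; reflexivity. }
  assert (He0 : forall j, e (2 * j)%nat = RtoC 0) by (intros j; unfold e; rewrite Nat.even_mul; reflexivity).
  assert (He1 : forall j, e (2 * j + 1)%nat = (RtoC (/ 2 ^ (2 * m - 1)) * RtoC (g j))%C).
  { intros j; unfold e.
    replace (Nat.even (2 * j + 1)) with false by (rewrite Nat.even_add, Nat.even_mul; reflexivity).
    rewrite <- RtoC_mult; f_equal; unfold f, g.
    replace (S (2 * j + 1)) with (2 * S j)%nat by lia.
    rewrite mult_INR; change (INR 2) with 2; rewrite Rpow_mult_distr, E2.
    replace (2 * INR (S j) * (2 * PI * (x / (2 * PI)))) with (INR (S j) * (2 * PI * (x / PI))) by (field; lra).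
    assert (Hj : 0 < INR (S j)) by (rewrite S_INR; generalize (pos_INR j); lra).
    assert (0 < INR (S j) ^ (2 * m)) by (apply pow_lt; auto).
    field; split; lra. }
  assert (Se := is_series_interleave (V := C_NormedModule) e _ _ _ _
    He0 He1 is_Cseries_0 (is_Cseries_scal (RtoC (/ 2 ^ (2 * m - 1))) _ _ S2)).
  refine (is_Cseries_ext _ _ _ _ _ _ (is_Cseries_minus _ _ _ _ S1 Se)).
  - intros k; unfold e; rewrite <- RtoC_minus; f_equal; unfold f.
    replace (2 * PI * (x / (2 * PI))) with x by (field; lra).
    replace (k + 1)%nat with (S k) by lia.
    assert (Hsign : (-1) ^ k = if Nat.even k then 1 else -1).
    { induction k as [|k IH]; [reflexivity|].
      rewrite Nat.even_succ, <- Nat.negb_even; simpl pow; rewrite IH; destruct (Nat.even k); simpl; ring. }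
    rewrite Hsign; destruct (Nat.even k); unfold Rdiv; ring.
  - assert (HF := INR_fact_lt_0 (2 * m - 1)).
    match goal with |- context [plus ?a ?b] => change (plus a b) with (a + b)%C end.
    (* The factor 2^(2 m - 1) split off from (2 PI)^(2 m - 1) survives at x / (2 PI) and cancels
       against 2^(1 - 2 m) at x / PI. *)
    replace (RtoC ((-1) ^ m * (2 * PI) ^ (2 * m - 1) / INR (fact (2 * m - 1))))
      with (RtoC (2 ^ (2 * m - 1)) * RtoC ((-1) ^ m * PI ^ (2 * m - 1) / INR (fact (2 * m - 1))))%C.
    + rewrite RtoC_inv by lra.
      assert (RtoC (2 ^ (2 * m - 1)) <> 0%C) by (apply RtoC_nz; lra).
      field; auto.
    + rewrite <- RtoC_mult; f_equal; rewrite Rpow_mult_distr; field; lra.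
Qed.
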